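(* Let $\Phi_0$ be a strictly plurisubharmonic (real) quadratic form on $\mathbf{C}^n$ and let $Q$ be a (inhomogeneous) quadratic polynomial on $\mathbf{C}^n$ with complex coefficients (in the real coordinates of $\mathbf{C}^n\simeq\mathbf{R}^{2n}$), with principal (homogeneous quadratic) part $q$. Assume that $$\mathrm{Re}\, q(x) < \Phi_{\rm herm}(x) := \tfrac12\left(\Phi_0(x) + \Phi_0(ix)\right),\quad x \neq 0,$$ and $$\det\, \partial_x \partial_{\overline{x}} \left(2\Phi_0 - q\right) \neq 0.$$ Let $a\in C^{\infty}(\Lambda_{\Phi_0})$ be the Weyl symbol of the Toeplitz operator $\mathrm{Top}(e^{Q})$, and assume that $a \in L^{\infty}(\Lambda_{\Phi_0})$. Then the Toeplitz operator $\mathrm{Top}(e^{Q}): H_{\Phi_0}(\mathbf{C}^n) \rightarrow H_{\Phi_0}(\mathbf{C}^n)$ is bounded.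
   Context: $\Lambda_{\Phi_0} = \{(x,\frac{2}{i}\frac{\partial \Phi_0}{\partial x}(x)) : x\in \mathbf{C}^n\} \subset \mathbf{C}^{2n}$, where $\partial/\partial x$ is the holomorphic derivative. The Bargmann space is $H_{\Phi_0}(\mathbf{C}^n) = L^2(\mathbf{C}^n, e^{-2\Phi_0} L(dx)) \cap \mathrm{Hol}(\mathbf{C}^n)$, with $L(dx)$ Lebesgue measure, and $\Pi_{\Phi_0}$ is the orthogonal projection of $L^2(\mathbf{C}^n, e^{-2\Phi_0}L(dx))$ onto $H_{\Phi_0}(\mathbf{C}^n)$. The Toeplitz operator is $\mathrm{Top}(e^Q) = \Pi_{\Phi_0}\circ e^{Q}\circ \Pi_{\Phi_0}$, with its natural (dense) domain $\{u\in H_{\Phi_0}(\mathbf{C}^n): e^{Q}u \in L^2(\mathbf{C}^n, e^{-2\Phi_0}L(dx))\}$; ''bounded'' means bounded on this domain (hence extends to a bounded operator on $H_{\Phi_0}$). The Weyl symbol of $\mathrm{Top}(e^Q)$ is the function $a$ on $\Lambda_{\Phi_0}$ with $\mathrm{Top}(e^Q)=a^w(x,D_x)$ (Weyl quantization realized on $H_{\Phi_0}$), explicitly given by $a(x,\xi) = \left(\exp\left(\tfrac{1}{4} (\Phi''_{0,x\overline{x}})^{-1} \partial_x \cdot \partial_{\overline{x}}\right)e^Q\right)(x)$ for $(x,\xi)\in\Lambda_{\Phi_0}$, equivalently $a(x,\xi)=C_{\Phi_0}\int_{\mathbf{C}^n}\exp(-4\Phi_{\rm herm}(x-y))e^{Q(y)}\,L(dy)$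 for a constant $C_{\Phi_0}\neq 0$. *)

(* Defs.v *)
From mathcomp Require Import all_boot all_order all_algebra complex.
From mathcomp Require Import all_classical all_reals all_analysis.
Set Implicit Arguments. Unset Strict Implicit. Unset Printing Implicit Defensive.
Import Order.TTheory GRing.Theory Num.Theory.
Local Open Scope ring_scope.

Definition cpt (R : realType) (n : nat) := 'I_n -> R[i].

Section Defs.
Variables (R : realType) (n : nat).

Definition cre (z : R[i]) : R := complex.Re z.
Definition cim (z : R[i]) : R := complex.Im z.
Definition cI : R[i] := Complex 0 1.
Definition cR (r : R) : R[i] := Complex r 0.
Definition cabs2 (z : R[i]) : R := cre z ^+ 2 + cim z ^+ 2.
Definition cabs (z : R[i]) : R := Num.sqrt (cabs2 z).
Definition cexp (z : R[i]) : R[i] :=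
  Complex (expR (cre z) * cos (cim z)) (expR (cre z) * sin (cim z)).

Definition vadd (x y : cpt R n) : cpt R n := fun j => x j + y j.
Definition vsub (x y : cpt R n) : cpt R n := fun j => x j - y j.
Definition vscale (c : R[i]) (x : cpt R n) : cpt R n := fun j => c * x j.
Definition vzero : cpt R n := fun _ => 0.
Definition vbasis (j : 'I_n) : cpt R n := fun k => if k == j then 1 else 0.
Definition vupd (x : cpt R n) (j : 'I_n) (z : R[i]) : cpt R n :=
  fun k => if k == j then z else x k.
Definition vnorm (x : cpt R n) : R := Num.sqrt (\sum_j cabs2 (x j)).

(* ---- Lebesgue integration on C^n ~ R^{2n} as iterated 1-d Lebesgue
   integrals over the 2n real coordinates (Re z_j, Im z_j). ---- *)
Local Notation leb := (@lebesgue_measure R).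

(* nonnegative (extended-real) integrand *)
Fixpoint niint_aux (s : seq 'I_n) (F : cpt R n -> \bar R) (x : cpt R n)
  : \bar R :=
  match s with
  | [::] => F x
  | j :: s' => (\int[leb]_a \int[leb]_b niint_aux s' F (vupd x j (Complex a b)))%E
  end.
Definition niint (F : cpt R n -> \bar R) : \bar R :=
  niint_aux (enum 'I_n) F vzero.

Fixpoint riint_aux (s : seq 'I_n) (F : cpt R n -> R) (x : cpt R n) : R :=
  match s with
  | [::] => F x
  | j :: s' => fine (\int[leb]_a
                 (fine (\int[leb]_b (riint_aux s' F (vupd x j (Complex a b)))%:E))%:E)%E
  end.
Definition riint (F : cpt R n -> R) : R := riint_aux (enum 'I_n) F vzero.

Definition ciint (F : cpt R n -> R[i]) : R[i] :=
  Complex (riint (fun x => cre (F x))) (riint (fun x => cim (F x))).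

Definition inL2w (Phi : cpt R n -> R) (f : cpt R n -> R[i]) : Prop :=
  (niint (fun x => (cabs2 (f x) * expR (- 2 * Phi x))%:E) < +oo)%E.
Definition l2normw (Phi : cpt R n -> R) (f : cpt R n -> R[i]) : R :=
  Num.sqrt (fine (niint (fun x => (cabs2 (f x) * expR (- 2 * Phi x))%:E))).
Definition innerw (Phi : cpt R n -> R) (f g : cpt R n -> R[i]) : R[i] :=
  ciint (fun x => f x * conjc (g x) * cR (expR (- 2 * Phi x))).

Definition holomorphic (f : cpt R n -> R[i]) : Prop :=
  forall z : cpt R n, exists c : cpt R n, forall eps : R, 0 < eps ->
    exists2 delta : R, 0 < delta & forall h : cpt R n, vnorm h < delta ->
      cabs (f (vadd z h) - f z - \sum_j c j * h j) <= eps * vnorm h.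

Definition bargmann (Phi : cpt R n -> R) : set (cpt R n -> R[i]) :=
  [set u | holomorphic u /\ inL2w Phi u].

Definition is_proj (Phi : cpt R n -> R) (f g : cpt R n -> R[i]) : Prop :=
  bargmann Phi g /\
  forall v, bargmann Phi v -> innerw Phi (fun x => f x - g x) v = 0.

(* Top(e^Q) = Pi o e^Q o Pi, bounded on its natural domain
   {u in H_Phi : e^Q u in L^2(e^{-2Phi})} *)
Definition toeplitz_exp_bounded (Phi : cpt R n -> R) (Q : cpt R n -> R[i])
  : Prop :=
  exists M : R, forall u : cpt R n -> R[i],
    bargmann Phi u -> inL2w Phi (fun x => cexp (Q x) * u x) ->
    forall g, is_proj Phi (fun x => cexp (Q x) * u x) g ->
      l2normw Phi g <= M * l2normw Phi u.

Definition rqform (A B C : 'M[R]_n) (x : cpt R n) : R :=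
  \sum_j \sum_k (A j k * cre (x j) * cre (x k) + B j k * cre (x j) * cim (x k)
                 + C j k * cim (x j) * cim (x k)).
Definition cqform (A B C : 'M[R[i]]_n) (x : cpt R n) : R[i] :=
  \sum_j \sum_k (A j k * cR (cre (x j) * cre (x k)) + B j k * cR (cre (x j) * cim (x k))
                 + C j k * cR (cim (x j) * cim (x k))).
Definition clform (d e : cpt R n) (x : cpt R n) : R[i] :=
  \sum_j (d j * cR (cre (x j)) + e j * cR (cim (x j))).

Definition phi_herm (Phi : cpt R n -> R) (x : cpt R n) : R :=
  (Phi x + Phi (vscale cI x)) / 2.

(* Complex Hessian (d_x d_xbar P)_{jk} = d^2 P / (dz_j dzbar_k)
   = 1/4 (P_{X_j X_k} + i P_{X_j Y_k} - i P_{Y_j X_k} + P_{Y_j Y_k}),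
   where, for a polynomial P of degree <= 2, the real second derivative
   D^2 P (u, v) is exactly  P(u+v) - P(u) - P(v) + P(0). *)
Definition hess2 (P : cpt R n -> R[i]) (u v : cpt R n) : R[i] :=
  P (vadd u v) - P u - P v + P vzero.
Definition dxdxbar (P : cpt R n -> R[i]) : 'M[R[i]]_n :=
  \matrix_(j, k) (cR (4^-1) *
    (hess2 P (vbasis j) (vbasis k) + cI * hess2 P (vbasis j) (vscale cI (vbasis k))
     - cI * hess2 P (vscale cI (vbasis j)) (vbasis k)
     + hess2 P (vscale cI (vbasis j)) (vscale cI (vbasis k)))).

Definition strictly_psh (Phi : cpt R n -> R) : Prop :=
  forall w : cpt R n, w <> vzero ->
    0 < cre (\sum_j \sum_k dxdxbar (fun x => cR (Phi x)) j k * w j * conjc (w k)).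

(* Weyl symbol of Top(e^Q), up to the nonzero constant C_Phi:
   a(x, xi) = C_Phi * int exp(-4 Phi_herm(x-y)) e^{Q(y)} L(dy), (x,xi) in Lambda_Phi,
   parametrized by x in C^n. *)
Definition weyl_symbol_noconst (Phi : cpt R n -> R) (Q : cpt R n -> R[i])
  (x : cpt R n) : R[i] :=
  ciint (fun y => cexp (cR (- 4 * phi_herm Phi (vsub x y)) + Q y)).

Definition ess_bounded (a : cpt R n -> R[i]) : Prop :=
  exists M : R, niint (fun x => (if M < cabs (a x) then 1 else 0)%:E) = 0%E.

End Defs.

(* Main.v *)
(** Write [Phi = H + Re f] with [H] Hermitian and [f] a holomorphic quadratic form; multiplication
    by [e^{-f}] reduces everything to the weight [H].  The reproducing formula expresses
    [Top(e^Q) u] through the kernel [t(x,z) = int e^{Q(y) + 2H(x,y) + 2H(y,z) - 2H(y,y)} dy], and a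
    complex shift in a Gaussian integral shows that [t(x,z)] is a constant times
    [int a(w) e^{-4H(w-x,w-z) + 2H(x,z)} dw], where [a] is the Weyl symbol.  The modulus of that
    exponential is [e^{H(x) + H(z) - 4H(w-(x+z)/2)}], so [|t(x,z)| e^{-H(x)-H(z)}] is bounded when
    [a] is.  By completing the square the same quantity is a constant times [e^{-r(x,z)}] for a real
    quadratic polynomial [r].  Being bounded below, [r] has a nonnegative quadratic part; the
    determinant condition makes this part positive definite in [x] and in [z] separately, and the
    parallelogram identity then bounds [int e^{-r}] in either variable uniformly in the other one.
    The Schur test concludes. *)

Require Import Defs.
From HB Require Import structures.
From mathcomp Require Import all_boot all_order all_algebra complex.
From mathcomp Require Import all_classical all_reals all_analysis.
From mathcomp Require Import measurable_realfun.
From mathcomp Require Import ring lra.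
Set Implicit Arguments. Unset Strict Implicit. Unset Printing Implicit Defensive.
Import Order.TTheory GRing.Theory Num.Theory.
Import numFieldNormedType.Exports.
Local Open Scope classical_set_scope.
Local Open Scope ring_scope.

(** * Lebesgue measure on the complex space *)

(** A bounded kernel does not by itself give a bounded operator: the Schur test needs integrability
    in each variable. The passage from one to the other rests on the kernel being Gaussian. A
    bounded Gaussian has a semidefinite exponent, and a vector on which a semidefinite form vanishes
    is orthogonal to everything for its polarization. The critical point equations of the inner
    integral show that such a vector of the form [(0, v)] or [(v, 0)] is zero once the mixed Hessian
    of [2 Phi_0 - q] is invertible. Joint definiteness in [(x, z)] is out of reach: for [Q = 0] the
    phase is [H(x - z)]. This is why the growth is measured from a near minimizer that moves with
    the other variable. The integrals of the statement are iterated integrals with [fine] at every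
    level. They are first identified with integrals for a single measure on [C^n], for which Fubini,
    translations and rotations are available. Gaussian integrals enter only up to constants; their
    dependence on parameters comes from invariance under complex shifts. *)

Section CptMeasurable.
Variables (R : realType) (n : nat).

(** A separate name for [cpt R n], so that the measurable structure is attached to a constant and
    not to a bare function type. *)
Definition mcpt := cpt R n.
HB.instance Definition _ := gen_eqMixin mcpt.
HB.instance Definition _ := gen_choiceMixin mcpt.
HB.instance Definition _ := isPointed.Build mcpt (@vzero R n).

Definition coord_preimages : set (set mcpt) :=
  [set A | exists j (B : set R), measurable B /\
     (A = (fun x : mcpt => cre (x j)) @^-1` B \/
      A = (fun x : mcpt => cim (x j)) @^-1` B)].

HB.instance Definition _ := @isMeasurable.Build (sigma_display coord_preimages)
  mcpt <<s coord_preimages >> (@sigma_algebra0 _ setT coord_preimages)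
  (@sigma_algebraC _ coord_preimages)
  (@sigma_algebra_bigcup _ setT coord_preimages).

Lemma measurable_cre_coord j : measurable_fun setT (fun x : mcpt => cre (x j)).
Proof.
by move=> _ B mB; rewrite setTI; apply: sub_sigma_algebra; exists j, B; split => //; left.
Qed.

Lemma measurable_cim_coord j : measurable_fun setT (fun x : mcpt => cim (x j)).
Proof.
by move=> _ B mB; rewrite setTI; apply: sub_sigma_algebra; exists j, B; split => //; right.
Qed.

Lemma measurable_to_mcpt d (T : measurableType d) (f : T -> mcpt) :
  (forall j, measurable_fun setT (fun t => cre (f t j))) ->
  (forall j, measurable_fun setT (fun t => cim (f t j))) ->
  measurable_fun setT f.
Proof.
move=> mre mim; apply: (@measurability _ _ _ _ _ _ coord_preimages) => //.
move=> _ [_ [j [B [mB [->|->]]]] <-]; rewrite -comp_preimage.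
  exact: mre.
exact: mim.
Qed.

Lemma measurable_vupd d (T : measurableType d) (f : T -> mcpt) (u v : T -> R) j :
  measurable_fun setT f -> measurable_fun setT u -> measurable_fun setT v ->
  measurable_fun setT (fun t => vupd (f t) j (Complex (u t) (v t)) : mcpt).
Proof.
move=> mf mu mv; apply: measurable_to_mcpt => k; rewrite /vupd; case: eqP => //= _.
  exact: (measurableT_comp (measurable_cre_coord k) mf).
exact: (measurableT_comp (measurable_cim_coord k) mf).
Qed.

Local Notation leb := (@lebesgue_measure R).
Local Open Scope ereal_scope.

Let mslice j (F : mcpt -> \bar R) (x : mcpt) (a : R) : measurable_fun setT F ->
  measurable_fun setT (fun b : measurableTypeR R => F (vupd x j (Complex a b))).
Proof.
by move=> mF; apply: (measurableT_comp mF); apply: measurable_vupd.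
Qed.

Let minner j (F : mcpt -> \bar R) : measurable_fun setT F -> (forall x, 0 <= F x) ->
  measurable_fun setT (fun p : mcpt * measurableTypeR R =>
    \int[leb]_b F (vupd p.1 j (Complex p.2 b))).
Proof.
move=> mF F0; pose G (q : (mcpt * measurableTypeR R) * measurableTypeR R) :=
  F (vupd q.1.1 j (Complex q.1.2 q.2)).
apply: (@measurable_fun_fubini_tonelli_F _ _ _ _ _ leb G); last by move=> q; exact: F0.
apply: (measurableT_comp mF); apply: measurable_vupd => //.
  exact: measurableT_comp.
exact: measurableT_comp.
Qed.

Let mslice2 j (F : mcpt -> \bar R) (x : mcpt) : measurable_fun setT F ->
  (forall x, 0 <= F x) -> measurable_fun setT (fun a : measurableTypeR R =>
    \int[leb]_b F (vupd x j (Complex a b))).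
Proof.
by move=> mF F0; exact: (measurableT_comp (minner j mF F0) (pair1_measurable x)).
Qed.

Lemma niint_aux_ge0 s (F : mcpt -> \bar R) : (forall x, 0 <= F x) ->
  forall x, 0 <= niint_aux s F x.
Proof.
move=> F0; elim: s => //= j s IH x.
by apply: integral_ge0 => a _; apply: integral_ge0 => b _; exact: IH.
Qed.

Lemma measurable_niint_aux s (F : mcpt -> \bar R) : measurable_fun setT F ->
  (forall x, 0 <= F x) -> measurable_fun setT (niint_aux s F : mcpt -> \bar R).
Proof.
move=> mF F0; elim: s => //= j s IH.
pose G (p : mcpt * measurableTypeR R) :=
  \int[leb]_b niint_aux s F (vupd p.1 j (Complex p.2 b)).
apply: (@measurable_fun_fubini_tonelli_F _ _ _ _ _ leb G) => //.
  by apply: minner => // x; exact: niint_aux_ge0.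
by move=> p; apply: integral_ge0 => b _; exact: niint_aux_ge0.
Qed.

Lemma niint_aux_slice s j (F : mcpt -> \bar R) (x : mcpt) : measurable_fun setT F ->
  (forall x, 0 <= F x) -> measurable_fun setT (fun a : measurableTypeR R =>
    \int[leb]_b niint_aux s F (vupd x j (Complex a b))).
Proof.
move=> mF F0; apply: mslice2; first exact: measurable_niint_aux.
exact: niint_aux_ge0.
Qed.

Lemma niint_aux_slice1 s j (F : mcpt -> \bar R) (x : mcpt) (a : R) : measurable_fun setT F ->
  (forall x, 0 <= F x) -> measurable_fun setT (fun b : measurableTypeR R =>
    niint_aux s F (vupd x j (Complex a b))).
Proof. by move=> mF F0; apply: mslice; exact: measurable_niint_aux. Qed.

Lemma niint_aux_sum s I (r : seq I) (F : I -> mcpt -> \bar R) x :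
  (forall i, measurable_fun setT (F i)) -> (forall i x, 0 <= F i x) ->
  niint_aux s (fun y => \sum_(i <- r) F i y) x = \sum_(i <- r) niint_aux s (F i) x.
Proof.
move=> mF F0; elim: s x => //= j s IH x.
rewrite -ge0_integral_sum//.
- apply: eq_integral => a _; rewrite -ge0_integral_sum//.
  + by apply: eq_integral => b _; exact: IH.
  + by move=> i; exact: niint_aux_slice1.
  + by move=> i b _; exact: niint_aux_ge0.
- by move=> i; exact: niint_aux_slice.
- by move=> i a _; apply: integral_ge0 => b _; exact: niint_aux_ge0.
Qed.

Lemma niint_aux_series s (F : nat -> mcpt -> \bar R) x :
  (forall i, measurable_fun setT (F i)) -> (forall i x, 0 <= F i x) ->
  niint_aux s (fun y => \sum_(i <oo) F i y) x = \sum_(i <oo) niint_aux s (F i) x.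
Proof.
move=> mF F0; elim: s x => //= j s IH x.
rewrite -integral_nneseries//.
- apply: eq_integral => a _; rewrite -integral_nneseries//.
  + by apply: eq_integral => b _; exact: IH.
  + by move=> i; exact: niint_aux_slice1.
  + by move=> i b _; exact: niint_aux_ge0.
- by move=> i; exact: niint_aux_slice.
- by move=> i a _; apply: integral_ge0 => b _; exact: niint_aux_ge0.
Qed.

Lemma niint_auxZ s k (F : mcpt -> \bar R) x : measurable_fun setT F ->
  (forall x, 0 <= F x) -> 0 <= k ->
  niint_aux s (fun y => k * F y) x = k * niint_aux s F x.
Proof.
move=> mF F0 k0; elim: s x => //= j s IH x.
rewrite -ge0_integralZl//.
- apply: eq_integral => a _; rewrite -ge0_integralZl//.
  + by apply: eq_integral => b _; exact: IH.
  + exact: niint_aux_slice1.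
  + by move=> b _; exact: niint_aux_ge0.
- exact: niint_aux_slice.
- by move=> a _; apply: integral_ge0 => b _; exact: niint_aux_ge0.
Qed.

Lemma le_niint_aux s (F G : mcpt -> \bar R) x : measurable_fun setT F ->
  measurable_fun setT G -> (forall x, 0 <= F x) -> (forall x, F x <= G x) ->
  niint_aux s F x <= niint_aux s G x.
Proof.
move=> mF mG F0 FG; have G0 y : 0 <= G y by exact: le_trans (F0 y) (FG y).
elim: s x => [x|j s IH x] /=; first by [].
apply: ge0_le_integral => //.
- by move=> a _; apply: integral_ge0 => b _; exact: niint_aux_ge0.
- exact: niint_aux_slice.
- exact: niint_aux_slice.
- move=> a _; apply: ge0_le_integral => //.
  + by move=> b _; exact: niint_aux_ge0.
  + exact: niint_aux_slice1.
  + exact: niint_aux_slice1.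
Qed.

Lemma eq_niint_aux s (F G : mcpt -> \bar R) x : F =1 G -> niint_aux s F x = niint_aux s G x.
Proof. by move=> /funext ->. Qed.

Lemma niint_aux_lim s (F : nat -> mcpt -> \bar R) x :
  (forall i, measurable_fun setT (F i)) -> (forall i x, 0 <= F i x) ->
  (forall x, nondecreasing_seq (F ^~ x)) ->
  niint_aux s (fun y => limn (F ^~ y)) x = limn (fun i => niint_aux s (F i) x).
Proof.
move=> mF F0 ndF; elim: s x => //= j s IH x.
rewrite -monotone_convergence//.
- apply: eq_integral => a _; rewrite -monotone_convergence//.
  + by apply: eq_integral => b _; exact: IH.
  + by move=> i; exact: niint_aux_slice1.
  + by move=> i b _; exact: niint_aux_ge0.
  + by move=> b _ p q pq; apply: le_niint_aux => // y; exact: ndF.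
- by move=> i; exact: niint_aux_slice.
- by move=> i a _; apply: integral_ge0 => b _; exact: niint_aux_ge0.
- move=> a _ p q pq; apply: ge0_le_integral => //.
  + by move=> b _; exact: niint_aux_ge0.
  + exact: niint_aux_slice1.
  + exact: niint_aux_slice1.
  + by move=> b _; apply: le_niint_aux => // y; exact: ndF.
Qed.

(** The measure is read off from [niint] on indicators. Agreement with the iterated integral is then
    only an extension from indicators to nonnegative functions. *)
Definition cptmu (A : set mcpt) : \bar R := niint (fun x : mcpt => (\1_A x)%:E).

Let mindic (A : set mcpt) : measurable A ->
  measurable_fun setT (fun x : mcpt => (\1_A x : R)%:E).
Proof. by move=> mA; apply/measurable_EFinP; exact: measurable_indic. Qed.

Lemma niint_aux0 s x : niint_aux s (cst 0 : mcpt -> \bar R) x = 0.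
Proof.
elim: s x => //= j s IH x; apply: integral0_eq => a _; apply: integral0_eq => b _.
exact: IH.
Qed.

Let cptmu0 : cptmu set0 = 0.
Proof.
rewrite /cptmu /niint -[RHS](niint_aux0 (enum 'I_n) (@vzero R n)).
by apply: eq_niint_aux => x; rewrite indic0.
Qed.

Let cptmu_ge0 A : 0 <= cptmu A.
Proof. by apply: niint_aux_ge0 => x; rewrite lee_fin. Qed.

Let cptmu_semi_sigma_additive : semi_sigma_additive cptmu.
Proof.
move=> F mF tF mUF.
have -> : cptmu (\bigcup_k F k) = \sum_(i <oo) cptmu (F i).
  rewrite /cptmu /niint -niint_aux_series.
  (* At a fixed point the series of indicators is countable additivity of the Dirac measure
     there. *)
  - apply: eq_niint_aux => x /=; apply/esym/cvg_lim => //.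
    exact: (@measure_semi_sigma_additive _ _ R (dirac x) F mF tF mUF).
  - by move=> i; exact: mindic.
  - by move=> i x; rewrite lee_fin.
by apply: is_cvg_ereal_nneg_natsum => i _; exact: cptmu_ge0.
Qed.

HB.instance Definition _ := isMeasure.Build _ mcpt R cptmu
  cptmu0 cptmu_ge0 cptmu_semi_sigma_additive.

Import HBNNSimple.

(** Both sides commute with increasing limits and with nonnegative combinations, and they agree on
    indicators by definition of [cptmu]. *)
Lemma niintE (F : mcpt -> \bar R) : measurable_fun setT F -> (forall x, 0 <= F x) ->
  niint F = \int[cptmu]_x F x.
Proof.
move=> mF F0; pose g := nnsfun_approx measurableT mF.
have -> : niint F = limn (fun i => niint (fun x => (g i x)%:E)).
  rewrite /niint -niint_aux_lim.
  - apply: eq_niint_aux => x; apply/esym/cvg_lim => //.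
    exact: cvg_nnsfun_approx.
  - by move=> i; apply/measurable_EFinP.
  - by move=> i x; rewrite lee_fin.
  - by move=> x p q pq; rewrite lee_fin; exact/lefP/nd_nnsfun_approx.
have -> : \int[cptmu]_x F x = limn (fun i => \int[cptmu]_x (g i x)%:E).
  rewrite -monotone_convergence//.
  - apply: eq_integral => x _; apply/esym/cvg_lim => //; exact: cvg_nnsfun_approx.
  - by move=> i; apply/measurable_EFinP.
  - by move=> i x _; rewrite lee_fin.
  - by move=> x _ p q pq; rewrite lee_fin; exact/lefP/nd_nnsfun_approx.
congr (limn _); apply/funext => i; move: (g i) => f {g}.
have fE x : (f x)%:E = \sum_(r <- finmap.enum_fset (fset_set (range f)))
    (r%:E * (\1_(f @^-1` [set r]) x)%:E).
  by rewrite fimfunE fsbig_finite//= -sumEFin; apply: eq_bigr => r _; rewrite EFinM.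
have r0 (r : R) (x : mcpt) : 0 <= r%:E * (\1_(f @^-1` [set r]) x)%:E.
  exact: nnfun_muleindic_ge0.
have mm (r : R) : measurable_fun setT
    (fun x => r%:E * (\1_(f @^-1` [set r]) x : R)%:E).
  by apply: measurable_funeM; exact: mindic.
rewrite (eq_integral (fun x => \sum_(r <- finmap.enum_fset (fset_set (range f)))
    (r%:E * (\1_(f @^-1` [set r]) x)%:E))); last by move=> x _; exact: fE.
rewrite ge0_integral_sum//.
rewrite /niint (eq_niint_aux _ _ fE) niint_aux_sum//.
apply: eq_bigr => r _; have [rge0|rlt0] := leP 0%R r.
  rewrite niint_auxZ//; [|exact: mindic].
  rewrite ge0_integralZl//; [|exact: mindic].
  by rewrite integral_indic// setIT.
(* A negative [r] cannot be factored out of the integrals, but it is not a value of the nonnegative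
   function [f], so its term is zero. *)
have z x : r%:E * (\1_(f @^-1` [set r]) x)%:E = 0.
  by rewrite preimage_nnfun0// indic0 mule0.
transitivity (niint_aux (enum 'I_n) (cst 0 : mcpt -> \bar R) (@vzero R n)).
  exact: eq_niint_aux.
by rewrite niint_aux0 integral0_eq.
Qed.

End CptMeasurable.

(** * Iterated real integrals, and the plane maps that preserve them *)

Section IteratedIntegral.
Variables (R : realType) (n : nat).
Local Notation mcpt := (@mcpt R n).
Local Notation leb := (@lebesgue_measure R).
Local Open Scope ereal_scope.

(** One level of the iterated real integral: [P], [M] and [K] stand for the inner integrals of the
    positive part, the negative part and the absolute value. The formula for [r] is known only where
    [K] is finite, which is almost everywhere because [K] is integrable. *)
Lemma fine_integralB_ae d (T : measurableType d) (mu : {measure set T -> \bar R})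
    (P M K : T -> \bar R) (r : T -> R) :
  measurable_fun setT P -> measurable_fun setT M -> measurable_fun setT K ->
  measurable_fun setT r -> (forall b, 0 <= P b <= K b) -> (forall b, 0 <= M b <= K b) ->
  \int[mu]_b K b < +oo ->
  (forall b, K b < +oo -> r b = (fine (P b) - fine (M b))%R) ->
  fine (\int[mu]_b (r b)%:E) = (fine (\int[mu]_b P b) - fine (\int[mu]_b M b))%R.
Proof.
move=> mP mM mK mr PK MK Koo rE.
have K0 b : 0 <= K b by have /andP[p] := PK b; apply: le_trans.
have iK : mu.-integrable setT K.
  apply/integrableP; split => //; rewrite (eq_integral K)// => b _.
  by rewrite gee0_abs.
have iP : mu.-integrable setT P.
  apply: le_integrable iK => // b _; have /andP[p pk] := PK b.
  by rewrite !gee0_abs.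
have iM : mu.-integrable setT M.
  apply: le_integrable iK => // b _; have /andP[p pk] := MK b.
  by rewrite !gee0_abs.
rewrite (@ae_eq_integral _ _ _ mu setT (P \- M))//.
- by rewrite integralB// fineB//; exact: integrable_fin_num.
- exact/measurable_EFinP.
- exact: emeasurable_funB.
- have := integrable_ae measurableT iK; apply: filterS => b Kb _.
  have {}Kb := Kb Logic.I; have Kboo : K b < +oo by rewrite -ge0_fin_numE.
  have /andP[p pk] := PK b; have /andP[m mk] := MK b.
  have fP : P b \is a fin_num by rewrite ge0_fin_numE// (le_lt_trans pk).
  have fM : M b \is a fin_num by rewrite ge0_fin_numE// (le_lt_trans mk).
  by rewrite rE// EFinB !fineK.
Qed.

(** The positive and negative parts are treated separately, so that Tonelli applies to each. *)
Lemma measurable_integral_snd d d' (T : measurableType d) (T' : measurableType d')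
    (nu : {sigma_finite_measure set T' -> \bar R}) (f : T -> T' -> R) :
  measurable_fun setT (fun p : T * T' => f p.1 p.2) ->
  measurable_fun setT (fun x => \int[nu]_b (f x b)%:E).
Proof.
move=> mf.
have mF : measurable_fun setT (fun p : T * T' => (f p.1 p.2)%:E).
  exact/measurable_EFinP.
rewrite (_ : (fun x => _) = (fun x => \int[nu]_b (fun p : T * T' =>
   (f p.1 p.2)%:E)^\+ (x, b) - \int[nu]_b (fun p : T * T' =>
   (f p.1 p.2)%:E)^\- (x, b))); last first.
  apply/funext => x; rewrite [LHS]integralE.
  by congr (_ - _); apply: eq_integral => b _; rewrite ?funeposE ?funenegE.
apply: emeasurable_funB.
  apply: (@measurable_fun_fubini_tonelli_F _ _ _ _ _ nu (fun p : T * T' =>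
   (f p.1 p.2)%:E)^\+) => //.
  exact: (measurable_funepos mF).
apply: (@measurable_fun_fubini_tonelli_F _ _ _ _ _ nu (fun p : T * T' =>
   (f p.1 p.2)%:E)^\-) => //.
exact: (measurable_funeneg mF).
Qed.

Let mriint_inner s (F : mcpt -> R) j : measurable_fun setT (riint_aux s F : mcpt -> R) ->
  measurable_fun setT (fun p : mcpt * measurableTypeR R =>
    fine (\int[leb]_b (riint_aux s F (vupd p.1 j (Complex p.2 b)))%:E)).
Proof.
move=> IH; apply: (measurableT_comp (@fine_measurable R setT measurableT)).
apply: (@measurable_integral_snd _ _ _ _ leb (fun (p : mcpt * measurableTypeR R) b =>
   riint_aux s F (vupd p.1 j (Complex p.2 b)))).
apply: (measurableT_comp IH); apply: measurable_vupd => //.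
  exact: measurableT_comp.
exact: measurableT_comp.
Qed.

Lemma measurable_riint_aux s (F : mcpt -> R) : measurable_fun setT F ->
  measurable_fun setT (riint_aux s F : mcpt -> R).
Proof.
move=> mF; elim: s => //= j s IH.
apply: (measurableT_comp (@fine_measurable R setT measurableT)).
apply: (@measurable_integral_snd _ _ _ _ leb (fun (x : mcpt) (a : measurableTypeR R) =>
  fine (\int[leb]_b (riint_aux s F (vupd x j (Complex a b)))%:E))).
exact: mriint_inner.
Qed.

(** Each complex coordinate costs two applications of [fine_integralB_ae], one per real variable.
    The induction hypothesis holds only at points where the partial integral of [|F|] is finite,
    whence the almost everywhere form of that lemma. *)
Lemma riint_auxE s (F : mcpt -> R) (x : mcpt) : measurable_fun setT F ->
  niint_aux s (fun y => `|(F y)%:E|) x < +oo ->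
  riint_aux s F x = (fine (niint_aux s (EFin \o F)^\+%E x) -
                     fine (niint_aux s (EFin \o F)^\-%E x))%R.
Proof.
move=> mF; have mEF : measurable_fun setT (EFin \o F) by exact/measurable_EFinP.
have mp := measurable_funepos mEF; have mn := measurable_funeneg mEF.
have ma : measurable_fun setT (fun y => `|(F y)%:E|) by exact: measurableT_comp.
have p0 y : 0 <= (EFin \o F)^\+ y by [].
have n0 y : 0 <= (EFin \o F)^\- y by [].
have a0 y : 0 <= `|(F y)%:E| by exact: abse_ge0.
have aE y : `|(F y)%:E| = (EFin \o F)^\+ y + (EFin \o F)^\- y.
  by rewrite -[RHS]/((_ \+ _) y) -fune_abse.
have pa y : (EFin \o F)^\+ y <= `|(F y)%:E| by rewrite aE leeDl.
have na y : (EFin \o F)^\- y <= `|(F y)%:E| by rewrite aE leeDr.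
elim: s x => [x _|j s IH x] /=.
  rewrite funeposE funenegE /= -?EFinN -!EFin_max /=.
  have [F0|F0] := orP (le_total 0%R (F x)); first by rewrite max_l// max_r ?subr0// oppr_le0.
  by rewrite max_r// max_l ?sub0r ?opprK// oppr_ge0.
move=> Koo; apply: (@fine_integralB_ae _ _ leb _ _
    (fun a => \int[leb]_b niint_aux s (fun y => `|(F y)%:E|) (vupd x j (Complex a b)))) => //.
- exact: niint_aux_slice.
- exact: niint_aux_slice.
- exact: niint_aux_slice.
- by have := measurableT_comp (mriint_inner j (measurable_riint_aux s mF)) (pair1_measurable x).
- move=> a; rewrite integral_ge0/=; last by move=> b _; exact: niint_aux_ge0.
  apply: ge0_le_integral => //; [by move=> b _; exact: niint_aux_ge0|exact: niint_aux_slice1..|].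
  by move=> b _; apply: le_niint_aux.
- move=> a; rewrite integral_ge0/=; last by move=> b _; exact: niint_aux_ge0.
  apply: ge0_le_integral => //; [by move=> b _; exact: niint_aux_ge0|exact: niint_aux_slice1..|].
  by move=> b _; apply: le_niint_aux.
move=> a Kaoo; apply: (@fine_integralB_ae _ _ leb _ _
    (fun b => niint_aux s (fun y => `|(F y)%:E|) (vupd x j (Complex a b)))) => //.
- exact: niint_aux_slice1.
- exact: niint_aux_slice1.
- exact: niint_aux_slice1.
- apply: (measurableT_comp (measurable_riint_aux s mF)); exact: measurable_vupd.
- by move=> b; rewrite niint_aux_ge0//=; apply: le_niint_aux.
- by move=> b; rewrite niint_aux_ge0//=; apply: le_niint_aux.
- by move=> b; exact: IH.
Qed.

Lemma riintE (F : mcpt -> R) : (@cptmu R n).-integrable setT (EFin \o F) ->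
  riint F = fine (\int[@cptmu R n]_x (F x)%:E).
Proof.
move=> /integrableP[/measurable_EFinP mF Foo].
have mEF : measurable_fun setT (EFin \o F) by exact/measurable_EFinP.
rewrite /riint riint_auxE//; last first.
  rewrite -/(niint _) niintE//; exact: measurableT_comp.
rewrite -!/(niint _) !niintE//; [|exact: measurable_funeneg|exact: measurable_funepos].
have iF : (@cptmu R n).-integrable setT (EFin \o F) by apply/integrableP; split.
rewrite -fineB; last 2 first.
- exact: integrable_pos_fin_num.
- exact: integrable_neg_fin_num.
by rewrite -integralE.
Qed.

(** The image of Lebesgue measure under a translation gives half-open intervals the same length, and
    this determines the measure. *)
Lemma ge0_integral_translate (f : R -> \bar R) (t : R) :
  measurable_fun setT f -> (forall a, 0 <= f a) ->
  \int[leb]_a f (a + t)%R = \int[leb]_a f a.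
Proof.
move=> mf f0.
have mt : measurable_fun setT ((fun a => a + t)%R : measurableTypeR R -> measurableTypeR R).
  exact: measurable_funD.
rewrite -(@ge0_integral_pushforward _ _ _ _ R _ mt leb setT f)//.
apply: eq_measure_integral => A mA _.
apply/esym/lebesgue_measure_unique => // _ [[a b]] _ <-.
rewrite [RHS](_ : _ = leb ((+%R^~ t) @^-1` `]a, b]%classic))//.
rewrite (_ : _ @^-1` _ = `]a - t, b - t]%classic)%R; last first.
  by apply/seteqP; split => x /=; rewrite !in_itv/= ltrBlDr lerBrDr.
rewrite !lebesgue_measure_itv/= !lte_fin ltrD2r.
by case: ifP => // _; rewrite -!EFinB; congr (_%:E); ring.
Qed.

(** Preservation of area, stated on iterated integrals of nonnegative functions so that it can be
    used directly inside one level of [niint_aux]. *)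
Definition plane_preserving (T : R[i] -> R[i]) :=
  measurable_fun setT (fun p : measurableTypeR R * measurableTypeR R => cre (T (Complex p.1 p.2))) /\
  measurable_fun setT (fun p : measurableTypeR R * measurableTypeR R => cim (T (Complex p.1 p.2))) /\
  forall G : measurableTypeR R * measurableTypeR R -> \bar R, measurable_fun setT G -> (forall p, 0 <= G p) ->
    \int[leb]_a \int[leb]_b G (cre (T (Complex a b)), cim (T (Complex a b))) =
    \int[leb]_a \int[leb]_b G (a, b).

Lemma plane_preserving_comp S T : plane_preserving S -> plane_preserving T ->
  plane_preserving (S \o T).
Proof.
move=> [mS1 [mS2 SE]] [mT1 [mT2 TE]].
have mT : measurable_fun setT (fun p : measurableTypeR R * measurableTypeR R =>
    (cre (T (Complex p.1 p.2)), cim (T (Complex p.1 p.2)))).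
  exact: measurable_fun_pair.
have ST z : S z = S (Complex (cre z) (cim z)) by case: z.
split; [|split].
- rewrite (_ : (fun p => _) = (fun p : R * R => cre (S (Complex p.1 p.2))) \o
    (fun p : R * R => (cre (T (Complex p.1 p.2)), cim (T (Complex p.1 p.2)))));
    first exact: (measurableT_comp mS1 mT).
  by apply/funext => p /=; rewrite ST.
- rewrite (_ : (fun p => _) = (fun p : R * R => cim (S (Complex p.1 p.2))) \o
    (fun p : R * R => (cre (T (Complex p.1 p.2)), cim (T (Complex p.1 p.2)))));
    first exact: (measurableT_comp mS2 mT).
  by apply/funext => p /=; rewrite ST.
move=> G mG G0; rewrite -(SE G mG G0).
have mGS : measurable_fun setT (fun p : measurableTypeR R * measurableTypeR R =>
    G (cre (S (Complex p.1 p.2)), cim (S (Complex p.1 p.2)))).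
  by apply: (measurableT_comp mG); exact: measurable_fun_pair.
rewrite -(TE _ mGS (fun p => G0 _)).
by apply: eq_integral => a _; apply: eq_integral => b _; rewrite /= ST.
Qed.

Lemma plane_preserving_shear1 (t : R) :
  plane_preserving (fun z => Complex (cre z + t * cim z) (cim z))%R.
Proof.
have m1 : measurable_fun setT
    (fun p : measurableTypeR R * measurableTypeR R => (p.1 + t * p.2)%R).
  by apply: measurable_funD => //; apply: measurable_funM.
split; [exact: m1|split; [exact: measurable_snd|move=> G mG G0 /=]].
have mH : measurable_fun setT (fun p : measurableTypeR R * measurableTypeR R =>
    G (p.1 + t * p.2, p.2)%R).
  by apply: (measurableT_comp mG); exact: measurable_fun_pair.
(* The first variable is moved by an amount depending on the second, so it has to become the inner
   variable before translation invariance applies. *)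
rewrite (@fubini_tonelli _ _ _ _ _ leb leb _ mH (fun p => G0 _)).
rewrite [RHS](@fubini_tonelli _ _ _ _ _ leb leb _ mG G0).
apply: eq_integral => b _ /=; rewrite /fubini_G /=.
apply: (ge0_integral_translate (f := fun a => G (a, b)) (t * b)) => //.
exact: (measurableT_comp mG (pair2_measurable b)).
Qed.

Lemma plane_preserving_shear2 (t : R) :
  plane_preserving (fun z => Complex (cre z) (cim z + t * cre z))%R.
Proof.
have m1 : measurable_fun setT
    (fun p : measurableTypeR R * measurableTypeR R => (p.2 + t * p.1)%R).
  by apply: measurable_funD => //; apply: measurable_funM.
split; [exact: measurable_fst|split; [exact: m1|move=> G mG G0 /=]].
apply: eq_integral => a _ /=.
apply: (ge0_integral_translate (f := fun b => G (a, b)) (t * a)) => //.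
exact: (measurableT_comp mG (pair1_measurable a)).
Qed.

Lemma plane_preserving_translate (w : R[i]) : plane_preserving (fun z => z + w)%R.
Proof.
have creD (z : R[i]) : cre (z + w)%R = (cre z + cre w)%R by case: z => za zb; case: (w).
have cimD (z : R[i]) : cim (z + w)%R = (cim z + cim w)%R by case: z => za zb; case: (w).
split.
  rewrite (_ : (fun p => _) = (fun p : R * R => p.1 + cre w)%R); first exact: measurable_funD.
  by apply/funext => p; rewrite creD.
split.
  rewrite (_ : (fun p => _) = (fun p : R * R => p.2 + cim w)%R); first exact: measurable_funD.
  by apply/funext => p; rewrite cimD.
move=> G mG G0.
have -> : \int[leb]_a \int[leb]_b G (a, b) = \int[leb]_a \int[leb]_b G (a + cre w, b)%R.
  apply/esym; apply: (ge0_integral_translate (f := fun a => \int[leb]_b G (a, b))).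
    exact: (@measurable_fun_fubini_tonelli_F _ _ _ _ _ leb G mG G0).
  by move=> a; exact: integral_ge0.
apply: eq_integral => a _ /=.
transitivity (\int[leb]_b G (a + cre w, b + cim w)%R).
  by apply: eq_integral => b _; rewrite creD cimD.
apply: (ge0_integral_translate (f := fun b => G (a + cre w, b)%R) (cim w)) => //.
exact: (measurableT_comp mG (pair1_measurable _)).
Qed.

(* A rotation of angle different from pi is a product of three shears. *)
Lemma plane_preserving_rot (c s : R) : (c ^+ 2 + s ^+ 2 = 1)%R ->
  plane_preserving (fun z => Complex c s * z)%R.
Proof.
suff main (c' s' : R) : (c' ^+ 2 + s' ^+ 2 = 1)%R -> (1 + c' != 0)%R ->
    plane_preserving (fun z => Complex c' s' * z)%R.
  move=> cs1; have [c1|] := eqVneq (1 + c)%R 0%R; last exact: main.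
  have cE : c = (-1)%R by lra.
  have s0 : s = 0%R by apply/eqP; rewrite -sqrf_eq0; apply/eqP; move: cs1; rewrite cE; lra.
  (* The rotation by pi is the square of the rotation by pi/2. *)
  have P : plane_preserving (fun z => Complex 0 1 * z)%R by apply: main; [ring|lra].
  have := plane_preserving_comp P P; congr plane_preserving.
  by apply/funext => -[a b] /=; rewrite cE s0; congr Complex; ring.
move=> cs1 c1.
(* For the angle theta the outer shears have parameter [- tan (theta / 2)] and the middle one
   [sin theta]. *)
have := plane_preserving_comp (plane_preserving_shear1 (- s' / (1 + c'))%R)
  (plane_preserving_comp (plane_preserving_shear2 s') (plane_preserving_shear1 (- s' / (1 + c'))%R)).
congr plane_preserving; apply/funext => -[a b] /=.
have s2 : (s' ^+ 2 = (1 - c') * (1 + c'))%R by rewrite -[LHS](addKr (c' ^+ 2)%R) cs1; ring.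
have tE : (s' * (- s' / (1 + c')) = c' - 1)%R.
  by apply: (mulIf c1); rewrite -mulrA divfK// mulrN -expr2 s2; ring.
have yE : (b + s' * (a + - s' / (1 + c') * b) = c' * b + s' * a)%R.
  by rewrite mulrDr mulrA tE; ring.
have c1' : (- s' / (1 + c') * (1 + c') = - s')%R by rewrite divfK.
congr Complex; rewrite yE//.
transitivity (a + (- s' / (1 + c') * (1 + c')) * b + s' * (- s' / (1 + c')) * a)%R; first by ring.
by rewrite c1' tE; ring.
Qed.

Lemma niint_aux_preserving (T : 'I_n -> R[i] -> R[i]) s (F : mcpt -> \bar R) x :
  (forall j, plane_preserving (T j)) -> measurable_fun setT F -> (forall x, 0 <= F x) ->
  niint_aux s (fun y : mcpt => F (fun j => T j (y j))) x = niint_aux s F (fun j => T j (x j)).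
Proof.
move=> TP mF F0; elim: s x => [x|j s IH x]; [by []|rewrite /=].
pose G (p : measurableTypeR R * measurableTypeR R) :=
  niint_aux s F (vupd (fun k => T k (x k)) j (Complex p.1 p.2)).
have [_ [_ TE]] := TP j.
transitivity (\int[leb]_a \int[leb]_b G (cre (T j (Complex a b)), cim (T j (Complex a b)))).
  apply: eq_integral => a _; apply: eq_integral => b _; rewrite IH /G.
  congr niint_aux; apply/funext => k; rewrite /vupd; case: eqP => // ->.
  by case: (T j _).
apply: TE => [|p]; last exact: niint_aux_ge0.
apply: (measurableT_comp (measurable_niint_aux s mF F0)).
exact: measurable_vupd.
Qed.

(** A coordinatewise map moves the base point [vzero] of the iteration; this lemma moves it back
    once all coordinates are integrated. *)
Lemma niint_aux_indep s (F : mcpt -> \bar R) x x' :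
  (forall j, j \notin s -> x j = x' j) -> niint_aux s F x = niint_aux s F x'.
Proof.
elim: s x x' => [|j s IH] x x' xx' /=; first by congr F; apply/funext => j; exact: xx'.
apply: eq_integral => a _; apply: eq_integral => b _; apply: IH => k ks.
by rewrite /vupd; case: eqVneq => // kj; apply: xx'; rewrite inE negb_or kj.
Qed.

Lemma niint_preserving (T : 'I_n -> R[i] -> R[i]) (F : mcpt -> \bar R) :
  (forall j, plane_preserving (T j)) -> measurable_fun setT F -> (forall x, 0 <= F x) ->
  niint (fun y : mcpt => F (fun j => T j (y j))) = niint F.
Proof.
move=> TP mF F0; rewrite /niint.
rewrite [LHS](niint_aux_preserving (enum 'I_n) (@vzero R n) TP mF F0).
by apply: niint_aux_indep => j; rewrite mem_enum.
Qed.

Lemma measurable_preserving (T : 'I_n -> R[i] -> R[i]) : (forall j, plane_preserving (T j)) ->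
  measurable_fun setT (fun y : mcpt => (fun j => T j (y j)) : mcpt).
Proof.
move=> TP; apply: measurable_to_mcpt => j; have [m1 [m2 _]] := TP j.
- rewrite (_ : (fun t => _) = (fun p : R * R => cre (T j (Complex p.1 p.2))) \o
    (fun t : mcpt => (cre (t j), cim (t j)))).
    by apply: (measurableT_comp m1); apply: measurable_fun_pair;
      [exact: measurable_cre_coord|exact: measurable_cim_coord].
  by apply/funext => t /=; case: (t j).
- rewrite (_ : (fun t => _) = (fun p : R * R => cim (T j (Complex p.1 p.2))) \o
    (fun t : mcpt => (cre (t j), cim (t j)))).
    by apply: (measurableT_comp m2); apply: measurable_fun_pair;
      [exact: measurable_cre_coord|exact: measurable_cim_coord].
  by apply/funext => t /=; case: (t j).
Qed.

Lemma ge0_integral_cptmu_preserving (T : 'I_n -> R[i] -> R[i]) (F : mcpt -> \bar R) :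
  (forall j, plane_preserving (T j)) -> measurable_fun setT F -> (forall x, 0 <= F x) ->
  \int[@cptmu R n]_y F (fun j => T j (y j)) = \int[@cptmu R n]_y F y.
Proof.
move=> TP mF F0; rewrite -niintE//; last first.
  by apply: (measurableT_comp mF); exact: measurable_preserving.
by rewrite [LHS](niint_preserving TP mF F0) niintE.
Qed.

End IteratedIntegral.

(** * Complex arithmetic *)

Section ComplexFacts.
Variable R : realType.
Implicit Types (z w : R[i]) (x y r : R).

Lemma cre_add z w : cre (z + w) = cre z + cre w. Proof. by case: z; case: w. Qed.
Lemma cim_add z w : cim (z + w) = cim z + cim w. Proof. by case: z; case: w. Qed.
Lemma cre_opp z : cre (- z) = - cre z. Proof. by case: z. Qed.
Lemma cim_opp z : cim (- z) = - cim z. Proof. by case: z. Qed.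
Lemma cre_sub z w : cre (z - w) = cre z - cre w. Proof. by rewrite cre_add cre_opp. Qed.
Lemma cim_sub z w : cim (z - w) = cim z - cim w. Proof. by rewrite cim_add cim_opp. Qed.
Lemma cre_mul z w : cre (z * w) = cre z * cre w - cim z * cim w.
Proof. by case: z; case: w. Qed.
Lemma cim_mul z w : cim (z * w) = cre z * cim w + cim z * cre w.
Proof. by case: z; case: w. Qed.
Lemma cre_conj z : cre (conjc z) = cre z. Proof. by case: z. Qed.
Lemma cim_conj z : cim (conjc z) = - cim z. Proof. by case: z. Qed.
Lemma cre_cR r : cre (cR r) = r. Proof. by []. Qed.
Lemma cim_cR r : cim (cR r) = 0. Proof. by []. Qed.
Lemma cre_cRM r z : cre (cR r * z) = r * cre z.
Proof. by rewrite cre_mul /= mul0r subr0. Qed.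
Lemma cim_cRM r z : cim (cR r * z) = r * cim z.
Proof. by rewrite cim_mul /= mul0r addr0. Qed.
Lemma cre_sum I (s : seq I) (P : pred I) (F : I -> R[i]) :
  cre (\sum_(i <- s | P i) F i) = \sum_(i <- s | P i) cre (F i).
Proof. by apply: (big_morph _ cre_add). Qed.

Definition creE := (cre_add, cim_add, cre_opp, cim_opp, cre_mul, cim_mul, cre_conj, cim_conj,
  cre_cR, cim_cR).

Lemma complex_ext z w : cre z = cre w -> cim z = cim w -> z = w.
Proof. by case: z => a b; case: w => c d /= -> ->. Qed.

Lemma complex_eta z : Complex (cre z) (cim z) = z. Proof. by case: z. Qed.

Lemma cRD x y : cR (x + y) = cR x + cR y. Proof. by apply: complex_ext; rewrite ?creE ?addr0. Qed.
Lemma cRN x : cR (- x) = - cR x. Proof. by apply: complex_ext; rewrite ?creE ?oppr0. Qed.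
Lemma cRB x y : cR (x - y) = cR x - cR y. Proof. by rewrite cRD cRN. Qed.
Lemma cRM x y : cR (x * y) = cR x * cR y.
Proof. by apply: complex_ext; rewrite ?creE; ring. Qed.
Lemma cR0 : cR (0 : R) = 0. Proof. by []. Qed.
Lemma cR1 : cR (1 : R) = 1. Proof. by []. Qed.
Lemma cRsum I (s : seq I) (P : pred I) (F : I -> R) :
  cR (\sum_(i <- s | P i) F i) = \sum_(i <- s | P i) cR (F i).
Proof. by apply: (big_morph _ cRD). Qed.
Lemma cR_nat k : cR (k%:R : R) = k%:R.
Proof. by elim: k => // k IH; rewrite -addn1 !natrD cRD IH. Qed.
Lemma cR_inj x y : cR x = cR y -> x = y. Proof. by case. Qed.
Lemma cR_inv x : x != 0 -> cR x^-1 = (cR x)^-1.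
Proof.
move=> x0; have cx0 : cR x != 0 by apply: contra x0 => /eqP[->].
by apply: (mulfI cx0); rewrite -cRM !mulfV.
Qed.
Lemma complex_split z : z = cR (cre z) + cI R * cR (cim z).
Proof. by apply: complex_ext; rewrite ?creE /=; ring. Qed.
Lemma conj_cR x : conjc (cR x) = cR x. Proof. by apply: complex_ext; rewrite ?creE ?oppr0. Qed.
Lemma add_conj z : z + conjc z = cR (2 * cre z).
Proof. by apply: complex_ext; rewrite ?creE; ring. Qed.
Lemma conjcM z w : conjc (z * w) = conjc z * conjc w. Proof. exact: rmorphM. Qed.
Lemma conjcD z w : conjc (z + w) = conjc z + conjc w. Proof. exact: rmorphD. Qed.
Lemma conjcN z : conjc (- z) = - conjc z. Proof. exact: rmorphN. Qed.
Lemma conjc_sum I (s : seq I) (P : pred I) (F : I -> R[i]) :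
  conjc (\sum_(i <- s | P i) F i) = \sum_(i <- s | P i) conjc (F i).
Proof. exact: rmorph_sum. Qed.

Lemma cabs_normc z : cabs z = ComplexField.Normc.normc z.
Proof. by case: z. Qed.
Lemma cabs_ge0 z : 0 <= cabs z. Proof. exact: sqrtr_ge0. Qed.
Lemma cabs2_ge0 z : 0 <= cabs2 z. Proof. by rewrite addr_ge0 ?sqr_ge0. Qed.
Lemma sqr_cabs z : cabs z ^+ 2 = cabs2 z.
Proof. by rewrite sqr_sqrtr ?cabs2_ge0. Qed.
Lemma cabsM z w : cabs (z * w) = cabs z * cabs w.
Proof. by rewrite !cabs_normc ComplexField.Normc.normcM. Qed.
Lemma cabs2M z w : cabs2 (z * w) = cabs2 z * cabs2 w.
Proof. by rewrite -!sqr_cabs cabsM exprMn. Qed.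
Lemma cabsD z w : cabs (z + w) <= cabs z + cabs w.
Proof. by rewrite !cabs_normc; exact: le_normcD. Qed.
Lemma cabsN z : cabs (- z) = cabs z.
Proof. by rewrite /cabs /cabs2 !creE !sqrrN. Qed.
Lemma cabsB z w : cabs (z - w) <= cabs z + cabs w.
Proof. by rewrite -(cabsN w) cabsD. Qed.
Lemma cabs_subC z w : cabs (z - w) = cabs (w - z).
Proof. by rewrite -cabsN opprB. Qed.
Lemma cabs0 : cabs (0 : R[i]) = 0.
Proof. by rewrite /cabs /cabs2 /= expr0n addr0 sqrtr0. Qed.
Lemma cabs_cR r : cabs (cR r) = `|r|.
Proof. by rewrite /cabs /cabs2 /= expr0n addr0 sqrtr_sqr. Qed.
Lemma cabs_cI : cabs (cI R) = 1.
Proof. by rewrite /cabs /cabs2 /= expr0n add0r expr1n sqrtr1. Qed.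
Lemma cabs_eq0 z : cabs z = 0 -> z = 0.
Proof. by rewrite cabs_normc; exact: ComplexField.Normc.eq0_normc. Qed.
Lemma cabs_conj z : cabs (conjc z) = cabs z.
Proof. by rewrite /cabs /cabs2 !creE sqrrN. Qed.
Lemma mul_conj z : z * conjc z = cR (cabs2 z).
Proof. by apply: complex_ext; rewrite /cabs2 ?creE; ring. Qed.
Lemma cre_le_cabs z : `|cre z| <= cabs z.
Proof. by rewrite -sqrtr_sqr ler_sqrt ?cabs2_ge0// lerDl sqr_ge0. Qed.
Lemma cim_le_cabs z : `|cim z| <= cabs z.
Proof. by rewrite -sqrtr_sqr ler_sqrt ?cabs2_ge0// lerDr sqr_ge0. Qed.
Lemma cabs_le_sum z : cabs z <= `|cre z| + `|cim z|.
Proof.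
rewrite {1}(complex_split z); apply: (le_trans (cabsD _ _)).
by rewrite cabsM cabs_cI mul1r !cabs_cR.
Qed.
Lemma cabs_bigsum I (s : seq I) (P : pred I) (F : I -> R[i]) :
  cabs (\sum_(i <- s | P i) F i) <= \sum_(i <- s | P i) cabs (F i).
Proof.
elim/big_rec2: _ => [|i x z _ xz]; first by rewrite cabs0.
by apply: (le_trans (cabsD _ _)); rewrite lerD2l.
Qed.

Lemma cexpD z w : cexp (z + w) = cexp z * cexp w.
Proof.
rewrite /cexp !cre_add !cim_add expRD cosD sinD.
by apply: complex_ext; rewrite ?creE /=; ring.
Qed.
Lemma cexp0 : cexp (0 : R[i]) = 1.
Proof. by rewrite /cexp /= expR0 cos0 sin0 !mul1r. Qed.
Lemma cexp_cR r : cexp (cR r) = cR (expR r).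
Proof. by rewrite /cexp /= cos0 sin0 mulr1 mulr0. Qed.
Lemma cabs2_cexp z : cabs2 (cexp z) = expR (cre z) ^+ 2.
Proof. by rewrite /cabs2 /= !exprMn -mulrDr cos2Dsin2 mulr1. Qed.
Lemma cabs_cexp z : cabs (cexp z) = expR (cre z).
Proof. by rewrite /cabs cabs2_cexp sqrtr_sqr ger0_norm// expR_ge0. Qed.
Lemma cexpNK z : cexp (- z) * cexp z = 1.
Proof. by rewrite -cexpD addNr cexp0. Qed.
Lemma conj_cexp z : conjc (cexp z) = cexp (conjc z).
Proof. by apply: complex_ext; rewrite ?creE /= ?cre_conj ?cim_conj ?cosN ?sinN ?mulrN. Qed.

(** The derivative is bounded only between [- |y|] and [|y|], which allows bootstrapping:
    first-order estimates for [sin], [cos] and [expR] bound the derivatives in the second-order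
    ones. *)
Lemma derive_bound (f df : R -> R) y K : (forall x, is_derive x 1 f (df x)) ->
  (forall c, `|c| <= `|y| -> `|df c| <= K) -> `|f y - f 0| <= K * `|y|.
Proof.
move=> fd fK.
have fc : continuous f.
  by move=> x; apply: differentiable_continuous; apply/derivable1_diffP; have [] := fd x.
have [y0|/ltW y0] := leP 0 y.
  have [c /[!in_itv]/= /andP[c0 cy] ->] := MVT_segment y0 (fun x _ => fd x) (continuous_subspaceT fc).
  by rewrite normrM subr0 ler_wpM2r// fK// !ger0_norm.
have [c /[!in_itv]/= /andP[yc c0]] := MVT_segment y0 (fun x _ => fd x) (continuous_subspaceT fc).
rewrite distrC => ->; rewrite normrM sub0r normrN ler_wpM2r// fK//.
by rewrite !ler0_norm// lerN2.
Qed.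

Lemma abs_sin_le y : `|sin y| <= `|y|.
Proof.
have := @derive_bound sin cos y 1 (fun x => is_derive_sin x) (fun c _ => cos_max c).
by rewrite sin0 subr0 mul1r.
Qed.

Lemma abs_cos_sub1_le y : `|cos y - 1| <= `|y|.
Proof.
have H c : `|y| >= `|c| -> `|- sin c| <= 1 by rewrite normrN => _; exact: sin_max.
have := @derive_bound cos (fun x => - sin x) y 1 (fun x => is_derive_cos x) H.
by rewrite cos0 mul1r.
Qed.

Lemma abs_cos_sub1_le2 y : `|cos y - 1| <= y ^+ 2.
Proof.
have H c : `|c| <= `|y| -> `|- sin c| <= `|y|.
  by rewrite normrN => cy; apply: le_trans cy; exact: abs_sin_le.
have := @derive_bound cos (fun x => - sin x) y `|y| (fun x => is_derive_cos x) H.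
by rewrite cos0 -expr2 real_normK ?num_real.
Qed.

Lemma abs_sin_sub_le y : `|sin y - y| <= y ^+ 2.
Proof.
have D (x : R) : is_derive x 1 (@sin R - (@id R)) (cos x - 1).
  by apply: is_deriveB.
have H c : `|c| <= `|y| -> `|cos c - 1| <= `|y|.
  by move=> cy; apply: le_trans cy; exact: abs_cos_sub1_le.
have := @derive_bound _ _ y `|y| D H.
rewrite -[X in `|X - _|]/(sin y - y) -[X in `|_ - X|]/(sin 0 - 0).
by rewrite sin0 !subr0 -expr2 real_normK ?num_real.
Qed.

Lemma abs_expR_sub1 x : `|expR x - 1| <= `|x| * expR `|x|.
Proof.
have := expR_ge1Dx x; have := expR_ge1Dx (- x).
have E := expRxMexpNx_1 x; have e0 := expR_gt0 x.
have [x0|/ltW x0] := leP 0 x => A B.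
  rewrite !ger0_norm//; last by rewrite subr_ge0; lra.
  have : expR x * (1 - x) <= expR x * expR (- x) by rewrite ler_wpM2l// ltW.
  by rewrite E; nra.
have e1 : expR x <= 1 by rewrite expR_le1.
rewrite !ler0_norm ?subr_le0//.
have : 1 <= expR (- x) by rewrite -expR0 ler_expR oppr_ge0.
nra.
Qed.

Lemma abs_expR_sub1x x : `|expR x - 1 - x| <= x ^+ 2 * expR `|x|.
Proof.
have D (y : R) : is_derive y 1 (@expR R - cst 1 - (@id R)) (expR y - 1).
  by apply: is_deriveB; rewrite -[X in is_derive _ _ _ X]subr0; exact: is_deriveB.
have H c : `|c| <= `|x| -> `|expR c - 1| <= `|x| * expR `|x|.
  move=> cx; apply: (le_trans (abs_expR_sub1 c)).
  by apply: ler_pM => //; rewrite ?expR_ge0// ler_expR.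
have := @derive_bound _ _ x (`|x| * expR `|x|) D H.
rewrite -[X in `|X - _|]/(expR x - 1 - x) -[X in `|_ - X|]/(expR 0 - 1 - 0).
by rewrite expR0 subrr !subr0 mulrAC -expr2 real_normK ?num_real.
Qed.

(** A global bound on the second-order remainder. It serves both for the complex derivative of
    [cexp] and for the dominating function in the Gaussian shift; the constant 4 is generous. *)
Lemma cabs_cexp_sub1z z : cabs (cexp z - 1 - z) <= 4 * cabs2 z * expR (cabs z).
Proof.
set a := cre z; set b := cim z.
have ab2 : cabs2 z = a ^+ 2 + b ^+ 2 by [].
have az := cre_le_cabs z; have bz := cim_le_cabs z.
have ea : expR `|a| <= expR (cabs z) by rewrite ler_expR.
have ea' : expR a <= expR (cabs z) by rewrite ler_expR (le_trans (ler_norm _)).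
have ez : 0 < expR (cabs z) by exact: expR_gt0.
apply: (le_trans (cabs_le_sum _)).
have -> : cre (cexp z - 1 - z) = expR a * (cos b - 1) + (expR a - 1 - a).
  by rewrite !creE /= -/a -/b; ring.
have -> : cim (cexp z - 1 - z) = expR a * (sin b - b) + (expR a - 1) * b.
  by rewrite !creE /= -/a -/b; ring.
have h1 : `|expR a * (cos b - 1)| <= b ^+ 2 * expR (cabs z).
  rewrite normrM ger0_norm ?expR_ge0// mulrC.
  by apply: ler_pM; rewrite ?expR_ge0 ?abs_cos_sub1_le2.
have h2 : `|expR a - 1 - a| <= a ^+ 2 * expR (cabs z).
  by apply: (le_trans (abs_expR_sub1x a)); rewrite ler_wpM2l// sqr_ge0.
have h3 : `|expR a * (sin b - b)| <= b ^+ 2 * expR (cabs z).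
  rewrite normrM ger0_norm ?expR_ge0// mulrC.
  by apply: ler_pM; rewrite ?expR_ge0 ?abs_sin_sub_le.
have h4 : `|(expR a - 1) * b| <= `|a| * `|b| * expR (cabs z).
  rewrite normrM mulrAC; apply: ler_wpM2r => //.
  by apply: (le_trans (abs_expR_sub1 a)); apply: ler_wpM2l.
have h5 : `|a| * `|b| <= a ^+ 2 + b ^+ 2.
  rewrite -(@real_normK _ a) ?num_real// -(@real_normK _ b) ?num_real//.
  have := sqr_ge0 (`|a| - `|b|); have := normr_ge0 a; have := normr_ge0 b; nra.
have h6 : `|a| * `|b| * expR (cabs z) <= (a ^+ 2 + b ^+ 2) * expR (cabs z).
  by rewrite ler_wpM2r// ltW.
have := ler_normD (expR a * (cos b - 1)) (expR a - 1 - a).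
have := ler_normD (expR a * (sin b - b)) ((expR a - 1) * b).
have a20 : 0 <= a ^+ 2 * expR (cabs z) by rewrite mulr_ge0 ?sqr_ge0 ?ltW.
have b20 : 0 <= b ^+ 2 * expR (cabs z) by rewrite mulr_ge0 ?sqr_ge0 ?ltW.
rewrite ab2; lra.
Qed.

End ComplexFacts.

(** * Gaussian mass and sigma-finiteness *)

Section GaussMass.
Variables (R : realType) (n : nat).
Local Notation mcpt := (@mcpt R n).
Local Notation leb := (@lebesgue_measure R).

Lemma gauss_line (t : R) : 0 < t -> exists2 c : R, 0 < c &
  (\int[leb]_a (expR (- (t * a ^+ 2)))%:E = c%:E)%E.
Proof.
(* [s] is the standard deviation of the centred normal law with density proportional to
   [exp (- t a^2)]. *)
move=> t0; pose s := Num.sqrt (2 * t)^-1.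
have s2 : s ^+ 2 = (2 * t)^-1 by rewrite sqr_sqrtr// invr_ge0 mulr_ge0 ?ltW.
have s0 : s != 0 by rewrite -sqrf_eq0 s2 invr_eq0 mulf_neq0 ?gt_eqF.
have p0 := normal_peak_gt0 s0.
exists (normal_peak s)^-1; first by rewrite invr_gt0.
have := integral_normal_pdf 0 s; rewrite normal_pdfE// => E.
transitivity (((normal_peak s)^-1)%:E *
   \int[leb]_a (normal_peak s * normal_fun 0 s a)%:E)%E; last by rewrite E mule1.
rewrite -ge0_integralZl//.
- apply: eq_integral => a _; rewrite -EFinM mulKf ?gt_eqF// /normal_fun s2 subr0.
  congr (expR _)%:E; rewrite -mulr_natr invfM; field; exact: lt0r_neq0.
- by apply/measurable_EFinP; apply: measurable_funM => //; exact: measurable_normal_fun.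
- by move=> a _; rewrite lee_fin mulr_ge0 ?normal_fun_ge0// ltW.
- by rewrite lee_fin invr_ge0 ltW.
Qed.

Lemma gauss_plane (t : R) : 0 < t -> exists2 c : R, 0 < c &
  (\int[leb]_a \int[leb]_b (expR (- (t * cabs2 (Complex a b))))%:E = c%:E)%E.
Proof.
move=> t0; have [c c0 cE] := gauss_line t0.
have mg : measurable_fun setT (fun a : measurableTypeR R => (expR (- (t * a ^+ 2)))%:E).
  apply/measurable_EFinP; apply: measurableT_comp => //; apply: measurableT_comp => //.
  by apply: measurable_funM => //; exact: measurable_funX.
exists (c * c); first exact: mulr_gt0.
transitivity (\int[leb]_a ((expR (- (t * a ^+ 2)))%:E * c%:E))%E.
  apply: eq_integral => a _; rewrite -cE -ge0_integralZl//.
  by apply: eq_integral => b _; rewrite -EFinM -expRD /cabs2 /=; congr (expR _)%:E; ring.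
by rewrite ge0_integralZr// ?cE ?EFinM// lee_fin ltW.
Qed.

Definition vnorm2 (x : cpt R n) : R := \sum_j cabs2 (x j).

Lemma niint_aux_gauss (t : R) : 0 < t -> exists2 c : R, 0 < c &
  forall s x, uniq s -> niint_aux s (fun y : cpt R n => (expR (- (t * vnorm2 y)))%:E) x =
    (c ^+ size s * expR (- (t * \sum_(j | j \notin s) cabs2 (x j))))%:E.
Proof.
move=> t0; have [c c0 cE] := gauss_plane t0; exists c => //.
elim=> [|j s IH] x /=; first by rewrite expr0 mul1r => _; congr (expR (- (t * _)))%:E; exact: eq_bigl.
move=> /andP[js us].
set E := \sum_(k | k \notin j :: s) cabs2 (x k).
have H a b : \sum_(k | k \notin s) cabs2 (vupd x j (Complex a b) k) = cabs2 (Complex a b) + E.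
  rewrite (bigD1 j)//= {1}/vupd eqxx; congr (_ + _).
  apply: eq_big => [k|k /andP[ks kj]]; first by rewrite inE negb_or andbC.
  by rewrite /vupd (negbTE kj).
transitivity (\int[leb]_a \int[leb]_b ((c ^+ size s * expR (- (t * E)))%:E *
    (expR (- (t * cabs2 (Complex a b))))%:E))%E.
  apply: eq_integral => a _; apply: eq_integral => b _; rewrite IH// H -EFinM mulrDr opprD expRD.
  by congr _%:E; ring.
have k0 : (0 <= (c ^+ size s * expR (- (t * E)))%:E)%E.
  by rewrite lee_fin mulr_ge0 ?expR_ge0// exprn_ge0// ltW.
have mg : measurable_fun setT (fun p : measurableTypeR R * measurableTypeR R =>
    (expR (- (t * cabs2 (Complex p.1 p.2))))%:E).
  apply/measurable_EFinP; apply: measurableT_comp => //; apply: measurableT_comp => //.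
  apply: measurable_funM => //; apply: measurable_funD; apply: measurable_funX.
    exact: measurable_fst.
  exact: measurable_snd.
have g0 (p : R * R) : (0 <= (expR (- (t * cabs2 (Complex p.1 p.2))))%:E)%E.
  by rewrite lee_fin expR_ge0.
transitivity ((c ^+ size s * expR (- (t * E)))%:E *
    \int[leb]_a \int[leb]_b (expR (- (t * cabs2 (Complex a b))))%:E)%E.
  rewrite -ge0_integralZl//.
  - apply: eq_integral => a _; rewrite -ge0_integralZl//.
    exact: (measurableT_comp mg (pair1_measurable a)).
  - exact: (@measurable_fun_fubini_tonelli_F _ _ _ _ _ leb _ mg g0).
  - by move=> a _; apply: integral_ge0 => b _; exact: (g0 (a, b)).
by rewrite cE -EFinM exprS; congr _%:E; ring.
Qed.

Lemma measurable_vnorm2 : measurable_fun setT (vnorm2 : mcpt -> R).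
Proof.
apply: measurable_sum => j; apply: measurable_funD; apply: measurable_funX.
  exact: measurable_cre_coord.
exact: measurable_cim_coord.
Qed.

Lemma gauss_mass (t : R) : 0 < t -> exists2 c : R, 0 < c &
  (\int[@cptmu R n]_x (expR (- (t * vnorm2 x)))%:E = c%:E)%E.
Proof.
move=> t0; have [c c0 cE] := niint_aux_gauss t0; exists (c ^+ size (enum 'I_n)).
  exact: exprn_gt0.
rewrite -niintE.
- rewrite /niint cE ?enum_uniq// big1 => [|j]; last by rewrite mem_enum.
  by rewrite mulr0 oppr0 expR0 mulr1.
- apply/measurable_EFinP; apply: measurableT_comp => //; apply: measurableT_comp => //.
  apply: measurable_funM => //; exact: measurable_vnorm2.
- by move=> x; rewrite lee_fin expR_ge0.
Qed.

Let cptmu_sigma_finite : sigma_finite setT (@cptmu R n).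
Proof.
exists (fun k : nat => [set x : mcpt | vnorm2 x <= k%:R]).
  apply/seteqP; split => // x _; exists (Num.truncn (vnorm2 x)).+1 => //=.
  by apply: ltW; exact: truncnS_gt.
have mA (k : nat) : measurable [set x : mcpt | vnorm2 x <= k%:R].
  have := measurable_vnorm2 measurableT (@measurable_itv R `]-oo, k%:R]).
  by rewrite setTI; congr measurable; apply/seteqP; split => x /=; rewrite in_itv.
move=> k; split => //.
have [c c0 cE] := gauss_mass ltr01.
(* On the ball [vnorm2 x <= k] the indicator is at most [e^k e^{-|x|^2}], so the Gaussian mass
   bounds the volume of the ball. *)
apply: (@le_lt_trans _ _ (\int[@cptmu R n]_x ((expR k%:R)%:E * (expR (- (1 * vnorm2 x)))%:E))%E).
  rewrite (_ : cptmu _ = \int[@cptmu R n]_x (\1_[set x : mcpt | vnorm2 x <= k%:R] x)%:E)%E;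
    last by rewrite integral_indic// setIT.
  apply: ge0_le_integral => //.
  - by apply/measurable_EFinP; exact: measurable_indic.
  - apply: measurable_funeM; apply/measurable_EFinP; apply: measurableT_comp => //.
    apply: measurableT_comp => //; apply: measurable_funM => //; exact: measurable_vnorm2.
  - move=> x _; rewrite -EFinM lee_fin -expRD mul1r.
    rewrite indicE; case: (boolP (x \in _)) => [|_]; last exact: expR_ge0.
    by rewrite inE /= => xk; rewrite -[leLHS]expR0 ler_expR subr_ge0.
rewrite ge0_integralZl// ?cE ?ltey//.
apply/measurable_EFinP; apply: measurableT_comp => //; apply: measurableT_comp => //.
apply: measurable_funM => //; exact: measurable_vnorm2.
Qed.

HB.instance Definition _ := @Measure_isSigmaFinite.Build _ mcpt R (@cptmu R n) cptmu_sigma_finite.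

End GaussMass.

(** * Integrals of complex functions *)

Section Cmeas.
Context d (T : measurableType d) (R : realType).
Implicit Types f g : T -> R[i].

Definition cmeas f :=
  measurable_fun setT (fun x => cre (f x)) /\ measurable_fun setT (fun x => cim (f x)).

Lemma cmeas_cst (c : R[i]) : cmeas (fun _ => c).
Proof. by split; exact: measurable_cst. Qed.

Lemma eq_cmeas f g : f =1 g -> cmeas f -> cmeas g.
Proof. by move=> /funext ->. Qed.

Lemma cmeasD f g : cmeas f -> cmeas g -> cmeas (fun x => f x + g x).
Proof.
move=> [f1 f2] [g1 g2]; split.
  by under eq_fun do rewrite cre_add; exact: measurable_funD.
by under eq_fun do rewrite cim_add; exact: measurable_funD.
Qed.

Lemma cmeasN f : cmeas f -> cmeas (fun x => - f x).
Proof.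
move=> [f1 f2]; split.
  by under eq_fun do rewrite cre_opp; exact: measurableT_comp.
by under eq_fun do rewrite cim_opp; exact: measurableT_comp.
Qed.

Lemma cmeasB f g : cmeas f -> cmeas g -> cmeas (fun x => f x - g x).
Proof. by move=> mf mg; apply: cmeasD => //; exact: cmeasN. Qed.

Lemma cmeasM f g : cmeas f -> cmeas g -> cmeas (fun x => f x * g x).
Proof.
move=> [f1 f2] [g1 g2]; split.
  by under eq_fun do rewrite cre_mul; apply: measurable_funB; exact: measurable_funM.
by under eq_fun do rewrite cim_mul; apply: measurable_funD; exact: measurable_funM.
Qed.

Lemma cmeas_conj f : cmeas f -> cmeas (fun x => conjc (f x)).
Proof.
move=> [f1 f2]; split; first by under eq_fun do rewrite cre_conj.
by under eq_fun do rewrite cim_conj; exact: measurableT_comp.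
Qed.

Lemma cmeas_cR (f : T -> R) : measurable_fun setT f -> cmeas (fun x => cR (f x)).
Proof. by move=> mf; split => //=; exact: measurable_cst. Qed.

Lemma cmeas_sum I (s : seq I) (f : I -> T -> R[i]) : (forall i, cmeas (f i)) ->
  cmeas (fun x => \sum_(i <- s) f i x).
Proof.
move=> mf; elim: s => [|i s IH].
  by under eq_fun do rewrite big_nil; exact: cmeas_cst.
by under eq_fun do rewrite big_cons; exact: cmeasD.
Qed.

Lemma cmeas_cexp f : cmeas f -> cmeas (fun x => cexp (f x)).
Proof.
move=> [f1 f2]; split; apply: measurable_funM.
- exact: measurableT_comp.
- apply: (measurableT_comp (f := @cos R)) => //.
  exact: (continuous_measurable_fun (@continuous_cos R)).
- exact: measurableT_comp.
- apply: (measurableT_comp (f := @sin R)) => //.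
  exact: (continuous_measurable_fun (@continuous_sin R)).
Qed.

Lemma measurable_cabs2 f : cmeas f -> measurable_fun setT (fun x => cabs2 (f x)).
Proof. by move=> [f1 f2]; apply: measurable_funD; exact: measurable_funX. Qed.

Lemma measurable_cabs f : cmeas f -> measurable_fun setT (fun x => cabs (f x)).
Proof.
move=> mf; apply: (measurableT_comp (f := @Num.sqrt R)); last exact: measurable_cabs2.
exact: (continuous_measurable_fun (@sqrt_continuous R)).
Qed.

End Cmeas.

Lemma cmeas_comp d (T : measurableType d) d' (T' : measurableType d') (R : realType)
    (phi : T' -> T) (f : T -> R[i]) :
  measurable_fun setT phi -> cmeas f -> cmeas (fun x => f (phi x)).
Proof.
move=> mphi [f1 f2]; split; first exact: (measurableT_comp f1 mphi).
exact: (measurableT_comp f2 mphi).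
Qed.

(** Locked, so that complex integrals are handled by linearity and Fubini and split into real and
    imaginary parts only through [CintE]. *)
HB.lock Definition Cint d (T : measurableType d) (R : realType) (mu : {measure set T -> \bar R})
  (f : T -> R[i]) : R[i] := Complex (\int[mu]_x cre (f x)) (\int[mu]_x cim (f x)).

Section CIntegral.
Context d (T : measurableType d) (R : realType) (mu : {measure set T -> \bar R}).
Implicit Types f g : T -> R[i].

Definition cinteg f := cmeas f /\ (\int[mu]_x (cabs (f x))%:E < +oo)%E.

Local Notation Cint := (Cint mu).

Lemma CintE f : Cint f = Complex (\int[mu]_x cre (f x)) (\int[mu]_x cim (f x)).
Proof. by rewrite Cint.unlock. Qed.

Lemma eq_Cint f g : f =1 g -> Cint f = Cint g. Proof. by move=> /funext ->. Qed.

Lemma eq_cinteg f g : f =1 g -> cinteg f -> cinteg g. Proof. by move=> /funext ->. Qed.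

Lemma le_cinteg f (g : T -> R) : cmeas f -> measurable_fun setT g ->
  (forall x, cabs (f x) <= g x) -> (\int[mu]_x (g x)%:E < +oo)%E -> cinteg f.
Proof.
move=> mf mg fg goo; split => //; apply: le_lt_trans goo.
apply: ge0_le_integral => //.
- by move=> x _; rewrite lee_fin cabs_ge0.
- by apply/measurable_EFinP; exact: measurable_cabs.
- exact/measurable_EFinP.
- by move=> x _; rewrite lee_fin.
Qed.

Lemma cinteg_abs f : cinteg f -> mu.-integrable setT (fun x => (cabs (f x))%:E).
Proof.
move=> [mf foo]; apply/integrableP; split.
  by apply/measurable_EFinP; exact: measurable_cabs.
by under eq_integral do rewrite gee0_abs ?lee_fin ?cabs_ge0//.
Qed.

Lemma cinteg_re f : cinteg f -> mu.-integrable setT (EFin \o (fun x => cre (f x))).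
Proof.
move=> fi; apply: (le_integrable _ _ _ (cinteg_abs fi)) => //.
  by apply/measurable_EFinP; have [[]] := fi.
by move=> x _; rewrite lee_fin (ger0_norm (cabs_ge0 _)) cre_le_cabs.
Qed.

Lemma cinteg_im f : cinteg f -> mu.-integrable setT (EFin \o (fun x => cim (f x))).
Proof.
move=> fi; apply: (le_integrable _ _ _ (cinteg_abs fi)) => //.
  by apply/measurable_EFinP; have [[]] := fi.
by move=> x _; rewrite lee_fin (ger0_norm (cabs_ge0 _)) cim_le_cabs.
Qed.

Lemma cintegD f g : cinteg f -> cinteg g -> cinteg (fun x => f x + g x).
Proof.
move=> fi gi; have [mf foo] := fi; have [mg goo] := gi.
apply: (@le_cinteg _ (fun x => cabs (f x) + cabs (g x))).
- exact: cmeasD.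
- by apply: measurable_funD; exact: measurable_cabs.
- by move=> x; exact: cabsD.
- under eq_integral do rewrite EFinD.
  rewrite ge0_integralD//; first exact: lte_add_pinfty.
  + by move=> x _; rewrite lee_fin cabs_ge0.
  + by apply/measurable_EFinP; exact: measurable_cabs.
  + by move=> x _; rewrite lee_fin cabs_ge0.
  + by apply/measurable_EFinP; exact: measurable_cabs.
Qed.

Lemma cintegZ c f : cinteg f -> cinteg (fun x => c * f x).
Proof.
move=> fi; have [mf foo] := fi.
apply: (@le_cinteg _ (fun x => cabs c * cabs (f x))).
- by apply: cmeasM => //; exact: cmeas_cst.
- by apply: measurable_funM => //; exact: measurable_cabs.
- by move=> x; rewrite cabsM.
- under eq_integral do rewrite EFinM.
  rewrite ge0_integralZl//.
  + by rewrite lte_mul_pinfty ?lee_fin ?cabs_ge0.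
  + by apply/measurable_EFinP; exact: measurable_cabs.
  + by move=> x _; rewrite lee_fin cabs_ge0.
  + by rewrite lee_fin cabs_ge0.
Qed.

Lemma cintegN f : cinteg f -> cinteg (fun x => - f x).
Proof. by move=> /(cintegZ (-1)); apply: eq_cinteg => x; rewrite mulN1r. Qed.

Lemma cintegB f g : cinteg f -> cinteg g -> cinteg (fun x => f x - g x).
Proof. by move=> fi gi; apply: cintegD => //; exact: cintegN. Qed.

Lemma CintD f g : cinteg f -> cinteg g -> Cint (fun x => f x + g x) = Cint f + Cint g.
Proof.
move=> fi gi; rewrite !CintE; apply: complex_ext; rewrite ?creE /=.
  under eq_Rintegral do rewrite cre_add; apply: RintegralD => //; exact: cinteg_re.
under eq_Rintegral do rewrite cim_add; apply: RintegralD => //; exact: cinteg_im.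
Qed.

Lemma CintZ c f : cinteg f -> Cint (fun x => c * f x) = c * Cint f.
Proof.
move=> fi; have ire := cinteg_re fi; have iim := cinteg_im fi.
have zre (r : R) : mu.-integrable setT (EFin \o (fun x => r * cre (f x))).
  by have := integrableZl measurableT r ire.
have zim (r : R) : mu.-integrable setT (EFin \o (fun x => r * cim (f x))).
  by have := integrableZl measurableT r iim.
rewrite !CintE; apply: complex_ext; rewrite ?creE /=.
  under eq_Rintegral do rewrite cre_mul.
  by rewrite RintegralB// !RintegralZl.
under eq_Rintegral do rewrite cim_mul.
by rewrite RintegralD// !RintegralZl.
Qed.

Lemma CintN f : cinteg f -> Cint (fun x => - f x) = - Cint f.
Proof.
move=> fi; rewrite -mulN1r -CintZ//; apply: eq_Cint => x; by rewrite mulN1r.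
Qed.

Lemma CintB f g : cinteg f -> cinteg g -> Cint (fun x => f x - g x) = Cint f - Cint g.
Proof. by move=> fi gi; rewrite CintD ?CintN//; exact: cintegN. Qed.

Lemma cabs_Cint_le f : cinteg f -> ((cabs (Cint f))%:E <= \int[mu]_x (cabs (f x))%:E)%E.
Proof.
move=> fi; have [mf foo] := fi; set z := Cint f.
have a0 x : (0 <= (cabs (f x))%:E)%E by rewrite lee_fin cabs_ge0.
have ma : measurable_fun setT (fun x => (cabs (f x))%:E).
  by apply/measurable_EFinP; exact: measurable_cabs.
have [z0|z0] := eqVneq (cabs z) 0; first by rewrite z0 integral_ge0.
have zp : 0 < cabs z by rewrite lt0r z0 cabs_ge0.
have zi := cintegZ (conjc z) fi.
(* With [z] the integral itself, [|z|^2] is the real part of the integral of [conj z * f], hence at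
   most [|z|] times the integral of [|f|]. *)
have E : cabs z ^+ 2 = cre (Cint (fun x => conjc z * f x)).
  by rewrite CintZ// -/z mulrC mul_conj sqr_cabs.
have Ioo : (\int[mu]_x (cabs (f x))%:E)%E \is a fin_num by rewrite ge0_fin_numE// integral_ge0.
have H : ((cabs z ^+ 2)%:E <= (cabs z)%:E * \int[mu]_x (cabs (f x))%:E)%E.
  rewrite -ge0_integralZl//; last by rewrite lee_fin cabs_ge0.
  rewrite E CintE /= /Rintegral fineK; last exact: integrable_fin_num (cinteg_re zi).
  apply: le_integral => //; first exact: cinteg_re zi.
    by have := integrableZl measurableT (cabs z) (cinteg_abs fi).
  move=> x _; rewrite -EFinM lee_fin -[cabs z]cabs_conj -cabsM.
  by apply: le_trans (cre_le_cabs _); exact: ler_norm.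
move: H; rewrite -(fineK Ioo) -EFinM !lee_fin expr2.
by rewrite ler_pM2l.
Qed.

End CIntegral.

(** * Fubini for complex functions *)

Section ComplexFubini.
Context d1 d2 (T1 : measurableType d1) (T2 : measurableType d2) (R : realType).
Variable m1 : {sigma_finite_measure set T1 -> \bar R}.
Variable m2 : {sigma_finite_measure set T2 -> \bar R}.

Lemma cabs_Cint_le_ge0 d (T : measurableType d) (mu : {measure set T -> \bar R}) (f : T -> R[i]) :
  cmeas f -> ((cabs (Cint mu f))%:E <= \int[mu]_x (cabs (f x))%:E)%E.
Proof.
move=> mf; have [foo|] := boolP (\int[mu]_x (cabs (f x))%:E < +oo)%E.
  exact: cabs_Cint_le.
by rewrite -leNgt leye_eq => /eqP ->; rewrite leey.
Qed.

(** The inner integrals are finite only almost everywhere, so each inner [fine] is first removed by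
    almost everywhere equality. *)
Lemma Rintegral_swap (r : T1 * T2 -> R) :
  (m1 \x m2)%E.-integrable setT (EFin \o r) ->
  \int[m1]_x \int[m2]_y r (x, y) = \int[m2]_y \int[m1]_x r (x, y).
Proof.
move=> ir; rewrite /Rintegral.
have mr := measurable_int _ ir.
have mar : measurable_fun setT (abse \o (EFin \o r)) by exact: measurableT_comp.
have iF := integrable_fubini_F ir.
have iG : m2.-integrable setT (fubini_G m1 (EFin \o r)).
  apply/integrableP; split; first exact: measurable_fubini_G ir.
  apply: le_lt_trans ((integrable21ltyP m1 m2 mr).1 ir).
  apply: ge0_le_integral => //.
  - by apply: measurableT_comp => //; exact: measurable_fubini_G ir.
  - exact: (@measurable_fun_fubini_tonelli_G _ _ _ _ _ m1 _ mar (fun p => abse_ge0 _)).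
  - move=> y _; apply: le_abse_integral => //.
    exact: (measurableT_comp mr (pair2_measurable y)).
have -> : (\int[m1]_x (fine (\int[m2]_y (r (x, y))%:E))%:E =
          \int[m1]_x \int[m2]_y (r (x, y))%:E)%E.
  apply: ae_eq_integral => //.
  - apply/measurable_EFinP; apply: (measurableT_comp (@fine_measurable R setT measurableT)).
    by have /integrableP[] := iF.
  - by have /integrableP[] := iF.
  - by have := integrable_ae measurableT iF; apply: filterS => x H _; rewrite fineK//; exact: H.
have -> : (\int[m2]_y (fine (\int[m1]_x (r (x, y))%:E))%:E =
          \int[m2]_y \int[m1]_x (r (x, y))%:E)%E.
  apply: ae_eq_integral => //.
  - apply/measurable_EFinP; apply: (measurableT_comp (@fine_measurable R setT measurableT)).
    by have /integrableP[] := iG.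
  - by have /integrableP[] := iG.
  - by have := integrable_ae measurableT iG; apply: filterS => x H _; rewrite fineK//; exact: H.
by congr fine; exact: (Fubini ir).
Qed.

Variable f : T1 * T2 -> R[i].
Hypothesis mf : cmeas f.

Lemma cmeas_Cint : cmeas (fun x => Cint m2 (fun y => f (x, y))).
Proof.
have [mf1 mf2] := mf; split.
  under eq_fun do rewrite CintE /=.
  apply: (measurableT_comp (@fine_measurable R setT measurableT)).
  apply: (@measurable_integral_snd _ _ _ _ _ m2 (fun x y => cre (f (x, y)))).
  by rewrite [X in measurable_fun _ X](_ : _ = (fun p => cre (f p)))//; apply/funext => -[].
under eq_fun do rewrite CintE /=.
apply: (measurableT_comp (@fine_measurable R setT measurableT)).
apply: (@measurable_integral_snd _ _ _ _ _ m2 (fun x y => cim (f (x, y)))).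
by rewrite [X in measurable_fun _ X](_ : _ = (fun p => cim (f p)))//; apply/funext => -[].
Qed.

Let mabs : measurable_fun setT (fun p => (cabs (f p))%:E).
Proof. by apply/measurable_EFinP; exact: measurable_cabs. Qed.

Let abs0 p : (0 <= (cabs (f p))%:E)%E. Proof. by rewrite lee_fin cabs_ge0. Qed.

Hypothesis foo : (\int[m1]_x \int[m2]_y (cabs (f (x, y)))%:E < +oo)%E.

Lemma Cint_swap : Cint m1 (fun x => Cint m2 (fun y => f (x, y))) =
  Cint m2 (fun y => Cint m1 (fun x => f (x, y))).
Proof.
have [mf1 mf2] := mf.
have int (r : T1 * T2 -> R) : measurable_fun setT r -> (forall p, `|r p| <= cabs (f p)) ->
    (m1 \x m2)%E.-integrable setT (EFin \o r).
  move=> mr rf; apply/integrable12ltyP; first exact/measurable_EFinP.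
  apply: le_lt_trans foo.
  have mr' : measurable_fun setT (fun p => `|(r p)%:E|%E).
    by apply: measurableT_comp => //; exact/measurable_EFinP.
  apply: ge0_le_integral => //.
  - by move=> x _; apply: integral_ge0.
  - exact: (@measurable_fun_fubini_tonelli_F _ _ _ _ _ m2 _ mr' (fun p => abse_ge0 _)).
  - exact: (@measurable_fun_fubini_tonelli_F _ _ _ _ _ m2 _ mabs abs0).
  - move=> x _; apply: ge0_le_integral => //.
    + exact: (measurableT_comp mr' (pair1_measurable x)).
    + exact: (measurableT_comp mabs (pair1_measurable x)).
    + by move=> y _; rewrite lee_fin; exact: rf.
rewrite [LHS]CintE [RHS]CintE; apply: complex_ext => /=.
  under [LHS]eq_Rintegral do rewrite CintE /=.
  under [RHS]eq_Rintegral do rewrite CintE /=.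
  by apply: (Rintegral_swap (r := fun p => cre (f p))); apply: int => // p; exact: cre_le_cabs.
under [LHS]eq_Rintegral do rewrite CintE /=.
under [RHS]eq_Rintegral do rewrite CintE /=.
by apply: (Rintegral_swap (r := fun p => cim (f p))); apply: int => // p; exact: cim_le_cabs.
Qed.

End ComplexFubini.

Section CptIntegral.
Variables (R : realType) (n : nat).
Local Notation mcpt := (@mcpt R n).
Local Notation mu := (@cptmu R n).

Lemma ciintE (F : mcpt -> R[i]) : cinteg mu F -> ciint F = Cint mu F.
Proof.
move=> Fi; rewrite CintE; apply: complex_ext => /=.
  by rewrite riintE//; exact: cinteg_re.
by rewrite riintE//; exact: cinteg_im.
Qed.

Lemma Rintegral_preserving (T : 'I_n -> R[i] -> R[i]) (r : mcpt -> R) :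
  (forall j, plane_preserving (T j)) -> measurable_fun setT r ->
  \int[mu]_x r (fun j => T j (x j)) = \int[mu]_x r x.
Proof.
move=> TP mr; rewrite /Rintegral integralE [in RHS]integralE.
have mE : measurable_fun setT (EFin \o r) by exact/measurable_EFinP.
congr (fine (_ - _)%E).
  rewrite -[RHS](ge0_integral_cptmu_preserving TP)//; last exact: measurable_funepos.
  by apply: eq_integral => x _; rewrite !funeposE.
rewrite -[RHS](ge0_integral_cptmu_preserving TP)//; last exact: measurable_funeneg.
by apply: eq_integral => x _; rewrite !funenegE.
Qed.

Lemma Cint_preserving (T : 'I_n -> R[i] -> R[i]) (f : mcpt -> R[i]) :
  (forall j, plane_preserving (T j)) -> cmeas f ->
  Cint mu (fun x : mcpt => f (fun j => T j (x j))) = Cint mu f.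
Proof.
move=> TP [f1 f2]; rewrite !CintE; apply: complex_ext => /=.
  exact: (Rintegral_preserving (r := fun x => cre (f x)) TP).
exact: (Rintegral_preserving (r := fun x => cim (f x)) TP).
Qed.

Lemma cinteg_preserving (T : 'I_n -> R[i] -> R[i]) (f : mcpt -> R[i]) :
  (forall j, plane_preserving (T j)) -> cinteg mu f ->
  cinteg mu (fun x : mcpt => f (fun j => T j (x j))).
Proof.
move=> TP [mf foo]; split.
  exact: (cmeas_comp (measurable_preserving TP) mf).
rewrite (ge0_integral_cptmu_preserving (F := fun x => (cabs (f x))%:E) TP)//.
  by apply/measurable_EFinP; exact: measurable_cabs.
by move=> x; rewrite lee_fin cabs_ge0.
Qed.

Lemma ge0_integral_shift (w : cpt R n) (F : mcpt -> \bar R) :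
  measurable_fun setT F -> (forall x, 0 <= F x)%E ->
  (\int[mu]_x F (vadd x w) = \int[mu]_x F x)%E.
Proof. exact: (ge0_integral_cptmu_preserving (fun j => plane_preserving_translate (w j))). Qed.

Lemma Cint_shift (w : cpt R n) (f : mcpt -> R[i]) : cmeas f ->
  Cint mu (fun x : mcpt => f (vadd x w)) = Cint mu f.
Proof. exact: (Cint_preserving (fun j => plane_preserving_translate (w j))). Qed.

Lemma cinteg_shift (w : cpt R n) (f : mcpt -> R[i]) : cinteg mu f ->
  cinteg mu (fun x : mcpt => f (vadd x w)).
Proof. exact: (cinteg_preserving (fun j => plane_preserving_translate (w j))). Qed.

Lemma plane_preserving_unit (u : R[i]) : cabs2 u = 1 -> plane_preserving (fun z => u * z).
Proof. by case: u => c s; rewrite /cabs2 /=; exact: plane_preserving_rot. Qed.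

Lemma ge0_integral_rot (u : R[i]) (F : mcpt -> \bar R) : cabs2 u = 1 ->
  measurable_fun setT F -> (forall x, 0 <= F x)%E ->
  (\int[mu]_x F (vscale u x) = \int[mu]_x F x)%E.
Proof.
move=> u1; exact: (ge0_integral_cptmu_preserving (fun j => plane_preserving_unit u1)).
Qed.

Lemma Cint_rot (u : R[i]) (f : mcpt -> R[i]) : cabs2 u = 1 -> cmeas f ->
  Cint mu (fun x : mcpt => f (vscale u x)) = Cint mu f.
Proof. move=> u1; exact: (Cint_preserving (fun j => plane_preserving_unit u1)). Qed.

Lemma cmeas_coord (j : 'I_n) : cmeas (fun x : mcpt => x j).
Proof. by split; [exact: measurable_cre_coord|exact: measurable_cim_coord]. Qed.

End CptIntegral.

(** * Quadratic forms and Gaussian integrals *)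

(** Bilinear and not sesquilinear: a real quadratic polynomial is written as [bl] on the vectors
    [em x = (x, conj x)], and the same formula extends it to all of [C^{2n}], where the complex
    shifts take place. *)
HB.lock Definition bl (R : realType) m (S : 'M[R[i]]_m) (u v : 'cV[R[i]]_m) : R[i] :=
  (u^T *m S *m v) 0 0.
HB.lock Definition ld (R : realType) m (l u : 'cV[R[i]]_m) : R[i] := (l^T *m u) 0 0.

Definition vconj (R : realType) n (x : cpt R n) : cpt R n := fun j => conjc (x j).
Definition cv (R : realType) n (x : cpt R n) : 'cV[R[i]]_n := \col_j x j.
(* [em x] collects the holomorphic and antiholomorphic coordinates [(x, conj x)]. *)
HB.lock Definition em (R : realType) n (x : cpt R n) : 'cV[R[i]]_(n + n) :=
  col_mx (cv x) (cv (vconj x)).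

Section BilinearForms.
Variables (R : realType).
Local Notation C := (R[i]).

Section Fixed.
Variable m : nat.
Implicit Types (S : 'M[C]_m) (u v w l : 'cV[C]_m) (c : C).

Lemma blE S u v : bl S u v = \sum_i \sum_j u i 0 * S i j * v j 0.
Proof.
rewrite bl.unlock mxE exchange_big /=; apply: eq_bigr => j _.
by rewrite !mxE mulr_suml; apply: eq_bigr => i _; rewrite mxE.
Qed.
Lemma ldE l u : ld l u = \sum_i l i 0 * u i 0.
Proof. by rewrite ld.unlock mxE; apply: eq_bigr => i _; rewrite mxE. Qed.
Lemma blDl S u v w : bl S (u + v) w = bl S u w + bl S v w.
Proof. by rewrite bl.unlock linearD /= !mulmxDl mxE. Qed.
Lemma blDr S u v w : bl S u (v + w) = bl S u v + bl S u w.
Proof. by rewrite bl.unlock mulmxDr mxE. Qed.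
Lemma blZl S c u v : bl S (c *: u) v = c * bl S u v.
Proof. by rewrite bl.unlock linearZ /= -!scalemxAl mxE. Qed.
Lemma blZr S c u v : bl S u (c *: v) = c * bl S u v.
Proof. by rewrite bl.unlock -scalemxAr mxE. Qed.
Lemma blNl S u v : bl S (- u) v = - bl S u v.
Proof. by rewrite -scaleN1r blZl mulN1r. Qed.
Lemma blNr S u v : bl S u (- v) = - bl S u v.
Proof. by rewrite -scaleN1r blZr mulN1r. Qed.
Lemma bl0l S u : bl S 0 u = 0. Proof. by rewrite bl.unlock linear0 !mul0mx mxE. Qed.
Lemma blDm S S' u v : bl (S + S') u v = bl S u v + bl S' u v.
Proof. by rewrite bl.unlock mulmxDr mulmxDl mxE. Qed.
Lemma blZm S c u v : bl (c *: S) u v = c * bl S u v.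
Proof. by rewrite bl.unlock -scalemxAr -scalemxAl mxE. Qed.
Lemma bl_tr S u v : bl S^T u v = bl S v u.
Proof.
rewrite bl.unlock; transitivity ((v^T *m S *m u)^T 0 0); last by rewrite mxE.
by rewrite !trmx_mul trmxK mulmxA.
Qed.
Lemma bl_ld S u v : bl S u v = ld u (S *m v). Proof. by rewrite bl.unlock ld.unlock mulmxA. Qed.
Lemma ldDl l u v : ld (l + u) v = ld l v + ld u v.
Proof. by rewrite ld.unlock linearD /= mulmxDl mxE. Qed.
Lemma ldDr l u v : ld l (u + v) = ld l u + ld l v.
Proof. by rewrite ld.unlock mulmxDr mxE. Qed.
Lemma ldZl l c u : ld (c *: l) u = c * ld l u.
Proof. by rewrite ld.unlock linearZ /= -scalemxAl mxE. Qed.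
Lemma ldZr l c u : ld l (c *: u) = c * ld l u.
Proof. by rewrite ld.unlock -scalemxAr mxE. Qed.
Lemma ldNl l u : ld (- l) u = - ld l u.
Proof. by rewrite -scaleN1r ldZl mulN1r. Qed.
Lemma ldC l u : ld l u = ld u l.
Proof. by rewrite !ldE; apply: eq_bigr => i _; rewrite mulrC. Qed.
Lemma ld0r l : ld l 0 = 0. Proof. by rewrite ld.unlock mulmx0 mxE. Qed.
Lemma ld0l l : ld 0 l = 0. Proof. by rewrite ldC ld0r. Qed.
Lemma ld_nondeg u : (forall v, ld u v = 0) -> u = 0.
Proof.
move=> H; apply/matrixP => i j; rewrite ord1 mxE.
have := H (delta_mx i 0); rewrite ldE (bigD1 i)//= big1 => [|k ki].
  by rewrite mxE !eqxx mulr1 addr0.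
by rewrite mxE (negbTE ki) mulr0.
Qed.
End Fixed.

Definition cvmeas d (T : measurableType d) m (u : T -> 'cV[C]_m) := forall i, cmeas (fun t => u t i 0).

Lemma cmeas_bl d (T : measurableType d) m (S : 'M[C]_m) (u v : T -> 'cV[C]_m) :
  cvmeas u -> cvmeas v -> cmeas (fun t => bl S (u t) (v t)).
Proof.
move=> mu mv; under eq_fun do rewrite blE.
apply: cmeas_sum => i; apply: cmeas_sum => j; do 2 apply: cmeasM => //.
Qed.

Lemma cmeas_ld d (T : measurableType d) m (l u : T -> 'cV[C]_m) :
  cvmeas l -> cvmeas u -> cmeas (fun t => ld (l t) (u t)).
Proof.
by move=> ml mu; under eq_fun do rewrite ldE; apply: cmeas_sum => i; exact: cmeasM.
Qed.

Lemma cvmeas_cst d (T : measurableType d) m (u : 'cV[C]_m) : cvmeas (fun _ : T => u).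
Proof. by move=> i; exact: cmeas_cst. Qed.

Lemma cvmeasD d (T : measurableType d) m (u v : T -> 'cV[C]_m) :
  cvmeas u -> cvmeas v -> cvmeas (fun t => u t + v t).
Proof. by move=> mu mv i; under eq_fun do rewrite mxE; exact: cmeasD. Qed.

Variable n : nat.

Implicit Types x y : cpt R n.

Lemma cvD x y : cv (vadd x y) = cv x + cv y.
Proof. by apply/matrixP => i j; rewrite !mxE. Qed.
Lemma vconjD x y : vconj (vadd x y) = vadd (vconj x) (vconj y).
Proof. by apply/funext => j; exact: conjcD. Qed.
Lemma emD x y : em (vadd x y) = em x + em y.
Proof. by rewrite em.unlock vconjD !cvD add_col_mx. Qed.
Lemma cvZ c x : cv (vscale c x) = c *: cv x.
Proof. by apply/matrixP => i j; rewrite !mxE. Qed.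
Lemma vconjZ c x : vconj (vscale c x) = vscale (conjc c) (vconj x).
Proof. by apply/funext => j; exact: conjcM. Qed.
Lemma emZ r x : em (vscale (cR r) x) = cR r *: em x.
Proof. by rewrite em.unlock vconjZ !cvZ conj_cR scale_col_mx. Qed.
Lemma cv0 : cv (@vzero R n) = 0.
Proof. by apply/matrixP => i j; rewrite !mxE. Qed.
Lemma vconj0 : vconj (@vzero R n) = @vzero R n.
Proof. by apply/funext => j; exact: conjc0. Qed.
Lemma em0 : em (@vzero R n) = 0.
Proof. by rewrite em.unlock vconj0 cv0 col_mx0. Qed.
Lemma vconjK x : vconj (vconj x) = x.
Proof. by apply/funext => j; exact: conjcK. Qed.

Lemma emL x j : em x (lshift n j) 0 = x j. Proof. by rewrite em.unlock col_mxEu mxE. Qed.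
Lemma emR x j : em x (rshift n j) 0 = conjc (x j).
Proof. by rewrite em.unlock col_mxEd mxE. Qed.

Lemma cvmeas_cv d (T : measurableType d) (phi : T -> cpt R n) :
  (forall j, cmeas (fun t => phi t j)) -> cvmeas (fun t => cv (phi t)).
Proof. by move=> H i; under eq_fun do rewrite mxE; exact: H. Qed.

Lemma cvmeas_em d (T : measurableType d) (phi : T -> cpt R n) :
  (forall j, cmeas (fun t => phi t j)) -> cvmeas (fun t => em (phi t)).
Proof.
move=> H i; rewrite em.unlock; have [k ->|k ->] := split_ordP i.
  by under eq_fun do rewrite col_mxEu mxE; exact: H.
by under eq_fun do rewrite col_mxEd mxE; apply: cmeas_conj; exact: H.
Qed.

Section ContinuousComplex.
Variable X : topologicalType.
Implicit Types f g : X -> C.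
Definition ccts f := continuous (fun x : X => cre (f x)) /\ continuous (fun x : X => cim (f x)).
Lemma ccts_cst c : ccts (fun _ : X => c). Proof. by split => x; exact: cvg_cst. Qed.
Lemma cctsD f g : ccts f -> ccts g -> ccts (fun x : X => f x + g x).
Proof.
move=> [f1 f2] [g1 g2]; split => x.
  by under eq_fun do rewrite cre_add; apply: cvgD; [exact: f1|exact: g1].
by under eq_fun do rewrite cim_add; apply: cvgD; [exact: f2|exact: g2].
Qed.
Lemma cctsM f g : ccts f -> ccts g -> ccts (fun x : X => f x * g x).
Proof.
move=> [f1 f2] [g1 g2]; split => x.
  under eq_fun do rewrite cre_mul.
  by apply: cvgB; apply: cvgM; [exact: f1|exact: g1|exact: f2|exact: g2].
under eq_fun do rewrite cim_mul.
by apply: cvgD; apply: cvgM; [exact: f1|exact: g2|exact: f2|exact: g1].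
Qed.
Lemma ccts_conj f : ccts f -> ccts (fun x : X => conjc (f x)).
Proof.
move=> [f1 f2]; split => x; first by under eq_fun do rewrite cre_conj; exact: f1.
by under eq_fun do rewrite cim_conj; apply: cvgN; exact: f2.
Qed.
Lemma ccts_sum I (s : seq I) (f : I -> X -> C) : (forall i, ccts (f i)) ->
  ccts (fun x : X => \sum_(i <- s) f i x).
Proof.
move=> cf; elim: s => [|i s IH].
  by under eq_fun do rewrite big_nil; exact: ccts_cst.
by under eq_fun do rewrite big_cons; exact: cctsD.
Qed.
End ContinuousComplex.

Lemma cre_bl_emZ S r x : cre (bl S (em (vscale (cR r) x)) (em (vscale (cR r) x))) =
  r ^+ 2 * cre (bl S (em x) (em x)).
Proof. by rewrite emZ blZl blZr !cre_cRM expr2 mulrA. Qed.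

Lemma vnorm2Z (c : C) (x : cpt R n) : vnorm2 (vscale c x) = cabs2 c * vnorm2 x.
Proof. by rewrite /vnorm2 mulr_sumr; apply: eq_bigr => j _; rewrite cabs2M. Qed.

Lemma vnorm2_ge0 (x : cpt R n) : 0 <= vnorm2 x.
Proof. by apply: sumr_ge0 => j _; exact: cabs2_ge0. Qed.

Lemma vnorm2_eq0 (x : cpt R n) : vnorm2 x = 0 -> x = @vzero R n.
Proof.
move=> /eqP; rewrite psumr_eq0 => [/allP H|j _]; last exact: cabs2_ge0.
apply/funext => j; have := H j (mem_index_enum _); rewrite -sqr_cabs sqrf_eq0.
by move=> /eqP/cabs_eq0.
Qed.

Lemma vnorm2_gt0 (x : cpt R n) : x <> @vzero R n -> 0 < vnorm2 x.
Proof.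
by move=> x0; rewrite lt0r vnorm2_ge0 andbT; apply/negP => /eqP/vnorm2_eq0.
Qed.

Definition negdef (S : 'M[C]_(n + n)) := forall x : cpt R n, x <> @vzero R n ->
  cre (bl S (em x) (em x)) < 0.

(** The form attains a negative maximum on the compact unit sphere; homogeneity carries the bound to
    all points. *)
Lemma coercive S : negdef S -> exists2 delta : R, 0 < delta &
  forall x, cre (bl S (em x) (em x)) <= - (delta * vnorm2 x).
Proof.
move=> Sneg.
(* If there is no nonzero point, that is for [n = 0], the sphere is empty and the extremum argument
   is void. *)
have [all0|/existsNP[x0 x0N]] := pselect (forall x : cpt R n, x = @vzero R n).
  exists 1 => // x; rewrite (all0 x) em0 bl0l /vnorm2 big1 ?mulr0 ?oppr0// => j _.
  by rewrite /cabs2 /= expr0n addr0.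
pose toY (r : 'rV[R]_(n + n)) : cpt R n :=
  fun j => Complex (r 0 (lshift n j)) (r 0 (rshift n j)).
pose toR (x : cpt R n) : 'rV[R]_(n + n) := row_mx (\row_j cre (x j)) (\row_j cim (x j)).
have toRK x : toY (toR x) = x.
  by apply/funext => j; rewrite /toY /toR row_mxEl row_mxEr !mxE complex_eta.
have cY j : ccts (fun r => toY r j).
  by split => /= r; exact: coord_continuous.
pose f r := - cre (bl S (em (toY r)) (em (toY r))).
have cem i : ccts (fun r => em (toY r) i 0).
  rewrite em.unlock; have [k ->|k ->] := split_ordP i.
    by under eq_fun do rewrite col_mxEu mxE; exact: cY.
  by under eq_fun do rewrite col_mxEd mxE; apply: ccts_conj; exact: cY.
have cf : continuous f.
  have [cb _] : ccts (fun r => bl S (em (toY r)) (em (toY r))).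
    under eq_fun do rewrite blE.
    apply: ccts_sum => i; apply: ccts_sum => j; apply: cctsM => //; apply: cctsM => //.
    exact: ccts_cst.
  move=> r; exact: (cvgN (cb r)).
have cn : continuous (fun r => vnorm2 (toY r)).
  have [cc _] : ccts (fun r => \sum_j toY r j * conjc (toY r j)).
    by apply: ccts_sum => j; apply: cctsM => //; exact: ccts_conj.
  rewrite (_ : (fun r => _) = (fun r => cre (\sum_j toY r j * conjc (toY r j))))//.
  by apply/funext => r; rewrite cre_sum; apply: eq_bigr => j _; rewrite mul_conj.
pose A := [set r : 'rV[R]_(n + n) | vnorm2 (toY r) = 1].
have normalize x : x <> @vzero R n ->
    vnorm2 (vscale (cR (Num.sqrt (vnorm2 x))^-1) x) = 1.
  move=> xN; have xp := vnorm2_gt0 xN.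
  rewrite vnorm2Z -sqr_cabs cabs_cR real_normK ?num_real// exprVn sqr_sqrtr ?ltW// mulVf//.
  exact: lt0r_neq0.
have A0 : A !=set0.
  by exists (toR (vscale (cR (Num.sqrt (vnorm2 x0))^-1) x0)); rewrite /A /= toRK normalize.
have cA : compact A.
  have Mc : compact [set v : 'rV[R]_(n + n) | forall i, v ord0 i \in `[-1, 1]].
    have := @rV_compact R (n + n) (fun=> `[(-1 : R), 1]%classic) (fun _ => @segment_compact R (-1) 1).
    by [].
  apply: subclosed_compact Mc _.
    have -> : A = (fun r => vnorm2 (toY r)) @^-1` [set 1] by [].
    by apply: closed_comp => [r _|]; [exact: cn|exact: closed_eq].
  move=> r /= rA i; rewrite in_itv /= -ler_norml -(@ler_sqr R) ?nnegrE// expr1n.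
  rewrite real_normK ?num_real// -rA /vnorm2.
  have [k ->|k ->] := split_ordP i; rewrite (bigD1 k)//= /cabs2 /= -?addrA ?lerDl.
    by rewrite addr_ge0 ?sqr_ge0// sumr_ge0// => j _; rewrite addr_ge0 ?sqr_ge0.
  rewrite addrCA lerDl.
  by rewrite addr_ge0 ?sqr_ge0// sumr_ge0// => j _; rewrite addr_ge0 ?sqr_ge0.
have [r rA fmin] := EVT_min_rV A0 cA (continuous_subspaceT cf).
have rN : toY r <> @vzero R n.
  move=> r0; move/set_mem: rA; rewrite /A /= r0 /vnorm2 big1 => [/eqP|j _].
    by rewrite eq_sym oner_eq0.
  by rewrite /cabs2 /= expr0n addr0.
exists (f r); first by rewrite /f oppr_gt0; exact: Sneg.
move=> x; have [->|xN] := pselect (x = @vzero R n).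
  rewrite em0 bl0l /vnorm2 big1 ?mulr0 ?oppr0// => j _.
  by rewrite /cabs2 /= expr0n addr0.
have xp := vnorm2_gt0 xN; have xp0 := ltW xp.
have := fmin (toR (vscale (cR (Num.sqrt (vnorm2 x))^-1) x)).
rewrite inE /A /= toRK normalize// => /(_ erefl).
rewrite /f toRK cre_bl_emZ exprVn sqr_sqrtr// -mulrN ler_pdivlMl// => H.
by rewrite lerNr mulrC.
Qed.

End BilinearForms.

(** Increments of order [h^2] give a zero derivative at each point. Since [K] may depend on [t],
    local estimates suffice when this is applied along an imaginary direction. *)
Lemma quadratic_increment_cst (R : realType) (f : R -> R) :
  (forall t, exists K, forall h, `|h| <= 1 -> `|f (t + h) - f t| <= K * h ^+ 2) ->
  forall x y, f x = f y.
Proof.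
move=> H x y; apply: is_derive_0_is_cst => t.
have [K HK] := H t.
have K0 : 0 <= K.
  by have := HK 1; rewrite normr1 lexx expr1n mulr1 => /(_ isT); apply: le_trans.
have cv : (h^-1 *: ((f \o shift t) (h *: (1 : R^o)) - f t)) @[h --> 0^'] --> (0 : R).
  apply/cvgrPdist_le => e e0.
  near=> h.
  have h0 : h != 0 by near: h; exact: nbhs_dnbhs_neq.
  have h1 : `|h| <= Num.min 1 (e / (K + 1)).
    near: h; apply: dnbhs0_le; rewrite lt_min ltr01/=.
    by rewrite divr_gt0// ltr_wpDl.
  move: h1; rewrite le_min => /andP[h1 h2].
  rewrite sub0r normrN /= /GRing.scale /= mulr1 [h + t]addrC normrM normfV.
  rewrite ler_pdivrMl ?normr_gt0//; apply: (le_trans (HK h h1)).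
  rewrite -(@real_normK _ h) ?num_real// expr2 mulrCA ler_wpM2l//.
  apply: (@le_trans _ _ (K * (e / (K + 1)))); first by rewrite ler_wpM2l.
  rewrite mulrCA ger_pMr// ler_pdivrMr ?mul1r; first by rewrite lerDl.
  by rewrite ltr_wpDl.
apply: DeriveDef; first by apply/cvg_ex; exists 0.
exact: cvg_lim cv.
Unshelve. all: by end_near. Qed.

(** * Invariance of Gaussian integrals under complex shifts *)

Section GaussianShift.
Variables (R : realType) (n : nat).
Local Notation C := (R[i]).
Local Notation mcpt := (@mcpt R n).
Local Notation mu := (@cptmu R n).
Implicit Types (S : 'M[C]_(n + n)) (l W : 'cV[C]_(n + n)) (k : C).

Definition n1 (y : cpt R n) : R := \sum_j cabs (y j).

Lemma n1_ge0 y : 0 <= n1 y.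
Proof. by apply: sumr_ge0 => j _; exact: cabs_ge0. Qed.

Lemma measurable_n1 : measurable_fun setT (n1 : mcpt -> R).
Proof. by apply: measurable_sum => j; apply: measurable_cabs; exact: cmeas_coord. Qed.

Lemma cvmeas_em_id : cvmeas (fun y : mcpt => em y).
Proof. by apply: cvmeas_em => j; exact: cmeas_coord. Qed.

Lemma gauss_dom S A M : negdef S -> 0 <= M ->
  (\int[mu]_y (expR (cre (bl S (em y) (em y)) + A + M * n1 y))%:E < +oo)%E.
Proof.
move=> /coercive[delta d0 Sd] M0.
(* In each coordinate [M t <= M^2 / (2 delta) + delta t^2 / 2]: half of the coercivity absorbs the
   linear term. *)
pose B := A + \sum_(j < n) M ^+ 2 / (2 * delta).
have [c c0 cE] := @gauss_mass R n (delta / 2) (divr_gt0 d0 (ltr0Sn _ _)).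
have mg (t : R) : measurable_fun setT (fun y : mcpt => expR (- (t * vnorm2 y))).
  apply: measurableT_comp => //; apply: measurableT_comp => //.
  by apply: measurable_funM => //; exact: measurable_vnorm2.
apply: (@le_lt_trans _ _ (\int[mu]_y ((expR B)%:E * (expR (- (delta / 2 * vnorm2 y)))%:E))%E).
  apply: ge0_le_integral => //.
  - apply/measurable_EFinP; apply: measurableT_comp => //.
    apply: measurable_funD; last by apply: measurable_funM => //; exact: measurable_n1.
    apply: measurable_funD => //.
    by have [] := cmeas_bl S cvmeas_em_id cvmeas_em_id.
  - by apply: measurable_funeM; apply/measurable_EFinP; exact: mg.
  move=> y _; rewrite -EFinM lee_fin -expRD ler_expR /B.
  apply: (@le_trans _ _ (- (delta * vnorm2 y) + A + M * n1 y)).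
    by rewrite !lerD2r.
  suff : M * n1 y <= \sum_(j < n) M ^+ 2 / (2 * delta) + delta / 2 * vnorm2 y by lra.
  rewrite /n1 /vnorm2 !mulr_sumr -big_split /=; apply: ler_sum => j _.
  rewrite -sqr_cabs -subr_ge0.
  have -> : M ^+ 2 / (2 * delta) + delta / 2 * cabs (y j) ^+ 2 - M * cabs (y j) =
     (M - delta * cabs (y j)) ^+ 2 / (2 * delta) by field; exact: lt0r_neq0.
  by rewrite divr_ge0 ?sqr_ge0// mulr_ge0 ?ltW.
rewrite ge0_integralZl// ?cE ?ltey//.
by apply/measurable_EFinP; exact: mg.
Qed.

Lemma gauss_cinteg S A M (f : mcpt -> C) : negdef S -> 0 <= M -> cmeas f ->
  (forall y, cabs (f y) <= expR (cre (bl S (em y) (em y)) + A + M * n1 y)) -> cinteg mu f.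
Proof.
move=> Sneg M0 mf fb; apply: (le_cinteg mf _ fb); last exact: gauss_dom.
apply: measurableT_comp => //.
apply: measurable_funD; last by apply: measurable_funM => //; exact: measurable_n1.
apply: measurable_funD => //.
by have [] := cmeas_bl S cvmeas_em_id cvmeas_em_id.
Qed.

Lemma cabs_em_le y i : cabs (em y i 0) <= n1 y.
Proof.
rewrite /n1; have [j ->|j ->] := split_ordP i; rewrite ?emL ?emR.
  by rewrite (bigD1 j)//= lerDl sumr_ge0// => k _; exact: cabs_ge0.
by rewrite cabs_conj (bigD1 j)//= lerDl sumr_ge0// => k _; exact: cabs_ge0.
Qed.

Lemma ld_em_bound l : exists2 M, 0 <= M & forall y, cabs (ld l (em y)) <= M * n1 y.
Proof.
exists (\sum_i cabs (l i 0)); first by apply: sumr_ge0 => i _; exact: cabs_ge0.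
move=> y; rewrite ldE mulr_suml; apply: (le_trans (cabs_bigsum _ _ _)).
by apply: ler_sum => i _; rewrite cabsM ler_wpM2l ?cabs_ge0// cabs_em_le.
Qed.

Definition qp S l k (u : 'cV[C]_(n + n)) : C := bl S u u + ld l u + k.

(** A translation changes the linear and constant coefficients and leaves [S] alone, so that
    statements made for all [l] and [k] can be moved from one base point to another. *)
Lemma qpD S l k u W : qp S l k (u + W) = qp S (l + (S + S^T) *m W) (qp S l k W) u.
Proof.
rewrite /qp !blDl !blDr !ldDr ldDl mulmxDl ldDl ![ld (_ *m _) _]ldC -!bl_ld bl_tr; ring.
Qed.

Lemma qp_bound S l k : exists2 M, 0 <= M &
  forall y, cre (qp S l k (em y)) <= cre (bl S (em y) (em y)) + cabs k + M * n1 y.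
Proof.
have [M M0 HM] := ld_em_bound l; exists M => // y.
rewrite /qp !cre_add; have := HM y; have := ler_norm (cre k); have := cre_le_cabs k.
have := ler_norm (cre (ld l (em y))); have := cre_le_cabs (ld l (em y)); lra.
Qed.

Lemma cmeas_qp_em S l k W : cmeas (fun y : mcpt => qp S l k (em y + W)).
Proof.
have mu1 : cvmeas (fun y : mcpt => em y + W).
  by apply: cvmeasD; [exact: cvmeas_em_id|exact: cvmeas_cst].
apply: cmeasD; last exact: cmeas_cst.
by apply: cmeasD; [exact: cmeas_bl|apply: cmeas_ld => //; exact: cvmeas_cst].
Qed.

Lemma gauss_qp_cinteg0 S l k : negdef S -> cinteg mu (fun y => cexp (qp S l k (em y))).
Proof.
move=> Sneg; have [M M0 HM] := qp_bound S l k.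
apply: (gauss_cinteg (S := S) (A := cabs k) (M := M)) => //.
  apply: cmeas_cexp; have := cmeas_qp_em S l k 0; apply: eq_cmeas => y; by rewrite addr0.
by move=> y; rewrite cabs_cexp ler_expR.
Qed.

Lemma gauss_qp_cinteg S l k W : negdef S -> cinteg mu (fun y => cexp (qp S l k (em y + W))).
Proof.
move=> Sneg; have := gauss_qp_cinteg0 (l + (S + S^T) *m W) (qp S l k W) Sneg.
by apply: eq_cinteg => y; rewrite qpD.
Qed.

(** The Gaussian integral over the translate by [W] of the real subspace formed by all [em y]. The
    aim is its independence of [W]. *)
Let F S l k W := Cint mu (fun y => cexp (qp S l k (em y + W))).

Let F_real S l k W w : F S l k (W + em w) = F S l k W.
Proof.
rewrite /F -[RHS](Cint_shift w).
  by apply: eq_Cint => y; rewrite emD [W + _]addrC addrA.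
by apply: cmeas_cexp; exact: cmeas_qp_em.
Qed.

Let F_base S l k W0 W : F S (l + (S + S^T) *m W0) (qp S l k W0) W = F S l k (W + W0).
Proof. by apply: eq_Cint => y; rewrite -qpD -addrA. Qed.

(* The first-order term in [h] is [i] times that of the real shift by [h w], under which [F] is
   constant. *)
Let F_imag_local S l k w : negdef S -> exists K, forall h : R, `|h| <= 1 ->
  cabs (F S l k ((cI R * cR h) *: em w) - F S l k 0) <= K * h ^+ 2.
Proof.
move=> Sneg; pose e := em w.
pose D (y : mcpt) := bl S (em y) e + bl S e (em y) + ld l e.
pose q2 := bl S e e.
pose E0 (y : mcpt) := cexp (qp S l k (em y)).
have expand (s : C) y : qp S l k (em y + s *: e) = qp S l k (em y) + (s * D y + s ^+ 2 * q2).
  by rewrite /qp /D /q2 !blDl !blDr !ldDr !blZl !blZr !ldZr; ring.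
have [M1 M10 HM1] := ld_em_bound ((S + S^T) *m e).
have Dle y : cabs (D y) + cabs q2 <= (cabs (ld l e) + cabs q2) + M1 * n1 y.
  have : cabs (D y) <= M1 * n1 y + cabs (ld l e).
    apply: (le_trans (cabsD _ _)); rewrite lerD2r.
    have -> : bl S (em y) e + bl S e (em y) = ld ((S + S^T) *m e) (em y).
      by rewrite mulmxDl ldDl ![ld (_ *m _) _]ldC -!bl_ld bl_tr.
    exact: HM1.
  lra.
have mD : cmeas D.
  apply: cmeasD; last exact: cmeas_cst.
  by apply: cmeasD; apply: cmeas_bl => //; (exact: cvmeas_em_id || exact: cvmeas_cst).
have mE0 : cmeas E0.
  apply: cmeas_cexp; have := cmeas_qp_em S l k 0; apply: eq_cmeas => y; by rewrite addr0.
have [M M0 HM] := qp_bound S l k.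
(* With [d = |D| + |q2|] the remainder is at most [4 d^2 e^d + |q2|] times [|s|^2 |E0|]. As
   [d^2 <= 2 e^d] and [|q2| <= e^{2d}], the constant is [8 + 1 = 9]. *)
pose g (y : mcpt) := 9 * expR (2 * (cabs (D y) + cabs q2)) * cabs (E0 y).
have g0 y : 0 <= g y by rewrite /g !mulr_ge0 ?expR_ge0 ?cabs_ge0.
have mg : measurable_fun setT g.
  apply: measurable_funM; last exact: measurable_cabs.
  apply: measurable_funM => //; apply: measurableT_comp => //; apply: measurable_funM => //.
  by apply: measurable_funD => //; exact: measurable_cabs.
pose A1 := cabs k + 2 * (cabs (ld l e) + cabs q2).
pose MM := M + 2 * M1.
have MM0 : 0 <= MM by rewrite addr_ge0// mulr_ge0.
have gle y : g y <= 9 * expR (cre (bl S (em y) (em y)) + A1 + MM * n1 y).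
  rewrite /g -mulrA ler_wpM2l// cabs_cexp -expRD ler_expR /A1 /MM.
  have := HM y; have := Dle y; lra.
have goo : (\int[mu]_y (g y)%:E < +oo)%E.
  apply: (@le_lt_trans _ _ (\int[mu]_y (9%:E *
      (expR (cre (bl S (em y) (em y)) + A1 + MM * n1 y))%:E))%E).
    apply: ge0_le_integral => //.
    - by move=> y _; rewrite lee_fin.
    - exact/measurable_EFinP.
    - apply: measurable_funeM; apply/measurable_EFinP; apply: measurableT_comp => //.
      apply: measurable_funD; last by apply: measurable_funM => //; exact: measurable_n1.
      apply: measurable_funD => //.
      by have [] := cmeas_bl S cvmeas_em_id cvmeas_em_id.
    - by move=> y _; rewrite -EFinM lee_fin.
  rewrite ge0_integralZl//.
  - by rewrite lte_mul_pinfty ?lee_fin// gauss_dom.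
  - apply/measurable_EFinP; apply: measurableT_comp => //.
    apply: measurable_funD; last by apply: measurable_funM => //; exact: measurable_n1.
    apply: measurable_funD => //.
    by have [] := cmeas_bl S cvmeas_em_id cvmeas_em_id.
pose r (s : C) (y : mcpt) := cexp (qp S l k (em y + s *: e)) - E0 y - s * (D y * E0 y).
have rle s y : cabs s <= 1 -> cabs (r s y) <= cabs s ^+ 2 * g y.
  move=> s1; set v := s * D y + s ^+ 2 * q2.
  have -> : r s y = E0 y * ((cexp v - 1 - v) + s ^+ 2 * q2).
    rewrite /r expand cexpD -/v -/(E0 y) /v; ring.
  set dd := cabs (D y) + cabs q2.
  have s0 := cabs_ge0 s; have dd0 : 0 <= dd by rewrite addr_ge0 ?cabs_ge0.
  have vle : cabs v <= cabs s * dd.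
    apply: (le_trans (cabsD _ _)); rewrite !cabsM mulrDr lerD2l ler_wpM2r ?cabs_ge0//.
    by rewrite -[leRHS]mulr1 ler_wpM2l.
  have vdd : cabs v <= dd by apply: (le_trans vle); rewrite -[leRHS]mul1r ler_wpM2r.
  rewrite cabsM /g -/dd mulrC [leRHS]mulrA ler_wpM2r ?cabs_ge0//.
  apply: (le_trans (cabsD _ _)).
  have h1 : cabs (cexp v - 1 - v) <= cabs s ^+ 2 * (4 * dd ^+ 2 * expR dd).
    apply: (le_trans (cabs_cexp_sub1z v)).
    have hv : cabs v ^+ 2 <= cabs s ^+ 2 * dd ^+ 2.
      by rewrite -exprMn ler_sqr// ?nnegrE ?cabs_ge0// mulr_ge0.
    rewrite -sqr_cabs (_ : _ * (_ * _) = 4 * (cabs s ^+ 2 * dd ^+ 2) * expR dd); last by ring.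
    apply: ler_pM; [|exact: expR_ge0| |by rewrite ler_expR].
      by rewrite mulr_ge0 ?sqr_ge0.
    exact: ler_wpM2l.
  have h2 : dd ^+ 2 <= 2 * expR dd.
    have := expR_ge1Dxn 1 dd0; rewrite (_ : 2`! = 2%N)//.
    by have := sqr_ge0 dd; lra.
  have e2 : expR (2 * dd) = expR dd * expR dd by rewrite -expRD; congr expR; ring.
  have e1 : 1 <= expR dd by rewrite -expR0 ler_expR.
  have h3 : cabs q2 <= expR dd * expR dd.
    have : cabs q2 <= dd by rewrite lerDr cabs_ge0.
    have := expR_ge1Dx dd; nra.
  have h4 : dd ^+ 2 * expR dd <= 2 * (expR dd * expR dd).
    by rewrite mulrA ler_wpM2r ?expR_ge0.
  rewrite cabsM (_ : cabs (s ^+ 2) = cabs s ^+ 2); last by rewrite !expr2 cabsM.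
  apply: (@le_trans _ _ (cabs s ^+ 2 * (4 * dd ^+ 2 * expR dd) + cabs s ^+ 2 * cabs q2)).
    by rewrite lerD2r.
  rewrite -mulrDr ler_wpM2l ?sqr_ge0// e2; lra.
have iE s : cinteg mu (fun y => cexp (qp S l k (em y + s *: e))) by exact: gauss_qp_cinteg.
have iE0 : cinteg mu E0 by exact: gauss_qp_cinteg0.
have iDE : cinteg mu (fun y => D y * E0 y).
  apply: (le_cinteg _ mg _ goo); first exact: cmeasM.
  move=> y; rewrite cabsM /g ler_wpM2r ?cabs_ge0//.
  have := expR_ge1Dx (2 * (cabs (D y) + cabs q2)); have := expR_ge0 (2 * (cabs (D y) + cabs q2)).
  have := cabs_ge0 (D y); have := cabs_ge0 q2; lra.
pose J := Cint mu (fun y => D y * E0 y).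
pose G := fine (\int[mu]_y (g y)%:E)%E.
have G0 : 0 <= G by rewrite fine_ge0// integral_ge0// => y _; rewrite lee_fin.
have est s : cabs s <= 1 -> cabs (F S l k (s *: e) - F S l k 0 - s * J) <= cabs s ^+ 2 * G.
  move=> s1.
  have -> : F S l k (s *: e) - F S l k 0 - s * J = Cint mu (r s).
    apply/esym; transitivity (Cint mu (fun y => cexp (qp S l k (em y + s *: e)) - E0 y) -
        Cint mu (fun y => s * (D y * E0 y))).
      exact: (CintB (cintegB (iE s) iE0) (cintegZ s iDE)).
    congr (_ - _); last exact: (CintZ s iDE).
    have F0E : F S l k 0 = Cint mu E0 by apply: eq_Cint => y; rewrite (addr0 (em y)).
    rewrite F0E.
    transitivity (Cint mu (fun y => cexp (qp S l k (em y + s *: e))) - Cint mu E0).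
      exact: (CintB (iE s) iE0).
    by [].
  rewrite -lee_fin; apply: (@le_trans _ _ (\int[mu]_y (cabs (r s y))%:E)%E).
    exact: (cabs_Cint_le (cintegB (cintegB (iE s) iE0) (cintegZ s iDE))).
  have fg : (\int[mu]_y (g y)%:E)%E \is a fin_num.
    by rewrite ge0_fin_numE// integral_ge0// => y _; rewrite lee_fin.
  rewrite EFinM /G fineK// -ge0_integralZl//.
  - apply: ge0_le_integral => //.
    + by move=> y _; rewrite lee_fin cabs_ge0.
    + apply/measurable_EFinP; apply: measurable_cabs.
      exact: (cintegB (cintegB (iE s) iE0) (cintegZ s iDE)).1.
    + by apply: measurable_funeM; exact/measurable_EFinP.
    + by move=> y _; rewrite -EFinM lee_fin; exact: rle.
  - exact/measurable_EFinP.
  - by move=> y _; rewrite lee_fin.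
  - by rewrite lee_fin sqr_ge0.
have J0 : J = 0.
  apply: cabs_eq0; apply/eqP; rewrite eq_le cabs_ge0 andbT.
  apply/ler_addgt0Pr => eps eps0; rewrite add0r.
  pose h := Num.min 1 (eps / (G + 1)).
  have h0 : 0 < h by rewrite lt_min ltr01 divr_gt0// ltr_wpDl.
  have h1 : h <= 1 by rewrite ge_min lexx.
  have h2 : h <= eps / (G + 1) by rewrite ge_min lexx orbT.
  have := est (cR h); rewrite cabs_cR (gtr0_norm h0) => /(_ h1).
  have -> : F S l k (cR h *: e) = F S l k 0.
    by rewrite -(F_real S l k 0 (vscale (cR h) w)) emZ add0r.
  rewrite subrr sub0r cabsN cabsM cabs_cR (gtr0_norm h0) expr2 -mulrA ler_pM2l// => H.
  apply: (le_trans H); apply: (@le_trans _ _ (eps / (G + 1) * G)); first by rewrite ler_wpM2r.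
  rewrite -mulrA ger_pMr// mulrC ler_pdivrMr ?mul1r ?lerDl//.
  by rewrite ltr_wpDl.
exists G => h h1.
have := est (cI R * cR h); rewrite J0 mulr0 subr0 cabsM cabs_cI mul1r cabs_cR => /(_ h1).
by rewrite (real_normK (num_real h)) [_ ^+ 2 * G]mulrC.
Qed.

Let F_imag S l k w : negdef S -> F S l k (cI R *: em w) = F S l k 0.
Proof.
move=> Sneg.
have loc t : exists K, forall h : R, `|h| <= 1 ->
    cabs (F S l k ((cI R * cR (t + h)) *: em w) - F S l k ((cI R * cR t) *: em w)) <= K * h ^+ 2.
  (* [F_base] recentres at [i t w] by changing [l] and [k], so the local estimate at 0 holds at
     every point of the line. *)
  have [K HK] := F_imag_local (l + (S + S^T) *m ((cI R * cR t) *: em w))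
    (qp S l k ((cI R * cR t) *: em w)) w Sneg.
  exists K => h h1; have := HK h h1; rewrite !F_base add0r -scalerDl -mulrDr -cRD.
  by rewrite [h + t]addrC.
have E : (cI R * cR 1) *: em w = cI R *: em w by rewrite cR1 mulr1.
have E0 : (cI R * cR 0) *: em w = 0 by rewrite cR0 mulr0 scale0r.
rewrite -E -E0; apply: complex_ext.
  apply: (quadratic_increment_cst (f := fun t => cre (F S l k ((cI R * cR t) *: em w)))) => t.
  have [K HK] := loc t; exists K => h h1; apply: le_trans (HK h h1).
  by rewrite -cre_sub cre_le_cabs.
apply: (quadratic_increment_cst (f := fun t => cim (F S l k ((cI R * cR t) *: em w)))) => t.
have [K HK] := loc t; exists K => h h1; apply: le_trans (HK h h1).
by rewrite -cim_sub cim_le_cabs.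
Qed.

(** [C^{2n}] is the complexification of the real subspace of the vectors [em x]: for [W = (p, q)]
    the real part comes from [(p + conj q) / 2] and the imaginary part from
    [(p - conj q) / (2i)]. *)
Lemma em_span W : exists a b : cpt R n, W = em a + cI R *: em b.
Proof.
pose p j := W (lshift n j) 0; pose q j := W (rshift n j) 0.
have two : (2 : C) != 0 by rewrite pnatr_eq0.
have half (w : C) : w = 2^-1 * (w + w).
  by rewrite -mulr2n -(mulr_natl w) mulKf.
have ci2 : cI R * cI R = -1 by apply: complex_ext; rewrite ?creE /=; ring.
have cic : conjc (cI R) = - cI R by apply: complex_ext; rewrite ?creE /= ?oppr0.
have c2 : conjc (2^-1 : C) = 2^-1 by rewrite -cR_nat -cR_inv ?conj_cR// pnatr_eq0.
exists (fun j => 2^-1 * (p j + conjc (q j))), (fun j => - cI R * 2^-1 * (p j - conjc (q j))).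
apply/matrixP => i j; rewrite ord1 mxE [X in _ + X]mxE.
have [s ->|s ->] := split_ordP i; rewrite ?emL ?emR.
  rewrite -/(p s) !mulrA mulrN ci2 opprK mul1r -mulrDr.
  by rewrite addrACA subrr addr0 -half.

rewrite -/(q s) !conjcM !conjcD !conjcN !conjcK cic c2 opprK !mulrA ci2 mulN1r.
rewrite mulNr -mulrBr opprB addrC addrA subrK.
exact: half.
Qed.

(** Of the two parts of [W] given by [em_span], the real one is a translation of the measure and the
    imaginary one is [F_imag]. This plays the part of a change of contour in [2n] variables. *)
Lemma gauss_shift S l k W : negdef S ->
  Cint mu (fun y => cexp (qp S l k (em y + W))) = Cint mu (fun y => cexp (qp S l k (em y))).
Proof.
move=> Sneg; have [a [b ->]] := em_span W.
rewrite [em a + _]addrC -[LHS]/(F S l k (cI R *: em b + em a)) F_real (F_imag _ _ _ Sneg).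
by apply: eq_Cint => y; rewrite (addr0 (em y)).
Qed.

End GaussianShift.

(** * Holomorphic functions and the mean value property *)

Section LittleO.
Variables (R : realType).
Local Notation C := (R[i]).

(** Remainders are measured against an arbitrary size [N], so that one calculus serves derivatives
    on [C] and on [C^n], and the passage between them in [hol_comp] and [hol_line]. *)
Definition lito (X : Type) (N : X -> R) (r : X -> C) := forall eps : R, 0 < eps ->
  exists2 delta : R, 0 < delta & forall h, N h < delta -> cabs (r h) <= eps * N h.
Definition bigo (X : Type) (N : X -> R) (r : X -> C) := exists M delta : R,
  [/\ 0 <= M, 0 < delta & forall h, N h < delta -> cabs (r h) <= M * N h].

Section Fixed.
Variables (X : Type) (N : X -> R).
Hypothesis N0 : forall h, 0 <= N h.
Implicit Types r s : X -> C.

Lemma eq_lito r s : r =1 s -> lito N r -> lito N s.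
Proof. by move=> /funext ->. Qed.

Lemma litoD r s : lito N r -> lito N s -> lito N (fun h => r h + s h).
Proof.
move=> hr hs e e0; have e2 : 0 < e / 2 by rewrite divr_gt0.
have [d1 d10 H1] := hr _ e2; have [d2 d20 H2] := hs _ e2.
exists (Num.min d1 d2); first by rewrite lt_min d10.
move=> h; rewrite lt_min => /andP[/H1 h1 /H2 h2].
apply: (le_trans (cabsD _ _)); lra.
Qed.

Lemma bigoD r s : bigo N r -> bigo N s -> bigo N (fun h => r h + s h).
Proof.
move=> [M [d1 [M0 d10 H1]]] [M' [d2 [M0' d20 H2]]].
exists (M + M'), (Num.min d1 d2); split; [exact: addr_ge0|by rewrite lt_min d10|].
move=> h; rewrite lt_min => /andP[/H1 h1 /H2 h2].
apply: (le_trans (cabsD _ _)); rewrite mulrDl; exact: lerD.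
Qed.

Lemma litoZ c r : lito N r -> lito N (fun h => c * r h).
Proof.
move=> hr e e0; have c0 := cabs_ge0 c.
have e2 : 0 < e / (cabs c + 1) by rewrite divr_gt0// ltr_wpDl.
have [d d0 H] := hr _ e2; exists d => // h /H {}H; rewrite cabsM.
apply: (le_trans (ler_wpM2l c0 H)); rewrite mulrA ler_wpM2r// mulrCA ger_pMr//.
by rewrite ler_pdivrMr ?mul1r ?lerDl// ltr_wpDl.
Qed.

Lemma lito_bigo r : lito N r -> bigo N r.
Proof. by move=> /(_ 1 ltr01)[d d0 H]; exists 1, d. Qed.

Lemma bigoM r s : bigo N r -> bigo N s -> lito N (fun h => r h * s h).
Proof.
move=> [M [d1 [M0 d10 H1]]] [M' [d2 [M0' d20 H2]]] e e0.
have k0 : 0 <= M * M' by exact: mulr_ge0.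
exists (Num.min (Num.min d1 d2) (e / (M * M' + 1))).
  by rewrite !lt_min d10 d20 divr_gt0// ltr_wpDl.
move=> h; rewrite !lt_min => /andP[/andP[/H1 h1 /H2 h2]].
rewrite ltr_pdivlMr ?ltr_wpDl// => h3.
rewrite cabsM; apply: (le_trans (ler_pM (cabs_ge0 _) (cabs_ge0 _) h1 h2)).
rewrite (_ : M * N h * (M' * N h) = (M * M' * N h) * N h); last by ring.
by rewrite ler_wpM2r//; have := N0 h; nra.
Qed.

Lemma lito_comp (Y : Type) (N' : Y -> R) (r : X -> C) (phi : Y -> X) (M delta : R) :
  (forall h, 0 <= N' h) -> 0 <= M -> 0 < delta -> lito N r ->
  (forall h, N' h < delta -> N (phi h) <= M * N' h) -> lito N' (fun h => r (phi h)).
Proof.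
move=> N'0 M0 d0 hr H e e0.
have e2 : 0 < e / (M + 1) by rewrite divr_gt0// ltr_wpDl.
have [d1 d10 H1] := hr _ e2.
exists (Num.min delta (d1 / (M + 1))); first by rewrite lt_min d0 divr_gt0// ltr_wpDl.
move=> h; rewrite lt_min => /andP[/H h1]; rewrite ltr_pdivlMr ?ltr_wpDl// => h2.
have h3 : N (phi h) < d1 by apply: (le_lt_trans h1); have := N'0 h; nra.
apply: (le_trans (H1 _ h3)); apply: (le_trans (ler_wpM2l (ltW e2) h1)).
rewrite mulrA ler_wpM2r// -mulrA mulrC ger_pMl//.
by rewrite mulrC ler_pdivrMr ?mul1r ?lerDl// ltr_wpDl.
Qed.

End Fixed.

Definition cdiff (f : C -> C) := forall z, exists c, lito (@cabs R) (fun h => f (z + h) - f z - c * h).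

Lemma cdiff_cexp : cdiff (@cexp R).
Proof.
move=> z; exists (cexp z).
have E h : cexp (z + h) - cexp z - cexp z * h = cexp z * (cexp h - 1 - h).
  by rewrite cexpD; ring.
apply: (eq_lito (fun h => esym (E h))); apply: litoZ; first exact: cabs_ge0.
move=> e e0; have K0 : 0 < 4 * expR (1 : R) by rewrite mulr_gt0 ?expR_gt0.
exists (Num.min 1 (e / (4 * expR 1))); first by rewrite lt_min ltr01 divr_gt0.
move=> h; rewrite lt_min => /andP[h1]; rewrite ltr_pdivlMr// => h2.
apply: (le_trans (cabs_cexp_sub1z h)); rewrite -sqr_cabs.
have h0 := cabs_ge0 h.
have ee : expR (cabs h) <= expR 1 by rewrite ler_expR ltW.
apply: (@le_trans _ _ (4 * cabs h ^+ 2 * expR 1)).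
  by rewrite ler_wpM2l// mulr_ge0 ?sqr_ge0.
rewrite (_ : 4 * cabs h ^+ 2 * expR 1 = (cabs h * (4 * expR 1)) * cabs h); last by ring.
by rewrite ler_wpM2r// ltW.
Qed.

Lemma cdiff_comp f g : cdiff f -> cdiff g -> cdiff (fun z => g (f z)).
Proof.
move=> df dg z; have [a ha] := df z; have [b hb] := dg (f z).
exists (b * a); set r := fun h => f (z + h) - f z - a * h in ha.
have E h : g (f (z + h)) - g (f z) - b * a * h =
    (g (f z + (a * h + r h)) - g (f z) - b * (a * h + r h)) + b * r h.
  by rewrite /r (_ : f z + _ = f (z + h)); ring.
apply: (eq_lito (fun h => esym (E h))); apply: litoD; last by apply: litoZ => // h; exact: cabs_ge0.
have [M [d [M0 d0 H]]] : bigo (@cabs R) (fun h => a * h + r h).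
  apply: bigoD.
    by exists (cabs a), 1; split; rewrite ?cabs_ge0// => h _; rewrite cabsM.
  exact: lito_bigo.
by apply: (lito_comp (N := @cabs R) _ M0 d0 hb H) => h; exact: cabs_ge0.
Qed.

Lemma cdiff_continuous f z : cdiff f -> forall e, 0 < e ->
  exists2 d, 0 < d & forall h, cabs h < d -> cabs (f (z + h) - f z) < e.
Proof.
move=> df e e0; have [c hc] := df z; have [d d0 H] := hc 1 ltr01.
have c0 := cabs_ge0 c.
exists (Num.min d (e / (cabs c + 2))); first by rewrite lt_min d0 divr_gt0// ltr_wpDl.
move=> h; rewrite lt_min => /andP[/H h1]; rewrite ltr_pdivlMr ?ltr_wpDl// => h2.
have h0 := cabs_ge0 h.
have -> : f (z + h) - f z = (f (z + h) - f z - c * h) + c * h by ring.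
by apply: (le_lt_trans (cabsD _ _)); rewrite cabsM; nra.
Qed.

Variable n : nat.
Implicit Types (f g : cpt R n -> C) (z h : cpt R n).

Lemma vnorm_ge0 h : 0 <= vnorm h. Proof. exact: sqrtr_ge0. Qed.
Lemma sqr_vnorm h : vnorm h ^+ 2 = vnorm2 h.
Proof. by rewrite sqr_sqrtr// vnorm2_ge0. Qed.
Lemma vnormZ c h : vnorm (vscale c h) = cabs c * vnorm h.
Proof. by rewrite /vnorm -/(vnorm2 _) vnorm2Z sqrtrM ?cabs2_ge0. Qed.
Lemma cabs_le_vnorm h j : cabs (h j) <= vnorm h.
Proof.
rewrite ler_sqrt; last exact: vnorm2_ge0.
by rewrite (bigD1 j)//= lerDl sumr_ge0// => k _; exact: cabs2_ge0.
Qed.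
Lemma vnorm_le_n1 h : vnorm h <= n1 h.
Proof.
rewrite -(@ler_sqr R) ?nnegrE ?vnorm_ge0 ?n1_ge0// sqr_vnorm expr2 /n1 mulr_suml.
apply: ler_sum => j _; rewrite -sqr_cabs expr2 ler_wpM2l ?cabs_ge0//.
by rewrite (bigD1 j)//= lerDl sumr_ge0// => k _; exact: cabs_ge0.
Qed.
Lemma bigo_linear (c : cpt R n) : bigo (@vnorm R n) (fun h => \sum_j c j * h j).
Proof.
exists (\sum_j cabs (c j)), 1; split => //; first by apply: sumr_ge0 => j _; exact: cabs_ge0.
move=> h _; apply: (le_trans (cabs_bigsum _ _ _)); rewrite mulr_suml.
by apply: ler_sum => j _; rewrite cabsM ler_wpM2l ?cabs_ge0 ?cabs_le_vnorm.
Qed.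

Lemma hol_cst c : holomorphic (fun _ : cpt R n => c).
Proof.
move=> z; exists (@vzero R n) => e e0; exists 1 => // h _.
rewrite big1 => [|j _]; last by rewrite mul0r.
by rewrite subrr subr0 cabs0 mulr_ge0 ?vnorm_ge0// ltW.
Qed.

Lemma hol_coord j : holomorphic (fun z : cpt R n => z j).
Proof.
move=> z; exists (@Defs.vbasis R n j) => e e0; exists 1 => // h _.
rewrite (bigD1 j)//= big1 => [|k kj]; last by rewrite /Defs.vbasis (negbTE kj) mul0r.
rewrite /Defs.vbasis eqxx /vadd mul1r addr0 [z j + _]addrC addrK subrr cabs0.
by rewrite mulr_ge0 ?vnorm_ge0// ltW.
Qed.

Lemma holD f g : holomorphic f -> holomorphic g -> holomorphic (fun z => f z + g z).
Proof.
move=> hf hg z; have [c hc] := hf z; have [c' hc'] := hg z.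
exists (fun j => c j + c' j).
have E h : f (vadd z h) + g (vadd z h) - (f z + g z) - \sum_j (c j + c' j) * h j =
  (f (vadd z h) - f z - \sum_j c j * h j) + (g (vadd z h) - g z - \sum_j c' j * h j).
  by under eq_bigr do rewrite mulrDl; rewrite big_split /=; ring.
by apply: (eq_lito (fun h => esym (E h))); apply: litoD.
Qed.

Lemma holM f g : holomorphic f -> holomorphic g -> holomorphic (fun z => f z * g z).
Proof.
move=> hf hg z; have [c hc] := hf z; have [c' hc'] := hg z.
exists (fun j => f z * c' j + g z * c j).
set L := fun h => \sum_j c j * h j; set L' := fun h => \sum_j c' j * h j.
pose r h := f (vadd z h) - f z - L h; pose r' h := g (vadd z h) - g z - L' h.
have {}hc : lito (@vnorm R n) r := hc; have {}hc' : lito (@vnorm R n) r' := hc'.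
have E h : f (vadd z h) * g (vadd z h) - f z * g z -
    \sum_j (f z * c' j + g z * c j) * h j =
  (f z * r' h + g z * r h) + (L h + r h) * (L' h + r' h).
  under eq_bigr do rewrite mulrDl -!mulrA; rewrite big_split /= -!mulr_sumr.
  rewrite /r /r' /L /L'; ring.
apply: (eq_lito (fun h => esym (E h))); apply: litoD.
  by apply: litoD; apply: litoZ => // h; exact: vnorm_ge0.
by apply: bigoM => [h||]; [exact: vnorm_ge0|apply: bigoD; [exact: bigo_linear|exact: lito_bigo]..].
Qed.

Lemma hol_sum I (s : seq I) (f : I -> cpt R n -> C) : (forall i, holomorphic (f i)) ->
  holomorphic (fun z => \sum_(i <- s) f i z).
Proof.
move=> hf; elim: s => [|i s IH].
  by under eq_fun do rewrite big_nil; exact: hol_cst.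
by under eq_fun do rewrite big_cons; exact: holD.
Qed.

Lemma hol_comp (g : C -> C) f : cdiff g -> holomorphic f -> holomorphic (fun z => g (f z)).
Proof.
move=> dg hf z; have [c hc] := hf z; have [b hb] := dg (f z).
exists (fun j => b * c j).
set L := fun h => \sum_j c j * h j; pose r h := f (vadd z h) - f z - L h.
have {}hc : lito (@vnorm R n) r := hc.
have E h : g (f (vadd z h)) - g (f z) - \sum_j b * c j * h j =
    (g (f z + (L h + r h)) - g (f z) - b * (L h + r h)) + b * r h.
  under eq_bigr do rewrite -mulrA; rewrite -mulr_sumr -/(L h).
  rewrite /r (_ : f z + _ = f (vadd z h)); last by rewrite /L; ring.
  by rewrite /L; ring.
apply: (eq_lito (fun h => esym (E h))); apply: litoD; last by apply: litoZ => // h; exact: vnorm_ge0.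
have [M [d [M0 d0 H]]] : bigo (@vnorm R n) (fun h => L h + r h).
  by apply: bigoD; [exact: bigo_linear|exact: lito_bigo].
by apply: (lito_comp (N := @cabs R) _ M0 d0 hb H) => h; exact: vnorm_ge0.
Qed.

Lemma hol_shift f (w : cpt R n) : holomorphic f -> holomorphic (fun z => f (vadd w z)).
Proof.
move=> hf z; have [c hc] := hf (vadd w z); exists c.
have E h : vadd (vadd w z) h = vadd w (vadd z h) by apply/funext => j; rewrite /vadd addrA.
by apply: eq_lito hc => h; rewrite E.
Qed.

Lemma hol_line f (w : cpt R n) : holomorphic f -> cdiff (fun t => f (vscale t w)).
Proof.
move=> hf t; have [c hc] := hf (vscale t w); exists (\sum_j c j * w j).
pose r h := f (vadd (vscale t w) h) - f (vscale t w) - \sum_j c j * h j.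
have {}hc : lito (@vnorm R n) r := hc.
have E (h : C) : f (vscale (t + h) w) - f (vscale t w) - (\sum_j c j * w j) * h = r (vscale h w).
  rewrite /r; congr (f _ - _ - _); first by apply/funext => j; rewrite /vscale mulrDl.
  by rewrite mulr_suml; apply: eq_bigr => j _; rewrite /vscale; ring.
apply: (@eq_lito C (@cabs R) (fun h : C => r (vscale h w))); first by move=> h; rewrite -E.
apply: (lito_comp (N := @vnorm R n) (M := vnorm w) (delta := 1) _ _ _ hc) => //.
- exact: cabs_ge0.
- exact: vnorm_ge0.
- by move=> h _; rewrite vnormZ mulrC.
Qed.

Lemma hol_continuous f z : holomorphic f -> forall e, 0 < e ->
  exists2 d, 0 < d & forall h, vnorm h < d -> cabs (f (vadd z h) - f z) < e.
Proof.
move=> hf e e0; have [c hc] := hf z; have [d d0 H] := hc 1 ltr01.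
have [M [d' [M0 d'0 H']]] := bigo_linear c.
exists (Num.min (Num.min d d') (e / (M + 2))).
  by rewrite !lt_min d0 d'0 divr_gt0// ltr_wpDl.
move=> h; rewrite !lt_min => /andP[/andP[/H h1 /H' h1']]; rewrite ltr_pdivlMr ?ltr_wpDl// => h2.
have h0 := vnorm_ge0 h.
have -> : f (vadd z h) - f z = (f (vadd z h) - f z - \sum_j c j * h j) + \sum_j c j * h j by ring.
by apply: (le_lt_trans (cabsD _ _)); nra.
Qed.

End LittleO.

(** * Goursat's theorem on rectangles and the mean over a circle *)

Section Goursat.
Variable R : realType.
Local Notation C := (R[i]).
Local Notation leb := (@lebesgue_measure R).
Implicit Types (g : R -> C) (a b c : R).

(** Excluding the left endpoint makes adjacent intervals disjoint, so [itg_chasles] is an identity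
    between integrands. *)
Definition itg g a b := Cint leb (fun t : measurableTypeR R => cR (\1_(`]a, b]%classic) t) * g t).

Lemma ccts_eps g : (forall t e, 0 < e -> exists2 d, 0 < d & forall t', `|t' - t| < d ->
    cabs (g t' - g t) < e) -> ccts g.
Proof.
move=> H; split => t; apply/cvgrPdist_lt => e e0; have [d d0 Hd] := H t e e0;
  near=> t'; (have h : `|t' - t| < d by rewrite distrC; near: t'; apply/nbhs_ballP; exists d);
  rewrite distrC; apply: le_lt_trans (Hd _ h).
  by rewrite -cre_sub; exact: cre_le_cabs.
by rewrite -cim_sub; exact: cim_le_cabs.
Unshelve. all: by end_near. Qed.

Lemma ccts_cmeas g : ccts g -> cmeas (g : measurableTypeR R -> C).
Proof. by move=> [g1 g2]; split; exact: continuous_measurable_fun. Qed.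

Lemma ccts_bounded g a b : ccts g -> exists2 K, 0 <= K & forall t, a <= t <= b -> cabs (g t) <= K.
Proof.
move=> [g1 g2]; have [ab|ba] := leP a b; last first.
  by exists 0 => // t /andP[at_ tb]; have := le_trans at_ tb; rewrite leNgt ba.
have c1 : continuous (fun t => `|cre (g t)|) by move=> t; apply: cvg_norm; exact: g1.
have c2 : continuous (fun t => `|cim (g t)|) by move=> t; apply: cvg_norm; exact: g2.
have [x1 _ m1] := EVT_max ab (continuous_subspaceT c1).
have [x2 _ m2] := EVT_max ab (continuous_subspaceT c2).
exists (`|cre (g x1)| + `|cim (g x2)|); first by rewrite addr_ge0.
move=> t tab; apply: (le_trans (cabs_le_sum _)).
by apply: lerD; [apply: m1|apply: m2]; rewrite in_itv.
Qed.

Lemma indic_itv_integral a b (K : R) : a <= b -> 0 <= K ->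
  (\int[leb]_t (\1_(`]a, b]%classic) t * K)%:E = (K * (b - a))%:E)%E.
Proof.
move=> ab K0; under eq_integral do rewrite EFinM muleC.
rewrite ge0_integralZl//; last by apply/measurable_EFinP; exact: measurable_indic.
rewrite integral_indic//= setIT lebesgue_measure_itv/= lte_fin EFinM.
case: ltP => // ba; have -> : a = b by apply/eqP; rewrite eq_le ab.
by rewrite subrr mule0.
Qed.

Let mitg g a b : ccts g -> cmeas (fun t : measurableTypeR R => cR (\1_(`]a, b]%classic) t) * g t).
Proof.
move=> cg; apply: cmeasM; last exact: ccts_cmeas.
by apply: cmeas_cR; exact: measurable_indic.
Qed.

Let itg_le g a b K t : (forall t, a < t <= b -> cabs (g t) <= K) ->
  cabs (cR (\1_(`]a, b]%classic) t) * g t) <= \1_(`]a, b]%classic) t * K.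
Proof.
move=> gK; rewrite cabsM cabs_cR indicE; case: (boolP (t \in _)) => [|_].
  by rewrite inE /= in_itv /= => tab; rewrite normr1 !mul1r; exact: gK.
by rewrite normr0 !mul0r.
Qed.

Lemma itg_cinteg g a b : a <= b -> ccts g ->
  cinteg leb (fun t : measurableTypeR R => cR (\1_(`]a, b]%classic) t) * g t).
Proof.
move=> ab cg; have [K K0 gK] := ccts_bounded a b cg.
apply: (@le_cinteg _ _ _ leb _ (fun t => \1_(`]a, b]%classic) t * K)).
- exact: mitg.
- by apply: measurable_funM => //; exact: measurable_indic.
- by move=> t; apply: itg_le => u /andP[au ub]; apply: gK; rewrite ltW.
- by rewrite indic_itv_integral// ltey.
Qed.

Lemma itg_bound g a b K : a <= b -> 0 <= K -> ccts g ->
  (forall t, a < t <= b -> cabs (g t) <= K) -> cabs (itg g a b) <= K * (b - a).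
Proof.
move=> ab K0 cg gK; rewrite -lee_fin -indic_itv_integral//.
apply: le_trans (cabs_Cint_le (itg_cinteg ab cg)) _.
apply: ge0_le_integral => //.
- by move=> t _; rewrite lee_fin cabs_ge0.
- by apply/measurable_EFinP; apply: measurable_cabs; exact: mitg.
- by apply/measurable_EFinP; apply: measurable_funM => //; exact: measurable_indic.
- by move=> t _; rewrite lee_fin; exact: itg_le.
Qed.

Lemma eq_itg g h a b : g =1 h -> itg g a b = itg h a b.
Proof. by move=> /funext ->. Qed.

Lemma itgD g h a b : a <= b -> ccts g -> ccts h ->
  itg (fun t => g t + h t) a b = itg g a b + itg h a b.
Proof.
move=> ab cg ch; rewrite /itg -(CintD (itg_cinteg ab cg) (itg_cinteg ab ch)).
by apply: eq_Cint => t; rewrite mulrDr.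
Qed.

Lemma itgZ k g a b : a <= b -> ccts g -> itg (fun t => k * g t) a b = k * itg g a b.
Proof.
move=> ab cg; rewrite /itg -(CintZ k (itg_cinteg ab cg)).
by apply: eq_Cint => t; rewrite mulrCA.
Qed.

Lemma itg_cst k a b : a <= b -> itg (fun _ => k) a b = cR (b - a) * k.
Proof.
move=> ab; have -> : itg (fun _ => k) a b = k * itg (fun _ => 1) a b.
  by rewrite -itgZ//; [apply: eq_itg => t; rewrite mulr1|exact: ccts_cst].
rewrite mulrC; congr (_ * _).
have E := indic_itv_integral ab ler01; rewrite mul1r in E.
have R1 : \int[leb]_t cre (cR (\1_(`]a, b]%classic) t) * (1 : C)) = b - a.
  transitivity (fine (\int[leb]_t (\1_(`]a, b]%classic) t * 1)%:E)); last by rewrite E.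
  by apply: eq_Rintegral => t _; rewrite cre_cRM.
have R2 : \int[leb]_t cim (cR (\1_(`]a, b]%classic) t) * (1 : C)) = 0.
  by rewrite /Rintegral integral0_eq// => t _; rewrite cim_cRM mulr0.
by rewrite /itg CintE R1 R2.
Qed.

Lemma itg_chasles g a c b : a <= c -> c <= b -> ccts g -> itg g a b = itg g a c + itg g c b.
Proof.
move=> ac cb cg; rewrite /itg -(CintD (itg_cinteg ac cg) (itg_cinteg cb cg)).
apply: eq_Cint => t; rewrite -mulrDl -cRD; congr (cR _ * _).
rewrite !indicE !mem_setE !in_itv /=.
have [ta|ta] := leP t a.
  by have := le_trans ta ac; rewrite (leNgt t c) => /negbTE tc; rewrite ?tc/= addr0.
have [tc|tc] := leP t c; first by rewrite (le_trans tc cb) /= addr0.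
by rewrite add0r.
Qed.

Lemma itg_near_cst g a b k e : a <= b -> 0 <= e -> ccts g ->
  (forall t, a < t <= b -> cabs (g t - k) <= e) -> cabs (itg g a b - cR (b - a) * k) <= e * (b - a).
Proof.
move=> ab e0 cg H.
have ck : ccts (fun _ : R => - k) by exact: ccts_cst.
have -> : itg g a b - cR (b - a) * k = itg (fun t => g t - k) a b.
  by rewrite itgD// itg_cst// mulrN.
by apply: itg_bound => //; exact: cctsD.
Qed.

Section Rectangles.
Variable V : C -> C.
Hypothesis dV : cdiff V.

Let ch c : ccts (fun s => V (Complex s c)).
Proof.
apply: ccts_eps => t e e0; have [d d0 Hd] := cdiff_continuous (Complex t c) dV e0.
exists d => // t' tt'; have := Hd (cR (t' - t)); rewrite cabs_cR => /(_ tt').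
by congr (cabs (V _ - _) < _); apply: complex_ext; rewrite ?creE /=; ring.
Qed.

Let cvv a : ccts (fun t => V (Complex a t)).
Proof.
apply: ccts_eps => t e e0; have [d d0 Hd] := cdiff_continuous (Complex a t) dV e0.
exists d => // t' tt'; have := Hd (cI R * cR (t' - t)); rewrite cabsM cabs_cI mul1r cabs_cR => /(_ tt').
by congr (cabs (V _ - _) < _); apply: complex_ext; rewrite ?creE /=; ring.
Qed.

Let cB g h : ccts g -> ccts h -> ccts (fun t => g t - h t).
Proof.
move=> cg chh; have := cctsD cg (cctsM (ccts_cst R (-1)) chh).
by congr ccts; apply/funext => t; rewrite mulN1r.
Qed.

(** The integral of [V(z) dz] counterclockwise around the rectangle [[a, b] x [c, d]], with opposite
    sides grouped. *)
Definition circulation a b c d := itg (fun s => V (Complex s c) - V (Complex s d)) a b +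
  cI R * itg (fun t => V (Complex b t) - V (Complex a t)) c d.

Let circ_splith a m b c d : a <= m -> m <= b -> c <= d ->
  circulation a b c d = circulation a m c d + circulation m b c d.
Proof.
move=> am mb cd; rewrite /circulation (itg_chasles am mb); last exact: cB.
have -> : itg (fun t => V (Complex b t) - V (Complex a t)) c d =
   itg (fun t => V (Complex m t) - V (Complex a t)) c d +
   itg (fun t => V (Complex b t) - V (Complex m t)) c d.
  rewrite -itgD//; [|exact: cB..].
  by apply: eq_itg => t; ring.
ring.
Qed.

Let circ_splitv a b c m d : a <= b -> c <= m -> m <= d ->
  circulation a b c d = circulation a b c m + circulation a b m d.
Proof.
move=> ab cm md; rewrite /circulation [itg _ c d](itg_chasles cm md); last exact: cB.
have -> : itg (fun s => V (Complex s c) - V (Complex s d)) a b =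
   itg (fun s => V (Complex s c) - V (Complex s m)) a b +
   itg (fun s => V (Complex s m) - V (Complex s d)) a b.
  rewrite -itgD//; [|exact: cB..].
  by apply: eq_itg => t; ring.
ring.
Qed.

Lemma exists_half_pow (e : R) : 0 < e -> exists k : nat, 2^-1 ^+ k < e.
Proof.
move=> e0; exists (Num.truncn e^-1).+1.
rewrite exprVn invf_plt ?posrE ?exprn_gt0//.
apply: (lt_trans (truncnS_gt _)).
by rewrite -natrX ltr_nat ltn_expl.
Qed.

(** Quartering: one of four quarters keeps at least a quarter of the circulation. The nested
    rectangles shrink to a point where complex differentiability makes the circulation negligible
    compared with the square of the size. *)
Lemma goursat a0 b0 c0 d0 : a0 < b0 -> c0 < d0 -> circulation a0 b0 c0 d0 = 0.
Proof.
move=> ab cd; apply: cabs_eq0; apply/eqP; apply: contraT => K0.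
(* An opaque copy: only the two splitting rules are used until the final estimate. *)
have [G GE] : exists G, G = circulation by exists circulation.
have splith a m b c d : a <= m -> m <= b -> c <= d -> G a b c d = G a m c d + G m b c d.
  by rewrite GE; exact: circ_splith.
have splitv a b c m d : a <= b -> c <= m -> m <= d -> G a b c d = G a b c m + G a b m d.
  by rewrite GE; exact: circ_splitv.
rewrite -GE in K0.
pose K := cabs (G a0 b0 c0 d0).
have {K0}Kpos : 0 < K by rewrite lt0r K0 cabs_ge0.
pose L := b0 - a0; pose M := d0 - c0.
have L0 : 0 < L by rewrite subr_gt0.
have M0 : 0 < M by rewrite subr_gt0.
pose h k : R := 2^-1 ^+ k.
have h0 k : 0 < h k by rewrite exprn_gt0// invr_gt0.
have hS k : h k = h k.+1 + h k.+1 by rewrite /h exprS; field.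
pose Bad k (p : R * R) := K * h k ^+ 2 <=
  cabs (G p.1 (p.1 + L * h k) p.2 (p.2 + M * h k)).
pose Sub k (p p' : R * R) := [/\ p.1 <= p'.1, p'.1 + L * h k.+1 <= p.1 + L * h k,
  p.2 <= p'.2 & p'.2 + M * h k.+1 <= p.2 + M * h k].
(* The bad property is a premise inside the existential, so that [choice] gives a total function; at
   a rectangle that is not bad any value will do. *)
have step (x : nat * (R * R)) : exists p', Bad x.1 x.2 -> Bad x.1.+1 p' /\ Sub x.1 x.2 p'.
  case: x => k [a c] /=.
  have [B|nB] := pselect (Bad k (a, c)); last by exists (a, c) => /nB.
  pose l := L * h k.+1; pose m := M * h k.+1.
  have l0 : 0 <= l by rewrite mulr_ge0// ltW.
  have m0 : 0 <= m by rewrite mulr_ge0// ltW.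
  have lE : a + L * h k = a + l + l by rewrite hS mulrDr addrA.
  have mE : c + M * h k = c + m + m by rewrite hS mulrDr addrA.
  have a1 : a <= a + l by rewrite lerDl.
  have a2 : a + l <= a + l + l by rewrite lerDl.
  have c1 : c <= c + m by rewrite lerDl.
  have c2 : c + m <= c + m + m by rewrite lerDl.
  have SubE p' : [/\ a <= p'.1, p'.1 + l <= a + l + l, c <= p'.2 & p'.2 + m <= c + m + m] ->
      Sub k (a, c) p' by rewrite /Sub /= lE mE.
  move: B; rewrite /Bad /= lE mE (splith _ _ _ _ _ a1 a2 (le_trans c1 c2)).
  rewrite (splitv _ _ _ _ _ a1 c1 c2) (splitv _ _ _ _ _ a2 c1 c2) => B.
  have hk : K * h k ^+ 2 = 4 * (K * h k.+1 ^+ 2) by rewrite hS; ring.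
  have [B1|B1] := leP (K * h k.+1 ^+ 2) (cabs (G a (a + l) c (c + m))).
    by exists (a, c) => _; split; [exact: B1|exact: SubE].
  have [B2|B2] := leP (K * h k.+1 ^+ 2) (cabs (G a (a + l) (c + m) (c + m + m))).
    by exists (a, c + m) => _; split; [exact: B2|exact: SubE].
  have [B3|B3] := leP (K * h k.+1 ^+ 2) (cabs (G (a + l) (a + l + l) c (c + m))).
    by exists (a + l, c) => _; split; [exact: B3|exact: SubE].
  have [B4|B4] := leP (K * h k.+1 ^+ 2) (cabs (G (a + l) (a + l + l) (c + m) (c + m + m))).
    by exists (a + l, c + m) => _; split; [exact: B4|exact: SubE].
  exfalso; move: B; rewrite hk leNgt => /negP; apply.
  apply: (le_lt_trans (cabsD _ _)); apply: (le_lt_trans (lerD (cabsD _ _) (cabsD _ _))).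
  clear -B1 B2 B3 B4; lra.
have [F HF] := choice step.
pose fix P k : R * R := if k is k'.+1 then F (k', P k') else (a0, c0).
have PB k : Bad k (P k).
  elim: k => [|k IH].
    by rewrite /Bad /= /h expr0 !mulr1 expr1n mulr1 /L /M ![_ + (_ - _)]addrC !subrK.
  by have [] := HF (k, P k) IH.
have PS k : Sub k (P k) (P k.+1) by have [] := HF (k, P k) (PB k).
have mono k j : [/\ (P k).1 <= (P (k + j)%N).1, (P (k + j)%N).1 + L * h (k + j)%N <= (P k).1 + L * h k,
    (P k).2 <= (P (k + j)%N).2 & (P (k + j)%N).2 + M * h (k + j)%N <= (P k).2 + M * h k].
  elim: j => [|j [i1 i2 i3 i4]]; first by rewrite addn0.
  rewrite addnS; have [s1 s2 s3 s4] := PS (k + j)%N.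
  by split; [exact: le_trans i1 s1|exact: le_trans s2 i2|exact: le_trans i3 s3|exact: le_trans s4 i4].
have ub1 k j : (P j).1 <= (P k).1 + L * h k.
  have [/subnKC <-|/ltnW/subnKC <-] := leqP k j.
    have [_ H _ _] := mono k (j - k)%N; apply: le_trans H; rewrite lerDl mulr_ge0// ltW//.
  have [H _ _ _] := mono j (k - j)%N; apply: (le_trans H); rewrite lerDl mulr_ge0// ltW//.
have ub2 k j : (P j).2 <= (P k).2 + M * h k.
  have [/subnKC <-|/ltnW/subnKC <-] := leqP k j.
    have [_ _ _ H] := mono k (j - k)%N; apply: le_trans H; rewrite lerDl mulr_ge0// ltW//.
  have [_ _ H _] := mono j (k - j)%N; apply: (le_trans H); rewrite lerDl mulr_ge0// ltW//.
pose p1 := sup (range (fun k => (P k).1)); pose p2 := sup (range (fun k => (P k).2)).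
have hp1 k : (P k).1 <= p1 <= (P k).1 + L * h k.
  apply/andP; split.
    apply: ub_le_sup; last by exists k.
    by exists ((P 0%N).1 + L * h 0%N) => _ [j _ <-]; exact: ub1.
  by apply: ge_sup; [by exists (P 0%N).1; exists 0%N|move=> _ [j _ <-]; exact: ub1].
have hp2 k : (P k).2 <= p2 <= (P k).2 + M * h k.
  apply/andP; split.
    apply: ub_le_sup; last by exists k.
    by exists ((P 0%N).2 + M * h 0%N) => _ [j _ <-]; exact: ub2.
  by apply: ge_sup; [by exists (P 0%N).2; exists 0%N|move=> _ [j _ <-]; exact: ub2].
pose p := Complex p1 p2.
have [cc Hcc] := dV p.
have LM0 : 0 < L + M by exact: addr_gt0.
(* The four sides produce a total error [2 e (L + M)^2 H^2], which this [e] makes equal to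
   [K H^2 / 2], half of the lower bound in [Bad]. *)
pose e := K / (4 * (L + M) ^+ 2).
have e0 : 0 < e by rewrite divr_gt0// mulr_gt0// exprn_gt0.
have [d dd0 Hd] := Hcc _ e0.
have [k hk] := exists_half_pow (divr_gt0 dd0 LM0).
move: hk; rewrite ltr_pdivlMr// -/(h k) => hk.
have := PB k; rewrite /Bad; have := hp1 k; have := hp2 k.
move: (P k) => [a c] /= /andP[c1 c2] /andP[a1 a2].
have hk0 := h0 k; set H := h k in hk hk0 c2 a2 *.
have LH : 0 < L * H by exact: mulr_gt0.
have MH : 0 < M * H by exact: mulr_gt0.
have near s t : a <= s <= a + L * H -> c <= t <= c + M * H ->
    cabs (V (Complex s t) - V p - cc * (Complex s t - p)) <= e * (H * (L + M)).
  move=> /andP[s1 s2] /andP[t1 t2].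
  have zle : cabs (Complex s t - p) <= H * (L + M).
    apply: (le_trans (cabs_le_sum _)); rewrite !creE /=.
    have : `|s - p1| <= L * H by rewrite ler_norml; apply/andP; split; lra.
    have : `|t - p2| <= M * H by rewrite ler_norml; apply/andP; split; lra.
    lra.
  have := Hd (Complex s t - p) (le_lt_trans zle hk).
  rewrite [p + _]addrC subrK => /le_trans; apply; by rewrite ler_wpM2l// ltW.
set E := e * (H * (L + M)) in near.
have E0 : 0 <= E by rewrite mulr_ge0 ?ltW// mulr_gt0.
have aL : a <= a + L * H by rewrite lerDl ltW.
have cM : c <= c + M * H by rewrite lerDl ltW.
have I1 := @itg_near_cst (fun s => V (Complex s c) - V (Complex s (c + M * H))) a (a + L * H)
  (cc * (cI R * cR (- (M * H)))) (E + E) aL (addr_ge0 E0 E0) (cB (ch _) (ch _)).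
have I2 := @itg_near_cst (fun t => V (Complex (a + L * H) t) - V (Complex a t)) c (c + M * H)
  (cc * cR (L * H)) (E + E) cM (addr_ge0 E0 E0) (cB (cvv _) (cvv _)).
have {}I1 : cabs (itg (fun s => V (Complex s c) - V (Complex s (c + M * H))) a (a + L * H) -
    cR (L * H) * (cc * (cI R * cR (- (M * H))))) <= (E + E) * (L * H).
  have LE : a + L * H - a = L * H by ring.
  rewrite LE in I1; apply: I1 => s /andP[s1 s2].
  have n1 := near s c; have n2 := near s (c + M * H).
  have -> : V (Complex s c) - V (Complex s (c + M * H)) - cc * (cI R * cR (- (M * H))) =
    (V (Complex s c) - V p - cc * (Complex s c - p)) -
    (V (Complex s (c + M * H)) - V p - cc * (Complex s (c + M * H) - p)).
    have -> : cI R * cR (- (M * H)) = Complex s c - Complex s (c + M * H).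
      by apply: complex_ext; rewrite ?creE /=; ring.
    ring.
  apply: (le_trans (cabsB _ _)); apply: lerD; [apply: n1|apply: n2]; rewrite ?(ltW s1) ?s2 ?lexx ?cM//.
have {}I2 : cabs (itg (fun t => V (Complex (a + L * H) t) - V (Complex a t)) c (c + M * H) -
    cR (M * H) * (cc * cR (L * H))) <= (E + E) * (M * H).
  have LE : c + M * H - c = M * H by ring.
  rewrite LE in I2; apply: I2 => t /andP[t1 t2].
  have n1 := near (a + L * H) t; have n2 := near a t.
  have -> : V (Complex (a + L * H) t) - V (Complex a t) - cc * cR (L * H) =
    (V (Complex (a + L * H) t) - V p - cc * (Complex (a + L * H) t - p)) -
    (V (Complex a t) - V p - cc * (Complex a t - p)).
    have -> : cR (L * H) = Complex (a + L * H) t - Complex a t.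
      by apply: complex_ext; rewrite ?creE /=; ring.
    ring.
  apply: (le_trans (cabsB _ _)); apply: lerD; [apply: n1|apply: n2]; rewrite ?(ltW t1) ?t2 ?lexx ?aL//.
rewrite GE /circulation.
(* The affine part of [V] at [p] has no circulation: its horizontal contribution is [- i cc L M H^2]
   and its vertical one the opposite. *)
set G1 := itg _ a _ in I1 *; set G2 := itg _ c _ in I2 *.
have -> : G1 + cI R * G2 = (G1 - cR (L * H) * (cc * (cI R * cR (- (M * H))))) +
   cI R * (G2 - cR (M * H) * (cc * cR (L * H))) by rewrite cRN; ring.
move=> KH; have := le_trans KH (cabsD _ _); rewrite cabsM cabs_cI mul1r.
have EE : (E + E) * (L * H) + (E + E) * (M * H) = K * H ^+ 2 / 2.
  by rewrite /E /e; field; exact: lt0r_neq0.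
have : 0 < K * H ^+ 2 by rewrite mulr_gt0// exprn_gt0.
lra.
Qed.

End Rectangles.

(** Composed with [cexp], the circle of radius [e^s] becomes a vertical segment of height [2 pi].
    The horizontal sides of a rectangle cancel by periodicity, so the mean does not depend on [s];
    as [s] tends to minus infinity it approaches [phi 0]. *)
Lemma circle_mean (phi : C -> C) : cdiff phi ->
  itg (fun t => phi (Complex (cos t) (sin t))) 0 (pi *+ 2) = cR (pi *+ 2) * phi 0.
Proof.
move=> dphi.
have pi2 : 0 < (pi *+ 2 : R) by rewrite mulrn_wgt0// pi_gt0.
pose V z := phi (cexp z).
have dV : cdiff V by exact: (cdiff_comp (@cdiff_cexp R) dphi).
have circ s : ccts (fun t => V (Complex s t)).
  apply: ccts_eps => t e e0; have [d d0 Hd] := cdiff_continuous (Complex s t) dV e0.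
  exists d => // t' tt'; have := Hd (cI R * cR (t' - t)); rewrite cabsM cabs_cI mul1r cabs_cR => /(_ tt').
  by congr (cabs (V _ - _) < _); apply: complex_ext; rewrite ?creE /=; ring.
have -> : itg (fun t => phi (Complex (cos t) (sin t))) 0 (pi *+ 2) = itg (fun t => V (Complex 0 t)) 0 (pi *+ 2).
  by apply: eq_itg => t; rewrite /V /cexp /= expR0 !mul1r.
have inv s : s < 0 -> itg (fun t => V (Complex 0 t)) 0 (pi *+ 2) = itg (fun t => V (Complex s t)) 0 (pi *+ 2).
  move=> s0; have := goursat dV s0 pi2; rewrite /circulation.
  have -> : itg (fun u => V (Complex u 0) - V (Complex u (pi *+ 2))) s 0 = 0.
    rewrite (eq_itg (h := fun _ => 0)); last first.
      by move=> u; rewrite /V /cexp /= cos2pi sin2pi cos0 sin0 subrr.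
    by rewrite itg_cst ?mulr0 ?ltW.
  rewrite add0r => E.
  have : itg (fun t => V (Complex 0 t) - V (Complex s t)) 0 (pi *+ 2) = 0.
    apply: cabs_eq0; rewrite -[LHS]mul1r -cabs_cI -cabsM E; exact: cabs0.
  have -> : itg (fun t => V (Complex 0 t) - V (Complex s t)) 0 (pi *+ 2) =
    itg (fun t => V (Complex 0 t)) 0 (pi *+ 2) - itg (fun t => V (Complex s t)) 0 (pi *+ 2).
    rewrite -[- itg _ _ _]mulN1r -itgZ ?ltW// -itgD ?ltW//.
      by apply: eq_itg => t; rewrite mulN1r.
    by apply: cctsM => //; exact: ccts_cst.
  by move/eqP; rewrite subr_eq0 => /eqP.
apply/eqP; rewrite -subr_eq0; apply/eqP; apply: cabs_eq0.
apply/eqP; rewrite eq_le cabs_ge0 andbT; apply/ler_addgt0Pr => e e0; rewrite add0r.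
have e'0 : 0 < e / (pi *+ 2) by rewrite divr_gt0.
have [d d0 Hd] := cdiff_continuous 0 dphi e'0.
have dV0 : 0 < d^-1 by rewrite invr_gt0.
(* [e^{1/d} >= 1 + 1/d > 1/d], so the radius [e^s] is below [d]. *)
pose s := - d^-1; have s0 : s < 0 by rewrite oppr_lt0.
have es : expR s < d.
  rewrite /s expRN invf_plt ?posrE ?expR_gt0//.
  by have := expR_ge1Dx d^-1; lra.
rewrite (inv _ s0).
have := @itg_near_cst (fun t => V (Complex s t)) 0 (pi *+ 2) (phi 0) (e / (pi *+ 2)) (ltW pi2) (ltW e'0) (circ s).
rewrite subr0 divfK ?gt_eqF//; apply => t _; apply: ltW.
have := Hd (cexp (Complex s t)); rewrite cabs_cexp /= add0r; exact.
Qed.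

End Goursat.

(** * Measurability of continuous functions and the mean value property *)

Section MeanValue.
Variables (R : realType) (n : nat).
Local Notation C := (R[i]).
Local Notation mcpt := (@mcpt R n).
Local Notation mu := (@cptmu R n).
Local Notation leb := (@lebesgue_measure R).

Let grid (k : nat) (p : {ffun 'I_n -> int * int}) : cpt R n :=
  fun j => Complex ((p j).1%:~R * 2^-1 ^+ k) ((p j).2%:~R * 2^-1 ^+ k).
Let cell (k : nat) (z : cpt R n) : {ffun 'I_n -> int * int} :=
  [ffun j => (Num.floor (cre (z j) * 2 ^+ k), Num.floor (cim (z j) * 2 ^+ k))].

Let cell_close k z : vnorm (vsub (grid k (cell k z)) z) <= 2^-1 ^+ k * (n%:R * 2).
Proof.
apply: (le_trans (vnorm_le_n1 _)); rewrite /n1.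
have fl (x : R) : `|(Num.floor (x * 2 ^+ k))%:~R * 2^-1 ^+ k - x| <= 2^-1 ^+ k.
  have k0 : 0 < (2 : R) ^+ k by rewrite exprn_gt0.
  rewrite -[X in _ - X](mulfK (lt0r_neq0 k0)) -exprVn -mulrBl normrM (ger0_norm (x := 2^-1 ^+ k)) ?exprn_ge0 ?invr_ge0//.
  rewrite ler_piMl ?exprn_ge0 ?invr_ge0//.
  have := floor_itv (x * 2 ^+ k); rewrite rmorphD /= => /andP[f1 f2].
  by rewrite ler_norml; apply/andP; split; lra.
apply: (@le_trans _ _ (\sum_(j < n) 2^-1 ^+ k * 2)); last first.
  rewrite sumr_const card_ord -[X in X <= _]mulr_natr -mulrA.
  by rewrite [2 * _]mulrC.
apply: ler_sum => j _; apply: (le_trans (cabs_le_sum _)).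
rewrite /vsub /grid ffunE !creE /= mulr_natr mulr2n; apply: lerD; exact: fl.
Qed.

Let measurable_cell k p : measurable [set z : mcpt | cell k z = p].
Proof.
have floor_meas (x : mcpt -> R) (m : int) : measurable_fun setT x ->
    measurable [set z : mcpt | Num.floor (x z * 2 ^+ k) = m].
  move=> mx; have mx' : measurable_fun setT (fun z => x z * 2 ^+ k) by exact: measurable_funM.
  have := mx' measurableT _ (@measurable_itv R `[m%:~R, (m + 1)%:~R[).
  rewrite setTI; congr measurable; apply/seteqP; split => z /=; rewrite in_itv /=.
    by move=> h; apply/floor_def.
  by move=> <-; exact: floor_itv.
have -> : [set z : mcpt | cell k z = p] = \bigcap_(j in [set: 'I_n])
    ([set z : mcpt | Num.floor (cre (z j) * 2 ^+ k) = (p j).1] `&`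
     [set z : mcpt | Num.floor (cim (z j) * 2 ^+ k) = (p j).2]).
  apply/seteqP; split => z /=.
    by move=> <- j _; rewrite /cell ffunE.
  move=> H; apply/ffunP => j; have [h1 h2] := H j Logic.I.
  by rewrite /cell ffunE h1 h2; case: (p j).
apply: fin_bigcap_measurable => // j _; apply: measurableI; apply: floor_meas.
  exact: measurable_cre_coord.
exact: measurable_cim_coord.
Qed.

Let measurable_discretised k (g : cpt R n -> R) :
  measurable_fun setT (fun z : mcpt => g (grid k (cell k z))).
Proof.
move=> _ B mB; rewrite setTI.
have -> : (fun z : mcpt => g (grid k (cell k z))) @^-1` B =
   \bigcup_(p in [set p | B (g (grid k p))]) [set z : mcpt | cell k z = p].
  apply/seteqP; split => z /=; first by move=> h; exists (cell k z).
  by move=> [p /= Bp ->].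
rewrite bigcup_mkcond; apply: countable_bigcupT_measurable; first exact: countableP.
by move=> p; case: ifP => // _; exact: measurable_cell.
Qed.

(** The sigma-algebra is generated by coordinates and not by open sets. A continuous function is the
    pointwise limit of its values at dyadic roundings of the point, and each rounded function is
    constant on countably many measurable cells. *)
Lemma continuous_cmeas (f : cpt R n -> C) : (forall z e, 0 < e -> exists2 d, 0 < d &
    forall h, vnorm h < d -> cabs (f (vadd z h) - f z) < e) -> cmeas (f : mcpt -> C).
Proof.
move=> cf.
have conv (z : mcpt) e : 0 < e -> \forall k \near \oo, cabs (f z - f (grid k (cell k z))) < e.
  move=> e0; have [d d0 Hd] := cf z e e0.
  have d'0 : 0 < d / (n%:R * 2 + 1) by rewrite divr_gt0// ltr_wpDl// mulr_ge0.
  have [k0 Hk0] := exists_half_pow d'0.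
  exists k0 => // k /= kk; rewrite cabs_subC.
  have -> : grid k (cell k z) = vadd z (vsub (grid k (cell k z)) z).
    by apply/funext => j; rewrite /vadd /vsub addrC subrK.
  apply: Hd; apply: (le_lt_trans (cell_close k z)).
  move: Hk0; rewrite ltr_pdivlMr ?ltr_wpDl ?mulr_ge0// => Hk0.
  apply: le_lt_trans Hk0; apply: ler_pM; rewrite ?exprn_ge0 ?invr_ge0 ?mulr_ge0 ?lerDl//.
  by apply: ler_wiXn2l => //; rewrite ?invr_ge0// invf_le1// ler1n.
split.
  apply: (measurable_fun_cvg (h := fun k (z : mcpt) => cre (f (grid k (cell k z))))).
    by move=> k; exact: (@measurable_discretised k (fun w => cre (f w))).
  move=> z _; apply/cvgrPdist_lt => e e0; have := conv z e e0; apply: filterS => k.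
  by apply: le_lt_trans; rewrite -cre_sub; exact: cre_le_cabs.
apply: (measurable_fun_cvg (h := fun k (z : mcpt) => cim (f (grid k (cell k z))))).
  by move=> k; exact: (@measurable_discretised k (fun w => cim (f w))).
move=> z _; apply/cvgrPdist_lt => e e0; have := conv z e e0; apply: filterS => k.
by apply: le_lt_trans; rewrite -cim_sub; exact: cim_le_cabs.
Qed.

Lemma hol_cmeas (f : cpt R n -> C) : holomorphic f -> cmeas (f : mcpt -> C).
Proof. by move=> hf; apply: continuous_cmeas => z e; exact: hol_continuous. Qed.

Let ue (t : R) : C := Complex (cos t) (sin t).

Let ue1 t : cabs2 (ue t) = 1. Proof. exact: cos2Dsin2. Qed.

Let ue_cmeas : cmeas (ue : measurableTypeR R -> C).
Proof.
split; first exact: (continuous_measurable_fun (@continuous_cos R)).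
exact: (continuous_measurable_fun (@continuous_sin R)).
Qed.

Let circle_ccts (phi : C -> C) : cdiff phi -> ccts (fun t => phi (ue t)).
Proof.
move=> dphi; have dV := cdiff_comp (@cdiff_cexp R) dphi.
have cE t : cexp (Complex 0 t) = ue t by rewrite /cexp /= expR0 !mul1r.
apply: ccts_eps => t e e0; have [d d0 Hd] := cdiff_continuous (Complex 0 t) dV e0.
exists d => // t' tt'; have := Hd (cI R * cR (t' - t)); rewrite cabsM cabs_cI mul1r cabs_cR => /(_ tt').
rewrite -!cE; congr (cabs (phi (cexp _) - _) < _); apply: complex_ext; rewrite ?creE /=; ring.
Qed.

Lemma measurable_vscale d (T : measurableType d) (u : T -> C) (phi : T -> mcpt) :
  cmeas u -> measurable_fun setT phi -> measurable_fun setT (fun t => vscale (u t) (phi t) : mcpt).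
Proof.
move=> mu_ mphi; have mj (j : 'I_n) := cmeasM mu_ (cmeas_comp mphi (cmeas_coord R j)).
by apply: measurable_to_mcpt => j; have [] := mj j.
Qed.

(* Averaging over the rotations [z -> e^{it} z] reduces this to the circle mean of one-variable slices. *)
Lemma mean_value (v : cpt R n -> C) (w : mcpt -> R) : holomorphic v ->
  measurable_fun setT w -> (forall u z, cabs2 u = 1 -> w (vscale u z) = w z) ->
  cinteg mu (fun z => v z * cR (w z)) -> cinteg mu (fun z => cR (w z)) ->
  Cint mu (fun z => v z * cR (w z)) = v (@vzero R n) * Cint mu (fun z => cR (w z)).
Proof.
move=> hv mw wrot vi wi; set A := Cint mu (fun z => v z * cR (w z)).
have pi2 : 0 < (pi *+ 2 : R) by rewrite mulrn_wgt0// pi_gt0.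
pose I : set R := `]0, pi *+ 2]%classic.
pose G (p : measurableTypeR R * mcpt) : C := cR (\1_I p.1) * (v (vscale (ue p.1) p.2) * cR (w p.2)).
have lebI : leb I = (pi *+ 2)%:E.
  by rewrite /I lebesgue_measure_itv /= lte_fin pi2 oppr0 adde0.
have mIs : measurable (I : set (measurableTypeR R)) by exact: measurable_itv.
have mI : measurable_fun setT (fun t : measurableTypeR R => \1_I t : R) by rewrite /I; exact: measurable_indic.
have [mf foo] := vi.
have mG : cmeas G.
  apply: cmeasM.
    have mI' : measurable_fun setT (fun p : measurableTypeR R * mcpt => \1_I p.1 : R).
      by apply: (measurableT_comp mI); exact: measurable_fst.
    exact: cmeas_cR.
  apply: cmeasM; last first.
    have mw' : measurable_fun setT (fun p : measurableTypeR R * mcpt => w p.2).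
      by apply: (measurableT_comp mw); exact: measurable_snd.
    exact: cmeas_cR.
  apply: (@cmeas_comp _ _ _ _ _ (fun p : measurableTypeR R * mcpt => vscale (ue p.1) p.2 : mcpt) v).
    by apply: measurable_vscale => //; exact: (cmeas_comp measurable_fst ue_cmeas).
  exact: hol_cmeas.
have wE t z : v (vscale (ue t) z) * cR (w z) = v (vscale (ue t) z) * cR (w (vscale (ue t) z)).
  by rewrite wrot.
have mabs : measurable_fun setT (fun z : mcpt => (cabs (v z * cR (w z)))%:E).
  by apply/measurable_EFinP; exact: measurable_cabs.
have mvs t : measurable_fun setT (fun z : mcpt => vscale (ue t) z : mcpt).
  by apply: measurable_vscale; [exact: cmeas_cst|exact: measurable_id].
have Gint t : (\int[mu]_z (cabs (G (t, z)))%:E = (\1_I t)%:E * \int[mu]_z (cabs (v z * cR (w z)))%:E)%E.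
  rewrite -(ge0_integral_rot (ue1 t) mabs); last by move=> z; rewrite lee_fin cabs_ge0.
  rewrite -ge0_integralZl//.
  - apply: eq_integral => z _; rewrite /G /= cabsM cabs_cR ger0_norm// EFinM.
    by rewrite wE.
  - exact: (measurableT_comp mabs (mvs t)).
  - by move=> z _; rewrite lee_fin cabs_ge0.
have Goo : (\int[leb]_t \int[mu]_z (cabs (G (t, z)))%:E < +oo)%E.
  under eq_integral do rewrite Gint.
  rewrite ge0_integralZr//.
  - rewrite integral_indic// setIT [X in (X * _)%E](_ : _ = (pi *+ 2)%:E); last exact: lebI.
    by rewrite lte_mul_pinfty// lee_fin ltW.
  - exact/measurable_EFinP.
  - by apply: integral_ge0 => z _; rewrite lee_fin cabs_ge0.
(* Integrating first over [z] gives [2 pi A] by rotation invariance; integrating first over [t]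
   gives the circle mean of a slice of [v]. *)
have := Cint_swap mG Goo.
have -> : Cint leb (fun t => Cint mu (fun z => G (t, z))) = cR (pi *+ 2) * A.
  rewrite -[X in cR X]subr0 -(itg_cst A (ltW pi2)) /itg; apply: eq_Cint => t.
  rewrite /G /= CintZ; last first.
    have := cinteg_preserving (fun j => plane_preserving_unit (ue1 t)) vi.
    by apply: eq_cinteg => z; rewrite wE.
  congr (_ * _); rewrite /A -(Cint_rot (ue1 t) mf).
  by apply: eq_Cint => z; rewrite wE.
have -> : Cint mu (fun z => Cint leb (fun t => G (t, z))) =
    cR (pi *+ 2) * (v (@vzero R n) * Cint mu (fun z => cR (w z))).
  rewrite mulrA -(CintZ _ wi); apply: eq_Cint => z.
  have dphi := hol_line z hv.
  have z0 : vscale 0 z = @vzero R n by apply/funext => j; rewrite /vscale mul0r.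
  have := circle_mean dphi; rewrite z0 => <-.
  rewrite mulrC -itgZ ?ltW//; last exact: (circle_ccts dphi).
  by apply: eq_Cint => t; rewrite /G /= -/(ue t) [v _ * _]mulrC.
have c0 : cR (pi *+ 2) != 0 :> C by apply/eqP => /cR_inj/eqP; rewrite gt_eqF.
by move/(mulfI c0).
Qed.

End MeanValue.

(** * The weight of a Hermitian form *)

HB.lock Definition Hs (R : realType) n (h : 'M[R[i]]_n) (x y : cpt R n) : R[i] :=
  bl h (cv x) (cv (vconj y)).

Section HermitianForm.
Variables (R : realType) (n : nat).
Local Notation C := (R[i]).
Local Notation mcpt := (@mcpt R n).
Local Notation mu := (@cptmu R n).
Variable h : 'M[C]_n.

Local Notation Hs := (Hs h).

Lemma HsE x y : Hs x y = bl h (cv x) (cv (vconj y)).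
Proof. by rewrite Hs.unlock. Qed.

Definition Hr (x : cpt R n) : R := cre (Hs x x).
(** [h] sits in the block pairing [x] with [conj x], so [bl SH] on [em y] is [H(y, y)]. The matrix
    is not symmetric, which is why [S + S^T] appears as the Hessian below. *)
Definition SH : 'M[C]_(n + n) := block_mx 0 h 0 0.

Lemma emE (x : cpt R n) : em x = col_mx (cv x) (cv (vconj x)).
Proof. by rewrite em.unlock. Qed.

Lemma bl_block (A B D E : 'M[C]_n) (a b c d : 'cV[C]_n) :
  bl (block_mx A B D E) (col_mx a b) (col_mx c d) = bl A a c + bl B a d + (bl D b c + bl E b d).
Proof.
rewrite !blE big_split_ord /=; congr (_ + _).
  rewrite -big_split /=; apply: eq_bigr => i _; rewrite big_split_ord /=; congr (_ + _);
  by apply: eq_bigr => j _; rewrite ?block_mxEul ?block_mxEur ?col_mxEu ?col_mxEd.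
rewrite -big_split /=; apply: eq_bigr => i _; rewrite big_split_ord /=; congr (_ + _);
by apply: eq_bigr => j _; rewrite ?block_mxEdl ?block_mxEdr ?col_mxEu ?col_mxEd.
Qed.

Lemma ld_col (a b c d : 'cV[C]_n) : ld (col_mx a b) (col_mx c d) = ld a c + ld b d.
Proof.
rewrite !ldE big_split_ord /=; congr (_ + _);
by apply: eq_bigr => j _; rewrite ?col_mxEu ?col_mxEd.
Qed.

Lemma bl0m m (u v : 'cV[C]_m) : bl (0 : 'M[C]_m) u v = 0.
Proof. by rewrite blE big1 => // i _; rewrite big1 => // j _; rewrite mxE mulr0 mul0r. Qed.

Lemma Hs_em y : Hs y y = bl SH (em y) (em y).
Proof. by rewrite HsE /SH emE bl_block !bl0m add0r !addr0. Qed.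

Lemma HsDl x y z : Hs (vadd x y) z = Hs x z + Hs y z.
Proof. by rewrite !HsE cvD blDl. Qed.
Lemma HsDr x y z : Hs x (vadd y z) = Hs x y + Hs x z.
Proof. by rewrite !HsE vconjD cvD blDr. Qed.
Lemma HsZl c x y : Hs (vscale c x) y = c * Hs x y.
Proof. by rewrite !HsE cvZ blZl. Qed.
Lemma HsZr c x y : Hs x (vscale c y) = conjc c * Hs x y.
Proof. by rewrite !HsE vconjZ cvZ blZr. Qed.
Lemma vsubE (x y : cpt R n) : vsub x y = vadd x (vscale (-1) y).
Proof. by apply/funext => j; rewrite /vsub /vadd /vscale mulN1r. Qed.
Lemma HsBl x y z : Hs (vsub x y) z = Hs x z - Hs y z.
Proof. by rewrite vsubE HsDl HsZl mulN1r. Qed.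
Lemma HsBr x y z : Hs x (vsub y z) = Hs x y - Hs x z.
Proof. by rewrite vsubE HsDr HsZr conjcN conjc1 mulN1r. Qed.
Lemma Hr_em y : Hr y = cre (bl SH (em y) (em y)).
Proof. by rewrite /Hr Hs_em. Qed.
Lemma HrZ c x : Hr (vscale c x) = cabs2 c * Hr x.
Proof. by rewrite /Hr HsZl HsZr mulrA mul_conj cre_cRM. Qed.

Lemma cmeas_Hs d (T : measurableType d) (phi psi : T -> cpt R n) :
  (forall j, cmeas (fun t => phi t j)) -> (forall j, cmeas (fun t => psi t j)) ->
  cmeas (fun t => Hs (phi t) (psi t)).
Proof.
move=> mphi mpsi; under eq_fun do rewrite HsE; apply: cmeas_bl; apply: cvmeas_cv => // j.
exact: cmeas_conj.
Qed.

Lemma measurable_Hr : measurable_fun setT (Hr : mcpt -> R).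
Proof. by have [] := cmeas_Hs (@cmeas_coord R n) (@cmeas_coord R n). Qed.

Lemma hol_Hsl w : holomorphic (fun z => Hs z w).
Proof.
under eq_fun do rewrite HsE blE.
apply: hol_sum => i; apply: hol_sum => j; apply: holM; last exact: hol_cst.
by apply: holM; [under eq_fun do rewrite mxE; exact: hol_coord|exact: hol_cst].
Qed.

Hypothesis hherm : forall j k, conjc (h j k) = h k j.
Hypothesis hpos : forall z, z <> @vzero R n -> 0 < Hr z.

Lemma Hs_conj x y : conjc (Hs x y) = Hs y x.
Proof.
rewrite !HsE !blE conjc_sum exchange_big /=; apply: eq_bigr => j _.
rewrite conjc_sum; apply: eq_bigr => i _.
by rewrite !conjcM hherm !mxE /vconj conjcK; ring.
Qed.

Lemma Hs_real z : Hs z z = cR (Hr z).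
Proof.
apply: complex_ext => //=; have := congr1 (@cim R) (Hs_conj z z); rewrite cim_conj; lra.
Qed.

Lemma cre_HsC x y : cre (Hs x y) = cre (Hs y x).
Proof. by rewrite -Hs_conj cre_conj. Qed.

Lemma HrD x y : Hr (vadd x y) = Hr x + Hr y + 2 * cre (Hs x y).
Proof. by rewrite /Hr HsDl !HsDr !cre_add (cre_HsC y x); ring. Qed.

Lemma HrB x y : Hr (vsub x y) = Hr x + Hr y - 2 * cre (Hs x y).
Proof. by rewrite /Hr HsBl !HsBr !cre_sub (cre_HsC y x); ring. Qed.

Lemma Hr0 : Hr (@vzero R n) = 0.
Proof. by rewrite Hr_em em0 bl0l. Qed.

Lemma Hr_ge0 z : 0 <= Hr z.
Proof. by have [->|/hpos/ltW//] := pselect (z = @vzero R n); rewrite Hr0. Qed.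

Lemma negdefH (t : R) : 0 < t -> negdef (cR (- t) *: SH).
Proof.
move=> t0 z z0; rewrite blZm cre_cRM -Hr_em mulNr oppr_lt0 mulr_gt0//.
exact: hpos.
Qed.

Lemma cexp_gaussH (t : R) z : cexp (cR (- t) * Hs z z) = cR (expR (- (t * Hr z))).
Proof. by rewrite Hs_real -cRM cexp_cR mulNr. Qed.

Lemma gaussH_cinteg (t : R) : 0 < t -> cinteg mu (fun z => cR (expR (- (t * Hr z)))).
Proof.
move=> t0; have := gauss_qp_cinteg0 0 0 (negdefH t0).
apply: eq_cinteg => z; rewrite /qp ld0l !addr0 blZm -Hs_em; exact: cexp_gaussH.
Qed.

(** Positivity matters, since these masses are later divided by; it follows from [H <= K |z|^2] by
    comparison with a standard Gaussian. *)
Lemma gaussH_mass (t : R) : 0 < t -> exists2 c : R, 0 < c &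
  (\int[mu]_z (expR (- (t * Hr z)))%:E = c%:E)%E.
Proof.
move=> t0; have [mg goo] := gaussH_cinteg t0.
have mexp : measurable_fun setT (fun z : mcpt => expR (- (t * Hr z))).
  by have [] := mg.
have gooE : (\int[mu]_z (expR (- (t * Hr z)))%:E < +oo)%E.
  move: goo; under eq_integral do rewrite cabs_cR ger0_norm ?expR_ge0//.
  by [].
pose K := \sum_i \sum_j cabs (h i j).
have HK z : Hr z <= K * vnorm2 z.
  apply: (le_trans (ler_norm _)); apply: (le_trans (cre_le_cabs _)).
  rewrite !HsE blE; apply: (le_trans (cabs_bigsum _ _ _)); rewrite mulr_suml.
  apply: ler_sum => i _; apply: (le_trans (cabs_bigsum _ _ _)); rewrite mulr_suml.
  apply: ler_sum => j _; rewrite !cabsM mulrAC mulrC ler_wpM2l ?cabs_ge0//.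
  rewrite -sqr_vnorm expr2 !mxE /vconj cabs_conj.
  by apply: ler_pM; rewrite ?cabs_ge0 ?cabs_le_vnorm.
have K0 : 0 <= K by apply: sumr_ge0 => i _; apply: sumr_ge0 => j _; exact: cabs_ge0.
(* The added 1 keeps the exponent positive when [K = 0]. *)
have tK : 0 < t * K + 1 by rewrite ltr_wpDl// mulr_ge0// ltW.
have [c c0 cE] := @gauss_mass R n _ tK.
have low : (c%:E <= \int[mu]_z (expR (- (t * Hr z)))%:E)%E.
  rewrite -cE; apply: ge0_le_integral => //.
  - apply/measurable_EFinP; apply: measurableT_comp => //; apply: measurableT_comp => //.
    by apply: measurable_funM => //; exact: measurable_vnorm2.
  - exact/measurable_EFinP.
  - move=> z _; rewrite lee_fin ler_expR lerN2.
    have := HK z; have := vnorm2_ge0 z; have := ltW t0; nra.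
have fin : (\int[mu]_z (expR (- (t * Hr z)))%:E)%E \is a fin_num.
  by rewrite ge0_fin_numE// integral_ge0.
exists (fine (\int[mu]_z (expR (- (t * Hr z)))%:E)); last by rewrite fineK.
by rewrite -lte_fin fineK//; apply: lt_le_trans low; rewrite lte_fin.
Qed.

Lemma Cint_gaussH (t c : R) : (\int[mu]_z (expR (- (t * Hr z)))%:E = c%:E)%E ->
  Cint mu (fun z => cR (expR (- (t * Hr z)))) = cR c.
Proof.
move=> E; rewrite CintE /Rintegral; congr Complex; first by rewrite E.
by rewrite integral0_eq.
Qed.

Definition L2H (u : cpt R n -> C) :=
  (\int[mu]_z (cabs2 (u z) * expR (- 2 * Hr z))%:E < +oo)%E.

Lemma measurable_L2H (u : mcpt -> C) : cmeas u ->
  measurable_fun setT (fun z : mcpt => cabs2 (u z) * expR (- 2 * Hr z)).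
Proof.
move=> mu_; apply: measurable_funM; first exact: measurable_cabs2.
by apply: measurableT_comp => //; apply: measurable_funM => //; exact: measurable_Hr.
Qed.

Lemma cmeas_Hs2 x : cmeas (fun z : mcpt => 2 * Hs x z - 2 * Hs z z).
Proof.
apply: cmeasB; apply: cmeasM; try exact: cmeas_cst.
  by apply: cmeas_Hs => j; [exact: cmeas_cst|exact: cmeas_coord].
by apply: cmeas_Hs => j; exact: cmeas_coord.
Qed.

Lemma cre_Hs2 x z : cre (2 * Hs x z - 2 * Hs z z) = 2 * cre (Hs x z) - 2 * Hr z.
Proof. by rewrite -(cR_nat R 2) cre_sub !cre_cRM. Qed.

Lemma gaussH_lin_lty (x : cpt R n) (t s : R) : 0 < t ->
  (\int[mu]_z (expR (s * cre (Hs x z) - t * Hr z))%:E < +oo)%E.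
Proof.
move=> t0.
have [_ goo] := gauss_qp_cinteg0 (cR s *: col_mx 0 (h^T *m cv x)) 0 (negdefH t0).
move: goo; under eq_integral => z _.
  rewrite cabs_cexp /qp addr0 blZm -Hs_em cre_add cre_cRM ldZl cre_cRM emE ld_col ld0l add0r.
  rewrite ldC -bl_ld bl_tr -HsE -/(Hr z) addrC mulNr.
  over.
by [].
Qed.

(** [a b <= a^2 + b^2] splits the modulus into [|u|^2 e^{-2H}], integrable because [u] is in [L^2],
    and a Gaussian with a linear term. *)
Lemma repro_cinteg (u : mcpt -> C) x : cmeas u -> L2H u ->
  cinteg mu (fun z => u z * cexp (2 * Hs x z - 2 * Hs z z)).
Proof.
move=> mu_ u2; apply: (@le_cinteg _ _ _ mu _ (fun z => cabs2 (u z) * expR (- 2 * Hr z) +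
    expR (4 * cre (Hs x z) - 2 * Hr z))).
- by apply: cmeasM => //; apply: cmeas_cexp; exact: cmeas_Hs2.
- apply: measurable_funD; first exact: measurable_L2H.
  apply: measurableT_comp => //; apply: measurable_funB.
    apply: measurable_funM => //.
    by have [] := cmeas_Hs (fun j => cmeas_cst mcpt (x j)) (@cmeas_coord R n).
  by apply: measurable_funM => //; exact: measurable_Hr.
- move=> z; rewrite cabsM cabs_cexp cre_Hs2 -sqr_cabs.
  have -> : expR (2 * cre (Hs x z) - 2 * Hr z) = expR (- Hr z) * expR (2 * cre (Hs x z) - Hr z).
    by rewrite -expRD; congr expR; ring.
  have -> : expR (- 2 * Hr z) = expR (- Hr z) ^+ 2 by rewrite expr2 -expRD; congr expR; ring.
  have -> : expR (4 * cre (Hs x z) - 2 * Hr z) = expR (2 * cre (Hs x z) - Hr z) ^+ 2.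
    by rewrite expr2 -expRD; congr expR; ring.
  have := sqr_ge0 (cabs (u z) * expR (- Hr z) - expR (2 * cre (Hs x z) - Hr z)).
  have := mulr_ge0 (mulr_ge0 (cabs_ge0 (u z)) (expR_ge0 (- Hr z))) (expR_ge0 (2 * cre (Hs x z) - Hr z)).
  set a := cabs _; set b := expR _; set c := expR _; clear; nra.
- under eq_integral do rewrite EFinD.
  rewrite ge0_integralD//.
  + by apply: lte_add_pinfty => //; exact: gaussH_lin_lty.
  + by move=> z _; rewrite lee_fin mulr_ge0 ?cabs2_ge0 ?expR_ge0.
  + by apply/measurable_EFinP; exact: measurable_L2H.
  + apply/measurable_EFinP; apply: measurableT_comp => //; apply: measurable_funB.
      apply: measurable_funM => //.
      by have [] := cmeas_Hs (fun j => cmeas_cst mcpt (x j)) (@cmeas_coord R n).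
    by apply: measurable_funM => //; exact: measurable_Hr.
Qed.

(* After translating [x] to the origin the integrand is a holomorphic function times the
   rotation invariant weight, so the mean value property applies. *)
Lemma reproducing (u : cpt R n -> C) x c : holomorphic u -> L2H u ->
  (\int[mu]_z (expR (- (2 * Hr z)))%:E = c%:E)%E ->
  Cint mu (fun z => u z * cexp (2 * Hs x z - 2 * Hs z z)) = u x * cR c.
Proof.
move=> hu u2 cE; have mu_ := hol_cmeas hu.
pose v z := u (vadd x z) * cexp (- 2 * Hs z x).
have hv : holomorphic v.
  apply: holM; first exact: hol_shift.
  apply: hol_comp; first exact: cdiff_cexp.
  by apply: holM; [exact: hol_cst|exact: hol_Hsl].
have fE z : u (vadd z x) * cexp (2 * Hs x (vadd z x) - 2 * Hs (vadd z x) (vadd z x)) =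
    v z * cR (expR (- (2 * Hr z))).
  rewrite /v -cexp_gaussH cRN (cR_nat R 2) -mulrA -cexpD; congr (u _ * cexp _).
    by apply/funext => j; rewrite /vadd addrC.
  by rewrite !HsDl !HsDr; ring.
have fi := repro_cinteg x mu_ u2.
rewrite -(Cint_shift x); last by have [] := fi.
transitivity (Cint mu (fun z => v z * cR (expR (- (2 * Hr z))))).
  by apply: eq_Cint => z; rewrite fE.
rewrite mean_value//.
- rewrite (Cint_gaussH cE); congr (_ * _).
  rewrite /v (_ : vadd x _ = x); last by apply/funext => j; rewrite /vadd addr0.
  have -> : Hs (@vzero R n) x = 0 by rewrite !HsE cv0 bl0l.
  by rewrite mulr0 cexp0 mulr1.
- apply: measurableT_comp => //; apply: measurableT_comp => //.
  by apply: measurable_funM => //; exact: measurable_Hr.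
- by move=> w z w1; rewrite HrZ w1 mul1r.
- by have := cinteg_shift x fi; apply: eq_cinteg => z; rewrite fE.
- by apply: gaussH_cinteg.
Qed.

End HermitianForm.

(** * Toeplitz and Weyl kernels *)

Lemma mul_le_sqrD (R : realFieldType) (a b : R) : 0 <= a -> 0 <= b ->
  a * b <= a ^+ 2 + b ^+ 2.
Proof. nra. Qed.

Section MeasurableForms.
Variables (R : realType) (n : nat) (h : 'M[R[i]]_n).
Local Notation mcpt := (@mcpt R n).
Variables (d : measure_display) (T : measurableType d) (phi psi : T -> mcpt).
Hypotheses (mphi : measurable_fun setT phi) (mpsi : measurable_fun setT psi).

Lemma cmeas_Hs_comp : cmeas (fun t => Hs h (phi t) (psi t)).
Proof.
apply: cmeas_Hs => j; first exact: (cmeas_comp mphi (cmeas_coord R j)).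
exact: (cmeas_comp mpsi (cmeas_coord R j)).
Qed.

Lemma measurable_Hr_comp : measurable_fun setT (fun t => Hr h (phi t)).
Proof. exact: (measurableT_comp (measurable_Hr h) mphi). Qed.

Lemma measurable_vsub : measurable_fun setT (fun t => vsub (phi t) (psi t) : mcpt).
Proof.
have mj (j : 'I_n) : cmeas (fun t => vsub (phi t) (psi t) j).
  by apply: cmeasB; [exact: (cmeas_comp mphi (cmeas_coord R j))|
    exact: (cmeas_comp mpsi (cmeas_coord R j))].
by apply: measurable_to_mcpt => j; have [] := mj j.
Qed.

End MeasurableForms.

Lemma cmeas_qp (R : realType) n (S : 'M[R[i]]_(n + n)) l k :
  cmeas (fun y : mcpt R n => qp S l k (em y)).
Proof. by have := cmeas_qp_em S l k 0; apply: eq_cmeas => y; rewrite addr0. Qed.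

Section Kernels.
Variables (R : realType) (n : nat).
Local Notation C := (R[i]).
Local Notation mcpt := (@mcpt R n).
Local Notation mu := (@cptmu R n).
Variable h : 'M[C]_n.
Local Notation Hs := (Hs h).
Local Notation Hr := (Hr h).
Local Notation SH := (SH h).
Hypothesis hherm : forall j k, conjc (h j k) = h k j.
Hypothesis hpos : forall z, z <> @vzero R n -> 0 < Hr z.
Variables (Sq : 'M[C]_(n + n)) (lq : 'cV[C]_(n + n)) (kq : C).
Hypothesis Sq_lt : forall y, y <> @vzero R n -> cre (bl Sq (em y) (em y)) < Hr y.

Let Q (y : cpt R n) : C := qp Sq lq kq (em y).

(** [e^{2H(x,y)}] and [e^{2H(y,z)}] come from the two projections, taken without their normalising
    factors [1/c]; hence the factor [c * c] in [toeplitz_kernel_repr]. *)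
Definition toeplitz_kernel (x z : cpt R n) : C :=
  Cint mu (fun y => cexp (Q y + 2 * Hs x y + 2 * Hs y z - 2 * Hs y y)).

Lemma Hs_ldl x y : Hs x y = ld (col_mx 0 (h^T *m cv x)) (em y).
Proof. by rewrite emE ld_col ld0l add0r ldC -bl_ld bl_tr HsE. Qed.

Lemma Hs_ldr y z : Hs y z = ld (col_mx (h *m cv (vconj z)) 0) (em y).
Proof. by rewrite emE ld_col ld0l addr0 ldC -bl_ld HsE. Qed.

(** Used with [t = 1] for domination, [t = 2] for the Toeplitz kernel and [t = 4] for the Weyl
    symbol. *)
Lemma negdef_sub (t : R) : 1 <= t -> negdef (Sq + cR (- t) *: SH).
Proof.
move=> t1 y y0; rewrite blDm blZm cre_add cre_cRM -Hr_em.
have := Sq_lt y0; have := hpos y0; nra.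
Qed.

Definition kernel_lin (x z : cpt R n) : 'cV[C]_(n + n) :=
  lq + 2 *: (col_mx 0 (h^T *m cv x) + col_mx (h *m cv (vconj z)) 0).

Lemma kernel_exponent (t : R) x z y :
  Q y + 2 * Hs x y + 2 * Hs y z - cR t * Hs y y = qp (Sq + cR (- t) *: SH) (kernel_lin x z) kq (em y).
Proof.
rewrite /Q /qp blDm blZm -Hs_em /kernel_lin ldDl ldZl ldDl -Hs_ldl -Hs_ldr cRN; ring.
Qed.

Let cmQ : cmeas (fun y : mcpt => Q y). Proof. exact: cmeas_qp. Qed.

Let cmQ' d (T : measurableType d) (phi : T -> mcpt) : measurable_fun setT phi ->
  cmeas (fun t => Q (phi t)).
Proof. by move=> mphi; exact: (cmeas_comp mphi cmQ). Qed.

Let mcst d (T : measurableType d) (x : mcpt) : measurable_fun setT (fun _ : T => x).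
Proof. exact: measurable_cst. Qed.

Let mid : measurable_fun setT (fun y : mcpt => y). Proof. exact: measurable_id. Qed.

Lemma kernel_cinteg (t : R) x z : 1 <= t ->
  cinteg mu (fun y => cexp (Q y + 2 * Hs x y + 2 * Hs y z - cR t * Hs y y)).
Proof.
move=> t1; have := gauss_qp_cinteg0 (kernel_lin x z) kq (negdef_sub t1).
by apply: eq_cinteg => y; rewrite kernel_exponent.
Qed.

(* [e^{Re Q - H}] is still a Gaussian, by the strict bound on the real part of [q]. *)
Lemma gauss_Q_lty x : (\int[mu]_y (expR (cre (Q y) + 2 * cre (Hs x y) - Hr y))%:E < +oo)%E.
Proof.
have [_ ] := gauss_qp_cinteg0 (lq + 2 *: col_mx 0 (h^T *m cv x)) kq (negdef_sub (lexx 1)).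
under eq_integral => y _.
  rewrite cabs_cexp (_ : qp _ _ _ _ = Q y + 2 * Hs x y - Hs y y); last first.
    by rewrite /Q /qp blDm blZm -Hs_em ldDl ldZl -Hs_ldl cRN cR1; ring.
  rewrite -(cR_nat R 2) cre_sub cre_add cre_cRM -/(Hr y).
  over.
by [].
Qed.

Lemma shifted_gauss (t c : R) y : (\int[mu]_z (expR (- (t * Hr z)))%:E = c%:E)%E ->
  (\int[mu]_z (expR (- (t * Hr (vsub z y))))%:E = c%:E)%E.
Proof.
move=> <-; rewrite -(ge0_integral_shift (vscale (-1) y) (F := fun z => (expR (- (t * Hr z)))%:E)).
- by apply: eq_integral => z _; rewrite vsubE.
- apply/measurable_EFinP; apply: measurableT_comp => //; apply: measurableT_comp => //.
  by apply: measurable_funM => //; exact: measurable_Hr_comp.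
- by move=> z; rewrite lee_fin expR_ge0.
Qed.

(** Inside the integral for [g], the value [u y] is replaced by its own reproducing integral over
    [z], and the order of integration is exchanged. *)
Lemma toeplitz_kernel_repr (u g : cpt R n -> C) x c : holomorphic u -> L2H h u ->
  L2H h (fun y => cexp (Q y) * u y) -> (\int[mu]_z (expR (- (2 * Hr z)))%:E = c%:E)%E ->
  Cint mu (fun y => cexp (Q y) * u y * cexp (2 * Hs x y - 2 * Hs y y)) = g x * cR c ->
  g x * cR (c * c) = Cint mu (fun z => toeplitz_kernel x z * (u z * cexp (- 2 * Hs z z))).
Proof.
move=> hu u2 Qu2 cE gE; have mu_ := hol_cmeas hu.
pose G (p : mcpt * mcpt) := cexp (Q p.1 + 2 * Hs x p.1 + 2 * Hs p.1 p.2 - 2 * Hs p.1 p.1) *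
  (u p.2 * cexp (- 2 * Hs p.2 p.2)).
have m1 : measurable_fun setT (fun p : mcpt * mcpt => p.1) by exact: measurable_fst.
have m2 : measurable_fun setT (fun p : mcpt * mcpt => p.2) by exact: measurable_snd.
have mG : cmeas G.
  apply: cmeasM.
    apply: cmeas_cexp; apply: cmeasB; last first.
      by apply: cmeasM; [exact: cmeas_cst|exact: cmeas_Hs_comp].
    apply: cmeasD; last by apply: cmeasM; [exact: cmeas_cst|exact: cmeas_Hs_comp].
    apply: cmeasD; first exact: cmQ'.
    by apply: cmeasM; [exact: cmeas_cst|exact: cmeas_Hs_comp].
  apply: cmeasM; first exact: (cmeas_comp m2 mu_).
  by apply: cmeas_cexp; apply: cmeasM; [exact: cmeas_cst|exact: cmeas_Hs_comp].
(* Completing the square in [z - y] writes the modulus as [E y * e^{-H(z-y)} * |u z| e^{-H z}]. The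
   [z]-integral is then bounded uniformly in [y], and [E] is integrable by [gauss_Q_lty]. *)
pose E y := expR (cre (Q y) + 2 * cre (Hs x y) - Hr y).
have GE y z : cabs (G (y, z)) = E y * (expR (- Hr (vsub z y)) * (cabs (u z) * expR (- Hr z))).
  rewrite /G /= !cabsM !cabs_cexp -(cR_nat R 2) -cRN !cre_sub !cre_add !cre_cRM -/(Hr y) -/(Hr z).
  transitivity (cabs (u z) * (E y * expR (- Hr (vsub z y)) * expR (- Hr z))); last by ring.
  rewrite /E mulrCA -!expRD; congr (_ * expR _).
  by rewrite HrB// (cre_HsC hherm z y) /Q /qp !cre_add; ring.
pose N := (\int[mu]_z (cabs2 (u z) * expR (- 2 * Hr z))%:E)%E.
have N0 : (0 <= N)%E by apply: integral_ge0 => z _; rewrite lee_fin mulr_ge0 ?cabs2_ge0 ?expR_ge0.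
have mE : measurable_fun setT (fun y : mcpt => (E y)%:E).
  apply/measurable_EFinP; apply: measurableT_comp => //; apply: measurable_funB; last exact: measurable_Hr_comp.
  apply: measurable_funD; first by have [] := cmQ.
  apply: measurable_funM => //; by have [] := cmeas_Hs_comp h (mcst x) mid.
have mN : measurable_fun setT (fun z : mcpt => (cabs2 (u z) * expR (- 2 * Hr z))%:E).
  by apply/measurable_EFinP; exact: measurable_L2H.
have mS y : measurable_fun setT (fun z : mcpt => (expR (- (2 * Hr (vsub z y))))%:E).
  apply/measurable_EFinP; apply: measurableT_comp => //; apply: measurableT_comp => //.
  by apply: measurable_funM => //; apply: measurable_Hr_comp; exact: measurable_vsub.
have inner y : (\int[mu]_z (cabs (G (y, z)))%:E <= (E y)%:E * (c%:E + N))%E.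
  rewrite -(shifted_gauss y cE) -ge0_integralD//; last first.
    by move=> z _; rewrite lee_fin mulr_ge0 ?cabs2_ge0 ?expR_ge0.
  rewrite -ge0_integralZl//.
  - apply: ge0_le_integral => //.
    + by move=> z _; rewrite lee_fin cabs_ge0.
    + apply/measurable_EFinP; apply: measurable_cabs.
      exact: (cmeas_comp (pair1_measurable y) mG).
    + by apply: measurable_funeM; exact: emeasurable_funD.
    + move=> z _; rewrite -EFinD -EFinM lee_fin GE ler_wpM2l ?expR_ge0//.
      rewrite -sqr_cabs.
      have -> : expR (- (2 * Hr (vsub z y))) = expR (- Hr (vsub z y)) ^+ 2.
        by rewrite expr2 -expRD; congr expR; ring.
      have -> : expR (- 2 * Hr z) = expR (- Hr z) ^+ 2 by rewrite expr2 -expRD; congr expR; ring.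
      rewrite -exprMn.
      by apply: mul_le_sqrD; rewrite ?mulr_ge0 ?expR_ge0 ?cabs_ge0.
  - exact: emeasurable_funD.
  - by move=> z _; rewrite adde_ge0// lee_fin ?mulr_ge0 ?cabs2_ge0 ?expR_ge0.
  - by rewrite lee_fin expR_ge0.
have Goo : (\int[mu]_y \int[mu]_z (cabs (G (y, z)))%:E < +oo)%E.
  apply: (@le_lt_trans _ _ (\int[mu]_y ((E y)%:E * (c%:E + N)))%E).
    apply: ge0_le_integral => //.
    - by move=> w _; apply: integral_ge0 => z _; rewrite lee_fin cabs_ge0.
    - apply: (@measurable_fun_fubini_tonelli_F _ _ _ _ _ mu (fun p => (cabs (G p))%:E)).
        by apply/measurable_EFinP; exact: measurable_cabs.
      by move=> p; rewrite lee_fin cabs_ge0.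
    - by apply: emeasurable_funM => //; exact: measurable_cst.
  have c0 : (0 <= c%:E)%E by rewrite -cE; apply: integral_ge0 => z _; rewrite lee_fin expR_ge0.
  rewrite ge0_integralZr//; first last.
  - by rewrite adde_ge0.
  - by move=> w _; rewrite lee_fin expR_ge0.
  rewrite lte_mul_pinfty//.
  - by apply: integral_ge0 => y _; rewrite lee_fin expR_ge0.
  - rewrite ge0_fin_numE; first exact: gauss_Q_lty.
    by apply: integral_ge0 => y _; rewrite lee_fin expR_ge0.
  - by apply: lte_add_pinfty => //; rewrite ltey.
have := Cint_swap mG Goo.
have -> : Cint mu (fun y => Cint mu (fun z => G (y, z))) = g x * cR (c * c).
  transitivity (Cint mu (fun y => cR c * (cexp (Q y) * u y * cexp (2 * Hs x y - 2 * Hs y y)))).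
    apply: eq_Cint => y.
    rewrite (_ : cR c * _ = cexp (Q y + 2 * Hs x y - 2 * Hs y y) * (u y * cR c)); last first.
      by rewrite -addrA [cexp (Q y + _)]cexpD; ring.
    rewrite -(reproducing hherm hpos y hu u2 cE) -CintZ; last exact: repro_cinteg.
    apply: eq_Cint => z; rewrite /G /=.
    set a := Q y; set b := Hs x y; set e := Hs y z; set f := Hs y y; set k := Hs z z.
    transitivity (u z * (cexp (a + 2 * b + 2 * e - 2 * f) * cexp (- 2 * k))); first by ring.
    transitivity (u z * (cexp (a + 2 * b - 2 * f) * cexp (2 * e - 2 * k))); last by ring.
    by rewrite -!cexpD; congr (u z * cexp _); ring.
  rewrite CintZ; last by apply: repro_cinteg => //; apply: cmeasM => //; exact: cmeas_cexp.
  by rewrite gE cRM; ring.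
move=> ->; apply: eq_Cint => z.
rewrite /G /= [RHS]mulrC -CintZ; last first.
  have := @kernel_cinteg 2 x z; rewrite ler1n (cR_nat R 2); exact.
by apply: eq_Cint => y; rewrite mulrC.
Qed.

End Kernels.

(** * The Toeplitz kernel as an integral of the Weyl symbol *)

Section WeylKernel.
Variables (R : realType) (n : nat).
Local Notation C := (R[i]).
Local Notation mcpt := (@mcpt R n).
Local Notation mu := (@cptmu R n).
Variable h : 'M[C]_n.
Local Notation Hs := (Hs h).
Local Notation Hr := (Hr h).
Local Notation SH := (SH h).
Hypothesis hherm : forall j k, conjc (h j k) = h k j.
Hypothesis hpos : forall z, z <> @vzero R n -> 0 < Hr z.
Variables (Sq : 'M[C]_(n + n)) (lq : 'cV[C]_(n + n)) (kq : C).
Hypothesis Sq_lt : forall y, y <> @vzero R n -> cre (bl Sq (em y) (em y)) < Hr y.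

Let Q (y : cpt R n) : C := qp Sq lq kq (em y).

Definition weyl_integral (w : cpt R n) : C :=
  Cint mu (fun y => cexp (cR (- 4 * Hr (vsub w y)) + Q y)).

Lemma bl_SH (a b : 'cV[C]_n) : bl SH (col_mx a b) (col_mx a b) = bl h a b.
Proof. by rewrite /SH bl_block !bl0m (add0r (bl h a b)) (addr0 0) (addr0 (bl h a b)). Qed.

Let mid (x z : cpt R n) : cpt R n := vscale (cR 2^-1) (vadd x z).

Lemma weyl_modulus w x z : cre (- 4 * Hs (vsub w x) (vsub w z) + 2 * Hs x z) =
  Hr x + Hr z - 4 * Hr (vsub w (mid x z)).
Proof.
rewrite HrB// /mid HrZ HrD// HsZr HsDr !HsBl !HsBr conj_cR -(cR_nat R 4) -(cR_nat R 2) -cRN.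
rewrite !(cre_add, cre_cRM, cre_opp, cre_sub) (cre_HsC hherm w x) /cabs2 /= expr0n addr0 -/(Hr w).
by field.
Qed.

(** Expanding [- 4 H(w - y)] gives a factor free of [y] and the kernel exponent with [t = 4] and
    both base points at [2 w]. *)
Lemma cinteg_weyl w : cinteg mu (fun y => cexp (cR (- 4 * Hr (vsub w y)) + Q y)).
Proof.
have t4 : (1 : R) <= 4 by rewrite ler1n.
have := cintegZ (cexp (cR (- 4 * Hr w))) (kernel_cinteg hpos lq kq Sq_lt (vscale 2 w) (vscale 2 w) t4).
apply: eq_cinteg => y; rewrite -cexpD; congr cexp.
rewrite -!/(Q y) !HsZl HsZr -(cR_nat R 2) conj_cR (cR_nat R 2) HrB//.
have -> : cR (- 4 * (Hr w + Hr y - 2 * cre (Hs w y))) =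
  cR (- 4 * Hr w) - cR 4 * Hs y y + 4 * cR (2 * cre (Hs w y)).
  rewrite Hs_real// !cRM cRN (cR_nat R 4) cRB cRD !cRM (cR_nat R 2); ring.
rewrite -add_conj Hs_conj//; ring.
Qed.

Let mcst d (T : measurableType d) (x : mcpt) : measurable_fun setT (fun _ : T => x).
Proof. exact: measurable_cst. Qed.

Let cmW d (T : measurableType d) (phi psi : T -> mcpt) : measurable_fun setT phi ->
  measurable_fun setT psi -> cmeas (fun t => cexp (cR (- 4 * Hr (vsub (phi t) (psi t))) + Q (psi t))).
Proof.
move=> mphi mpsi; apply: cmeas_cexp; apply: cmeasD; last exact: (cmeas_comp mpsi (cmeas_qp Sq lq kq)).
apply: cmeas_cR; apply: measurable_funM => //.
by apply: measurable_Hr_comp; exact: measurable_vsub.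
Qed.

Lemma cmeas_weyl : cmeas (fun w : mcpt => weyl_integral w).
Proof.
apply: (cmeas_Cint mu (f := fun p : mcpt * mcpt => cexp (cR (- 4 * Hr (vsub p.1 p.2)) + Q p.2))).
by apply: cmW; [exact: measurable_fst|exact: measurable_snd].
Qed.

Let G x z (p : mcpt * mcpt) := cexp (cR (- 4 * Hr (vsub p.2 p.1)) + Q p.1) *
  cexp (- 4 * Hs (vsub p.2 x) (vsub p.2 z) + 2 * Hs x z).

Let cmK d (T : measurableType d) (phi : T -> mcpt) x z : measurable_fun setT phi ->
  cmeas (fun t => cexp (- 4 * Hs (vsub (phi t) x) (vsub (phi t) z) + 2 * Hs x z)).
Proof.
move=> mphi; apply: cmeas_cexp; apply: cmeasD; last exact: cmeas_cst.
apply: cmeasM; first exact: cmeas_cst.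
by apply: cmeas_Hs_comp; apply: measurable_vsub => //; exact: mcst.
Qed.

Let cmG x z : cmeas (G x z).
Proof.
have m1 : measurable_fun setT (fun p : mcpt * mcpt => p.1) by exact: measurable_fst.
have m2 : measurable_fun setT (fun p : mcpt * mcpt => p.2) by exact: measurable_snd.
by apply: cmeasM; [exact: cmW|exact: cmK].
Qed.

(* Parallelogram: [4 Hr a + 4 Hr b >= 2 Hr a + Hr (a - b)]. *)
Let cabsG_le x z y w : cabs (G x z (y, w)) <=
  expR (Hr x + Hr z - Hr (mid x z)) * expR (cre (Q y) + 2 * cre (Hs (mid x z) y) - Hr y) *
  expR (- (2 * Hr (vsub w y))).
Proof.
rewrite /G /= cabsM !cabs_cexp weyl_modulus cre_add cre_cR -!expRD ler_expR; set m := mid x z.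
have E : Hr (vsub (vsub w y) (vsub w m)) = Hr (vsub m y).
  by congr Hr; apply/funext => j; rewrite /vsub; ring.
have := Hr_ge0 hpos (vadd (vsub w y) (vsub w m)).
have := Hr_ge0 hpos (vsub w m).
move: E; rewrite !HrB// (HrD hherm (vsub w y) (vsub w m)) !HrB//; lra.
Qed.

(** With the integral for the symbol inserted and the order exchanged, the exponent is that of the
    Toeplitz kernel plus [- 8 H(w - (x+y)/2, w - (y+z)/2)]. The two arguments have different
    centres, so this is no real translate of [- 8 H(w, w)], but in the variables [(w, conj w)] it is
    a complex one, and [gauss_shift] makes its integral the constant [c]. *)
Lemma weyl_kernel x z c : (\int[mu]_w (expR (- (8 * Hr w)))%:E = c%:E)%E ->
  Cint mu (fun w => weyl_integral w * cexp (- 4 * Hs (vsub w x) (vsub w z) + 2 * Hs x z)) =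
  cR c * toeplitz_kernel h Sq lq kq x z.
Proof.
move=> cE; set m := mid x z; pose K := expR (Hr x + Hr z - Hr m).
pose E y := expR (cre (Q y) + 2 * cre (Hs m y) - Hr y).
have two : (0 : R) < 2 by [].
have [c2 c20 c2E] := gaussH_mass hherm hpos two.
have mE : measurable_fun setT (fun y : mcpt => (E y)%:E).
  apply/measurable_EFinP; apply: measurableT_comp => //; apply: measurable_funB; last first.
    exact: measurable_Hr.
  apply: measurable_funD; first by have [] := cmeas_qp Sq lq kq.
  apply: measurable_funM => //.
  by have [] := cmeas_Hs_comp h (mcst (T := mcpt) m) (@measurable_id _ mcpt setT).
have Goo : (\int[mu]_y \int[mu]_w (cabs (G x z (y, w)))%:E < +oo)%E.
  apply: (@le_lt_trans _ _ (\int[mu]_y ((K * c2)%:E * (E y)%:E))%E).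
    apply: ge0_le_integral => //.
    - by move=> y _; apply: integral_ge0 => w _; rewrite lee_fin cabs_ge0.
    - apply: (@measurable_fun_fubini_tonelli_F _ _ _ _ _ mu (fun p => (cabs (G x z p))%:E)).
        by apply/measurable_EFinP; exact: measurable_cabs.
      by move=> p; rewrite lee_fin cabs_ge0.
    - exact: measurable_funeM.
    - move=> y _; rewrite -EFinM mulrAC EFinM -(shifted_gauss y c2E) -ge0_integralZl//; last 2 first.
      + by apply/measurable_EFinP; apply: measurableT_comp => //; apply: measurableT_comp => //;
          apply: measurable_funM => //; apply: measurable_Hr_comp; exact: measurable_vsub.
      + by rewrite lee_fin mulr_ge0 ?expR_ge0.
      apply: ge0_le_integral => //.
      + by move=> w _; rewrite lee_fin cabs_ge0.
      + apply/measurable_EFinP; apply: measurable_cabs.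
        exact: (cmeas_comp (pair1_measurable y) (cmG x z)).
      + apply: measurable_funeM; apply/measurable_EFinP; apply: measurableT_comp => //.
        by apply: measurableT_comp => //;
          apply: measurable_funM => //; apply: measurable_Hr_comp; exact: measurable_vsub.
      + by move=> w _; rewrite -EFinM lee_fin; exact: cabsG_le.
  rewrite ge0_integralZl//.
  - rewrite lte_mul_pinfty// ?lee_fin ?mulr_ge0 ?expR_ge0 ?ltW//.
    exact: gauss_Q_lty.
  - by move=> y _; rewrite lee_fin expR_ge0.
  - by rewrite lee_fin mulr_ge0 ?expR_ge0 ?ltW.
have swap := Cint_swap (cmG x z) Goo.
transitivity (Cint mu (fun w => Cint mu (fun y => G x z (y, w)))).
  apply: eq_Cint => w; rewrite mulrC /weyl_integral -CintZ; last exact: cinteg_weyl.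
  by apply: eq_Cint => y; rewrite mulrC.
have eight : (0 : R) < 8 by [].
rewrite -swap /toeplitz_kernel -CintZ; last first.
  have := @kernel_cinteg _ _ h hpos Sq lq kq Sq_lt 2 x z; rewrite ler1n (cR_nat R 2); exact.
apply: eq_Cint => y.
(* The holomorphic half is centred at [(x+y)/2] and the antiholomorphic half at the conjugate of
   [(y+z)/2]; in general [W] is not of the form [em w]. *)
pose W : 'cV[C]_(n + n) := - col_mx (cv (mid x y)) (cv (vconj (mid y z))).
have gE w : cexp (qp (cR (- 8) *: SH) 0 0 (em w + W)) =
    cexp (- 8 * Hs (vsub w (mid x y)) (vsub w (mid y z))).
  rewrite /qp ld0l !addr0 blZm cRN (cR_nat R 8) HsE; congr (cexp (_ * _)).
  rewrite /W /mid !vsubE !vconjD !vconjZ !cvD !cvZ rmorphN1 !scaleN1r.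
  by rewrite emE opp_col_mx add_col_mx bl_SH.
transitivity (Cint mu (fun w => cexp (Q y + 2 * Hs x y + 2 * Hs y z - 2 * Hs y y) *
    cexp (qp (cR (- 8) *: SH) 0 0 (em w + W)))).
  apply: eq_Cint => w; rewrite /G gE -!cexpD; congr cexp => /=.
  have -> : cR (- 4 * Hr (vsub w y)) = - 4 * Hs (vsub w y) (vsub w y).
    by rewrite Hs_real// cRM cRN (cR_nat R 4).
  rewrite !HsBl !HsBr !HsZl !HsZr conj_cR !HsDl !HsDr.
  rewrite cR_inv ?pnatr_eq0// (cR_nat R 2).
  by field.
rewrite CintZ; last exact: gauss_qp_cinteg (negdefH hpos eight).
rewrite (gauss_shift 0 0 W (negdefH hpos eight)) [RHS]mulrC; congr (_ * _).
rewrite -(Cint_gaussH cE); apply: eq_Cint => w.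
by rewrite /qp ld0l !addr0 blZm -Hs_em cexp_gaussH.
Qed.

End WeylKernel.

(** * A bounded symbol gives a bounded weighted kernel *)

Section KernelBound.
Variables (R : realType) (n : nat).
Local Notation C := (R[i]).
Local Notation mcpt := (@mcpt R n).
Local Notation mu := (@cptmu R n).
Variable h : 'M[C]_n.
Local Notation Hr := (Hr h).
Hypothesis hherm : forall j k, conjc (h j k) = h k j.
Hypothesis hpos : forall z, z <> @vzero R n -> 0 < Hr z.
Variables (Sq : 'M[C]_(n + n)) (lq : 'cV[C]_(n + n)) (kq : C).
Hypothesis Sq_lt : forall y, y <> @vzero R n -> cre (bl Sq (em y) (em y)) < Hr y.

Lemma toeplitz_kernel_bound (M : R) :
  (\int[mu]_w (if M < cabs (weyl_integral h Sq lq kq w) then 1 else 0)%:E = 0)%E ->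
  exists B : R, forall x z, cabs (toeplitz_kernel h Sq lq kq x z) <= B * expR (Hr x + Hr z).
Proof.
move=> aM; set a := weyl_integral h Sq lq kq in aM.
have ma : cmeas (fun w : mcpt => a w) by exact: cmeas_weyl.
have [c8 c80 c8E] := @gaussH_mass _ _ h hherm hpos 8 ltac:(by []).
have [c4 c40 c4E] := @gaussH_mass _ _ h hherm hpos 4 ltac:(by []).
have aeM : {ae mu, forall w, cabs (a w) <= `|M|}.
  have mf : measurable_fun setT (fun w : mcpt => (if M < cabs (a w) then 1 else 0 : R)%:E).
    apply/measurable_EFinP; apply: measurable_fun_ifT => //.
    by apply: measurable_fun_ltr => //; exact: measurable_cabs.
  have /(ae_eq_integral_abs mu measurableT mf) : (\int[mu]_w `|(if M < cabs (a w) then 1 else 0 : R)%:E| = 0)%E.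
    rewrite -[RHS]aM; apply: eq_integral => w _; rewrite gee0_abs//.
    by case: ifP => _; rewrite lee_fin.
  apply: filterS => w /(_ I) /=; case: ifP => [_ [] /eqP|/negbT]; first by rewrite oner_eq0.
  by rewrite -leNgt => aw _; exact: (le_trans aw (ler_norm M)).
(* [c8] is the constant of [weyl_kernel] and [c4] the mass of [e^{-4H}], which does not depend on
   the centre [(x+z)/2]; [M] carries no sign, hence its absolute value. *)
exists (c8^-1 * (`|M| * c4)) => x z.
pose E w := expR (- (4 * Hr (vsub w (vscale (cR 2^-1) (vadd x z))))).
have mE : measurable_fun setT (fun w : mcpt => (E w)%:E).
  apply/measurable_EFinP; apply: measurableT_comp => //; apply: measurableT_comp => //.
  apply: measurable_funM => //; apply: measurable_Hr_comp; apply: measurable_vsub => //.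
have key := weyl_kernel hherm hpos lq kq Sq_lt x z c8E.
have cmf : cmeas (fun w : mcpt => a w * cexp (- 4 * Hs h (vsub w x) (vsub w z) + 2 * Hs h x z)).
  apply: cmeasM => //; apply: cmeas_cexp; apply: cmeasD; last exact: cmeas_cst.
  apply: cmeasM; first exact: cmeas_cst.
  by apply: cmeas_Hs_comp; apply: measurable_vsub.
have := cabs_Cint_le_ge0 mu cmf; rewrite key cabsM cabs_cR gtr0_norm// => le1.
have le2 : (\int[mu]_w (cabs (a w * cexp (- 4 * Hs h (vsub w x) (vsub w z) + 2 * Hs h x z)))%:E <=
  \int[mu]_w ((`|M| * expR (Hr x + Hr z))%:E * (E w)%:E))%E.
  apply: ae_ge0_le_integral => //.
  - by move=> w _; rewrite lee_fin cabs_ge0.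
  - by apply/measurable_EFinP; exact: measurable_cabs.
  - by move=> w _; rewrite -EFinM lee_fin !mulr_ge0 ?expR_ge0.
  - exact: measurable_funeM.
  - move: aeM; apply: filterS; first exact: (ae_filter_ringOfSetsType mu).
    move=> w aw _; rewrite cabsM cabs_cexp weyl_modulus// expRD -EFinM lee_fin -mulrA.
    by apply: ler_wpM2r => //; rewrite mulr_ge0 ?expR_ge0.
have := le_trans le1 le2.
rewrite ge0_integralZl//; first last.
- by move=> w _; rewrite lee_fin expR_ge0.
rewrite (shifted_gauss _ c4E) -EFinM lee_fin => le3.
by rewrite -mulrA ler_pdivlMl// mulrAC -mulrA mulrCA; lra.
Qed.

End KernelBound.

(** * Decay of the kernel *)

(** Used in two ways: along rays it extracts a semidefinite quadratic part from a lower bound, and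
    along lines it shows that a null vector of that part is orthogonal to every direction. *)
Lemma quadratic_ge0 (R : realFieldType) (a b c : R) :
  (forall s, 0 <= s ^+ 2 * a + s * b + c) -> 0 <= a /\ (a = 0 -> b = 0).
Proof.
move=> H; split.
  rewrite leNgt; apply/negP => a0; pose m := `|b| + `|c| + 1.
  (* At this [s >= 1] one has [s a < - (|b| + |c| + 1)], so the quadratic term outweighs the two
     others. *)
  pose s := m / (- a) + 1.
  have m0 : 0 < m by rewrite ltr_wpDl.
  have s1 : 1 <= s by rewrite lerDr divr_ge0 ?ltW ?oppr_gt0.
  have sa : s * a = - m + a by rewrite /s; field; rewrite ?oppr_eq0 lt_eqF.
  have := H s; rewrite expr2 -mulrA sa.
  have := ler_norm b; have := ler_norm c; rewrite /m; have := normr_ge0 c; have := normr_ge0 b.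
  clear -s1 a0; set B := `|b|; set D := `|c|; nra.
move=> a0; have [//|b0] := eqVneq b 0.
by have := H (- (c + 1) / b); rewrite a0 mulr0 add0r divfK//; lra.
Qed.

Lemma bl_parallelogram (R : realType) m (S : 'M[R[i]]_m) (q v : 'cV[R[i]]_m) :
  cre (bl S (q + v) (q + v)) + cre (bl S (q - v) (q - v)) =
  2 * cre (bl S q q) + 2 * cre (bl S v v).
Proof. by rewrite !blDl !blDr !blNl !blNr !cre_add !cre_opp; ring. Qed.

Section QuadraticDecay.
Variables (R : realType) (n : nat).
Local Notation C := (R[i]).
Local Notation mcpt := (@mcpt R n).
Local Notation mu := (@cptmu R n).
Variable h : 'M[C]_n.
Local Notation Hr := (Hr h).
Local Notation SH := (SH h).
Hypothesis hherm : forall j k, conjc (h j k) = h k j.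
Variables (S MA MB : 'M[C]_(n + n)) (W0 : 'cV[C]_(n + n)).

Let w x z := MA *m em x + MB *m em z.
(** [rho] and [lin] are the quadratic and linear parts of [quad_phase], and [rhoB] is [rho] on the
    vectors [(0, z)]. *)
Let rho x z := Hr x + Hr z + cre (bl S (w x z) (w x z)).
Let lin u := cre (bl S W0 u + bl S u W0).
Let rhoB z := Hr z + cre (bl S (MB *m em z) (MB *m em z)).

(** The exponent left by completing the square, up to sign and constant: the critical point
    [W0 + w x z] is affine in [(x, z)]. Keeping [MA] and [MB] general lets the two variables
    exchange roles. *)
Definition quad_phase x z := Hr x + Hr z + cre (bl S (W0 + w x z) (W0 + w x z)).

(** The expression is the polarization of [rho] between [(xi, 0)] and [(0, v)], up to a factor 2,
    since [Hr x + Hr z] has no cross term. *)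
Hypothesis nondeg : forall v, (forall xi, cre (bl S (MA *m em xi) (MB *m em v) +
  bl S (MB *m em v) (MA *m em xi)) = 0) -> v = @vzero R n.
Variable B0 : R.
Hypothesis phase_ge : forall x z, - B0 <= quad_phase x z.

Let phaseE x z : quad_phase x z = rho x z + lin (w x z) + cre (bl S W0 W0).
Proof. by rewrite /quad_phase /rho /lin !blDl !blDr !cre_add; ring. Qed.

Let HrR s x : Hr (vscale (cR s) x) = s ^+ 2 * Hr x.
Proof. by rewrite HrZ /cabs2 /= expr0n addr0. Qed.

Let wZ s x z : w (vscale (cR s) x) (vscale (cR s) z) = cR s *: w x z.
Proof. by rewrite /w !emZ -!scalemxAr scalerDr. Qed.

Let rho_ge0 x z : 0 <= rho x z.
Proof.
have [] := @quadratic_ge0 _ (rho x z) (lin (w x z)) (cre (bl S W0 W0) + B0) _; last by [].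
move=> s; have := phase_ge (vscale (cR s) x) (vscale (cR s) z).
rewrite phaseE /rho /lin wZ !HrR !(blZl, blZr) !cre_add !cre_cRM; lra.
Qed.

(** If [rhoB v = 0], the nonnegative polynomial [s -> rho (xi, s v)] has no quadratic term, hence no
    linear one; this holds for every [xi], and [nondeg] applies. *)
Let rhoB_gt0 v : v <> @vzero R n -> 0 < rhoB v.
Proof.
move=> v0; have H xi (s : R) : 0 <= s ^+ 2 * rhoB v + s * cre (bl S (MA *m em xi) (MB *m em v) +
    bl S (MB *m em v) (MA *m em xi)) + (Hr xi + cre (bl S (MA *m em xi) (MA *m em xi))).
  have := rho_ge0 xi (vscale (cR s) v).
  rewrite /rho /rhoB /w HrR emZ -!scalemxAr !blDl !blDr !(blZl, blZr) !cre_add !cre_cRM; lra.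
have [r0 _] := quadratic_ge0 (H (@vzero R n)).
rewrite lt_neqAle r0 andbT; apply/eqP => r00; apply: v0; apply: nondeg => xi.
by have [_] := quadratic_ge0 (H xi); apply.
Qed.

Let rhoBE z : rhoB z = cre (bl (SH + MB^T *m S *m MB) (em z) (em z)).
Proof.
rewrite /rhoB Hr_em blDm cre_add; congr (_ + cre _).
by rewrite bl.unlock trmx_mul !mulmxA.
Qed.

Let parallelogram x y d : quad_phase x (vadd y d) + quad_phase x (vsub y d) =
  2 * quad_phase x y + 2 * rhoB d.
Proof.
rewrite /quad_phase /rhoB /w HrB// HrD// vsubE !emD -[-1 : C](cRN 1) emZ cRN scaleN1r !mulmxDr mulmxN.
set u := MB *m em y; set v := MB *m em d; set k := MA *m em x.
rewrite !addrA; have := bl_parallelogram S (W0 + k + u) v.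
move: (cre (bl _ _ _)) (cre (bl _ _ _)) (cre (bl _ _ _)) (cre (bl _ _ _)) => vv qq dm dp E.
transitivity (2 * Hr x + 2 * Hr y + 2 * Hr d + (dp + dm)); [ring|rewrite E; ring].
Qed.

(* At a near minimizer [z'] of [quad_phase x] the parallelogram identity turns the uniform lower
   bound into quadratic growth that does not depend on [x]. *)
Lemma phase_growth x : exists z', forall z,
  4^-1 * rhoB (vsub z z') - (B0 + 2^-1) <= quad_phase x z.
Proof.
pose A := [set quad_phase x z | z in setT].
have infA : has_inf A.
  split; first by exists (quad_phase x x); exists x.
  by exists (- B0) => _ [z _ <-].
have [_ [z' _ <-] Hz'] := inf_adherent ltr01 infA.
(* [z' + d] is the midpoint of [z'] and [z], where the phase is at least [- B0]. Near minimality
   gives [quad_phase x z' < quad_phase x z + 1], so [2 quad_phase x z + 1] exceeds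
   [- 2 B0 + rhoB (z - z') / 2]; halving gives the constants [4^-1] and [B0 + 2^-1]. *)
exists z' => z; pose d := vscale (cR 2^-1) (vsub z z').
have Ed : rhoB d = 4^-1 * rhoB (vsub z z').
  by rewrite /rhoB /d HrR emZ -scalemxAr blZl blZr !cre_cRM; field.
have := parallelogram x (vadd z' d) d.
have -> : vsub (vadd z' d) d = z' by apply/funext => j; rewrite /vsub /vadd; ring.
have -> : vadd (vadd z' d) d = z.
  by apply/funext => j; rewrite /vadd /d /vscale /vsub cR_inv ?pnatr_eq0// (cR_nat R 2); field.
have infz : inf A <= quad_phase x z by apply: ge_inf => //; [case: infA|exists z].
have arith (p p' r i q : R) : - B0 <= q -> i <= p -> p' < i + 1 -> p + p' = 2 * q + 2 * (4^-1 * r) ->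
  4^-1 * r - (B0 + 2^-1) <= p by lra.
by rewrite Ed; apply: arith infz Hz'; exact: phase_ge.
Qed.

Lemma measurable_quad_phase d (T : measurableType d) (phi psi : T -> mcpt) :
  measurable_fun setT phi -> measurable_fun setT psi ->
  measurable_fun setT (fun t => quad_phase (phi t) (psi t)).
Proof.
move=> mphi mpsi; apply: measurable_funD.
  by apply: measurable_funD; exact: measurable_Hr_comp.
have cm (M : 'M[C]_(n + n)) (f : T -> mcpt) : measurable_fun setT f ->
    cvmeas (fun t => M *m em (f t)).
  move=> mf i; under eq_fun do rewrite mxE.
  apply: cmeas_sum => j; apply: cmeasM; first exact: cmeas_cst.
  by apply: cvmeas_em => k; exact: (cmeas_comp mf (cmeas_coord R k)).
have cw : cvmeas (fun t => W0 + w (phi t) (psi t)).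
  by apply: cvmeasD; [exact: cvmeas_cst|apply: cvmeasD; exact: cm].
by have [] := cmeas_bl S cw cw.
Qed.

Lemma phase_integral_bound : exists B : R, forall x,
  (\int[mu]_z (expR (- quad_phase x z))%:E <= B%:E)%E.
Proof.
pose S4 := cR (- 4^-1) *: (SH + MB^T *m S *m MB).
have S4E z : cre (bl S4 (em z) (em z)) = - (4^-1 * rhoB z).
  by rewrite blZm cre_cRM rhoBE mulNr.
have S4neg : negdef S4.
  by move=> z z0; rewrite S4E oppr_lt0 mulr_gt0// rhoB_gt0.
have [mE] := gauss_qp_cinteg0 0 0 S4neg.
under eq_integral => z _ do rewrite cabs_cexp /qp ld0l !addr0 S4E.
set I := (\int[mu]_z _)%E => Ioo.
have mR : measurable_fun setT (fun z : mcpt => expR (- (4^-1 * rhoB z))).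
  have := measurable_cabs mE; apply: eq_measurable_fun => z _.
  by rewrite cabs_cexp /qp ld0l !addr0 S4E.
have If : I \is a fin_num by rewrite ge0_fin_numE// integral_ge0.
exists (expR (B0 + 2^-1) * fine I) => x; have [z' Hz'] := phase_growth x.
have mS : measurable_fun setT (fun z : mcpt => (expR (- (4^-1 * rhoB (vadd z (vscale (-1) z')))))%:E).
  apply/measurable_EFinP; apply: (measurableT_comp mR).
  under eq_fun do rewrite -vsubE.
  by apply: measurable_vsub => //; exact: measurable_cst.
rewrite EFinM fineK// /I -(ge0_integral_shift (vscale (-1) z') (F := fun z => (expR (- (4^-1 * rhoB z)))%:E)).
- rewrite -ge0_integralZl//.
  apply: ge0_le_integral => //.
  + apply/measurable_EFinP; apply: measurableT_comp => //; apply: measurableT_comp => //.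
    by apply: measurable_quad_phase => //; exact: measurable_cst.
  + exact: measurable_funeM.
  + move=> z _; rewrite -EFinM lee_fin -expRD ler_expR -vsubE.
    have := Hz' z; lra.
- exact/measurable_EFinP.
- by move=> z; rewrite lee_fin expR_ge0.
Qed.

End QuadraticDecay.

Lemma unitmx_inj (F : fieldType) m (A : 'M[F]_m) :
  (forall u : 'cV[F]_m, A *m u = 0 -> u = 0) -> A \in unitmx.
Proof.
move=> H; rewrite -unitmx_tr -row_free_unit -kermx_eq0; apply/eqP/row_matrixP => i.
rewrite row0; apply: trmx_inj; rewrite trmx0; apply: H.
by rewrite -{1}[A]trmxK -trmx_mul -row_mul mulmx_ker row0 trmx0.
Qed.

(** * Completing the square at a complex critical point *)

Section NegativeDefinite.
Variables (R : realType) (n : nat).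
Local Notation C := (R[i]).
Variable S : 'M[C]_(n + n).
Hypothesis Sneg : negdef S.

(** For [W = em a + i em b] in the kernel, pairing with [em a - i em b] yields twice the sum of the
    values of [S] at [em a] and [em b]. The real part of that sum is negative unless [a] and [b]
    vanish. *)
Lemma negdef_unit : S + S^T \in unitmx.
Proof.
apply: unitmx_inj => u; have [a [b ->]] := em_span u; set W := em a + _ => TW.
have E (c d : C) : bl S (c *: em a + d *: em b) W + bl S W (c *: em a + d *: em b) = 0.
  by rewrite -(bl_tr S _ W) -blDm bl_ld TW ld0r.
have neg0 x : 0 <= cre (bl S (em x) (em x)) -> x = @vzero R n.
  by move=> x0; have [//|/Sneg] := pselect (x = @vzero R n); rewrite ltNge x0.
have le0 x : cre (bl S (em x) (em x)) <= 0.
  by have [->|/Sneg/ltW//] := pselect (x = @vzero R n); rewrite em0 bl0l.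
have := congr1 (@cre R) (E 1 (- cI R)).
have I2 : cI R * cI R = -1 by apply: complex_ext; rewrite ?creE /=; ring.
have -> : bl S (1 *: em a + - cI R *: em b) W + bl S W (1 *: em a + - cI R *: em b) =
  cR 2 * (bl S (em a) (em a) + bl S (em b) (em b)).
  rewrite /W !blDl !blDr !blZl !blZr (cR_nat R 2).
  ring: I2.
rewrite cre_cRM cre_add => s0; rewrite /W.
have -> : a = @vzero R n by apply: neg0; have := le0 b; lra.
have -> : b = @vzero R n by apply: neg0; have := le0 a; lra.
by rewrite em0 scaler0 addr0.
Qed.

(** The critical point [- T^{-1} l], with [T = S + S^T], is complex in general, so centring the
    integral there relies on [gauss_shift]. *)
Lemma gauss_complete_square l k :
  Cint (@cptmu R n) (fun y => cexp (qp S l k (em y))) =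
  cexp (k - bl S (invmx (S + S^T) *m l) (invmx (S + S^T) *m l)) *
  Cint (@cptmu R n) (fun y => cexp (qp S 0 0 (em y))).
Proof.
set T := S + S^T; have uT := negdef_unit; pose W := - (invmx T *m l).
have TW : T *m W = - l by rewrite /W mulmxN mulmxA mulmxV// mul1mx.
rewrite -(gauss_shift _ _ W Sneg) -CintZ; last exact: gauss_qp_cinteg0.
apply: eq_Cint => y; rewrite -cexpD; congr cexp.
rewrite qpD -/T TW addrN /qp !ld0l !addr0 addrC; congr (_ + _).
have -> : ld l W = - (bl S W W + bl S W W).
  by rewrite -{2}(bl_tr S) -blDm -/T bl_ld TW (ldC W) ldNl opprK.
rewrite /W blNl blNr opprK; ring.
Qed.

End NegativeDefinite.

Lemma oppmx_affine (K : comNzRingType) m (U L1 L2 : 'M[K]_m) (l e1 e2 : 'cV[K]_m) (c : K) :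
  - (U *m (l + c *: (L1 *m e1 + L2 *m e2))) =
  - (U *m l) + (- (U *m (c *: L1)) *m e1 + - (U *m (c *: L2)) *m e2).
Proof.
rewrite mulmxDr opprD !mulNmx -[in RHS]opprD -!mulmxA -[in RHS]mulmxDr; congr (_ - _ *m _).
by rewrite -!scalemxAl scalerDr.
Qed.

(** * Integrability of the Toeplitz kernel in each variable *)

Section KernelDecay.
Variables (R : realType) (n : nat).
Local Notation C := (R[i]).
Local Notation mcpt := (@mcpt R n).
Local Notation mu := (@cptmu R n).
Variable h : 'M[C]_n.
Local Notation Hr := (Hr h).
Local Notation SH := (SH h).
Hypothesis hherm : forall j k, conjc (h j k) = h k j.
Hypothesis hpos : forall z, z <> @vzero R n -> 0 < Hr z.
Variables (Sq : 'M[C]_(n + n)) (lq : 'cV[C]_(n + n)) (kq : C).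
Hypothesis Sq_lt : forall y, y <> @vzero R n -> cre (bl Sq (em y) (em y)) < Hr y.

Let S := Sq + cR (- 2) *: SH.
Let T := S + S^T.
(** [W0 + MA em x + MB em z] is the critical point for the linear part [kernel_lin x z]. *)
Let MA := - (invmx T *m (2 *: SH^T)).
Let MB := - (invmx T *m (2 *: SH)).
Let W0 := - (invmx T *m lq).

Let Sneg : negdef S. Proof. by apply: (negdef_sub hpos Sq_lt); rewrite ler1n. Qed.

Let SHem z : SH *m em z = col_mx (h *m cv (vconj z)) 0.
Proof. by rewrite emE /SH mul_block_col !mul0mx add0r addr0. Qed.

Let SHTem z : SH^T *m em z = col_mx 0 (h^T *m cv z).
Proof. by rewrite emE /SH tr_block_mx !trmx0 mul_block_col !mul0mx !addr0. Qed.

Let h_inj z : h *m cv (vconj z) = 0 -> z = @vzero R n.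
Proof.
move=> hz; have [//|/hpos] := pselect (z = @vzero R n).
by rewrite -[Hr z]/(cre (Hs h z z)) HsE bl_ld hz ld0r ltxx.
Qed.

Let hT_inj z : h^T *m cv z = 0 -> z = @vzero R n.
Proof.
move=> hz; have [//|/hpos] := pselect (z = @vzero R n).
by rewrite -[Hr z]/(cre (Hs h z z)) HsE -bl_tr bl_ld hz ld0r ltxx.
Qed.

Lemma toeplitz_kernel_phase x z : cabs (toeplitz_kernel h Sq lq kq x z) * expR (- (Hr x + Hr z)) =
  expR (cre kq) * cabs (Cint mu (fun y => cexp (qp S 0 0 (em y)))) * expR (- quad_phase h S MA MB W0 x z).
Proof.
have -> : toeplitz_kernel h Sq lq kq x z = Cint mu (fun y => cexp (qp S (kernel_lin h lq x z) kq (em y))).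
  by apply: eq_Cint => y; rewrite -(kernel_exponent h Sq lq kq 2 x z) (cR_nat R 2).
rewrite gauss_complete_square// -/T cabsM cabs_cexp cre_sub -(opprK (bl S _ _)) -blNl -blNr.
have -> : - (invmx T *m kernel_lin h lq x z) = W0 + (MA *m em x + MB *m em z).
  by rewrite /kernel_lin -(SHem z) -(SHTem x); exact: oppmx_affine.
rewrite mulrAC -expRD [in RHS]mulrAC -expRD; congr (expR _ * _).
by rewrite /quad_phase; ring.
Qed.

(** This block is the mixed Hessian of [q - 2 H], minus the matrix in the determinant condition. *)
Hypothesis unitN : ursubmx T \in unitmx.

Let Tsym : T^T = T. Proof. by rewrite /T linearD /= trmxK addrC. Qed.

Let Tunit : T \in unitmx. Proof. exact: negdef_unit. Qed.

Let TMA x : T *m (MA *m em x) = - (2 *: col_mx 0 (h^T *m cv x)).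
Proof. by rewrite /MA -SHTem mulNmx mulmxN mulmxA mulKVmx// -scalemxAl. Qed.

Let TMB z : T *m (MB *m em z) = - (2 *: col_mx (h *m cv (vconj z)) 0).
Proof. by rewrite /MB -SHem mulNmx mulmxN mulmxA mulKVmx// -scalemxAl. Qed.

Let bl_sym u v : bl S u v + bl S v u = ld u (T *m v).
Proof. by rewrite -(bl_tr S u v) -blDm bl_ld. Qed.

Let ldNr m (u v : 'cV[C]_m) : ld u (- v) = - ld u v.
Proof. by rewrite ldC ldNl ldC. Qed.

Let unit_eq0 m (A : 'M[C]_m) (u : 'cV_m) : A \in unitmx -> A *m u = 0 -> u = 0.
Proof. by move=> uA Au; rewrite -(mulKmx uA u) Au mulmx0. Qed.

Let ld_trmx (A : 'M[C]_n) u v : ld u (A^T *m v) = ld v (A *m u).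
Proof. by rewrite -!bl_ld bl_tr. Qed.

Let cvE (u : 'cV[C]_n) : u = cv (fun j => u j 0).
Proof. by apply/matrixP => i j; rewrite ord1 mxE. Qed.

Let hunit : h \in unitmx.
Proof.
apply: unitmx_inj => u; rewrite [u]cvE -[X in cv X]vconjK => /h_inj ->.
by rewrite vconj0 cv0.
Qed.

(* Replacing [xi] by [- i xi] upgrades vanishing of the real part to vanishing. *)
Let ld_re_eq0 (u : 'cV[C]_n) : (forall xi : cpt R n, cre (ld (cv xi) u) = 0) -> u = 0.
Proof.
move=> H; apply: ld_nondeg => v; rewrite ldC [v]cvE.
apply: complex_ext; first exact: H.
have := H (vscale (- cI R) (fun j => v j 0)); rewrite cvZ ldZl cre_mul /=.
by rewrite oppr0 mul0r sub0r mulN1r opprK.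
Qed.

Let cre_two (z : C) : cre (- (2 * z)) = 0 -> cre z = 0.
Proof. by rewrite -(cR_nat R 2) cre_opp cre_cRM; lra. Qed.

(** Let [y = MB em v]. By [TMA] the hypothesis pairs every [xi] with [h] times the lower half of
    [y], which is therefore zero. By [TMB] the lower half of [T y] is zero, and by [unitN] so is the
    upper half of [y]. Then [T y = 0], which says [h conj v = 0]. *)
Let nondegAB v : (forall xi, cre (bl S (MA *m em xi) (MB *m em v) +
  bl S (MB *m em v) (MA *m em xi)) = 0) -> v = @vzero R n.
Proof.
move=> H; have := TMB v; move: H; generalize (MB *m em v) => y H Ty.
have yd : dsubmx y = 0.
  apply: (unit_eq0 hunit); apply: ld_re_eq0 => xi; apply: cre_two; rewrite -(H xi).
  by rewrite addrC bl_sym TMA -{2}[y]vsubmxK ldNr ldZr ld_col ld0r add0r ld_trmx.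
have yu : usubmx y = 0.
  apply: (@unit_eq0 _ (ursubmx T)^T); first by rewrite unitmx_tr.
  have := congr1 dsubmx Ty.
  rewrite -{1}[y]vsubmxK yd -{1}[T]submxK mul_block_col !mulmx0 !addr0 col_mxKd.
  by rewrite -scalerN opp_col_mx scale_col_mx col_mxKd oppr0 scaler0 trmx_ursub Tsym.
apply: h_inj; move: Ty; rewrite -[y]vsubmxK yu yd col_mx0 mulmx0 => /esym/eqP.
rewrite oppr_eq0 scaler_eq0 pnatr_eq0 /= => /eqP /(congr1 usubmx).
by rewrite col_mxKu linear0.
Qed.

(** The mirror image of [nondegAB], with the halves exchanged and [h^T] in place of [h]. *)
Let nondegBA v : (forall xi, cre (bl S (MB *m em xi) (MA *m em v) +
  bl S (MA *m em v) (MB *m em xi)) = 0) -> v = @vzero R n.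
Proof.
move=> H; have := TMA v; move: H; generalize (MA *m em v) => y H Ty.
have yu : usubmx y = 0.
  apply: (@unit_eq0 _ h^T); first by rewrite unitmx_tr.
  apply: ld_re_eq0 => xi; apply: cre_two; rewrite -(H (vconj xi)).
  by rewrite addrC bl_sym TMB -{2}[y]vsubmxK ldNr ldZr ld_col ld0r addr0 ld_trmx vconjK.
have yd : dsubmx y = 0.
  apply: (@unit_eq0 _ (ursubmx T)) => //.
  have := congr1 usubmx Ty.
  rewrite -{1}[y]vsubmxK yu -{1}[T]submxK mul_block_col !mulmx0 !add0r col_mxKu.
  by rewrite -scalerN opp_col_mx scale_col_mx col_mxKu oppr0 scaler0.
apply: hT_inj; move: Ty; rewrite -[y]vsubmxK yu yd col_mx0 mulmx0 => /esym/eqP.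
rewrite oppr_eq0 scaler_eq0 pnatr_eq0 /= => /eqP /(congr1 dsubmx).
by rewrite col_mxKd linear0.
Qed.

Lemma quad_phaseC x z : quad_phase h S MA MB W0 x z = quad_phase h S MB MA W0 z x.
Proof. by rewrite /quad_phase [Hr x + _]addrC [MA *m _ + _]addrC. Qed.

Lemma toeplitz_kernel_schur (B : R) :
  (forall x z, cabs (toeplitz_kernel h Sq lq kq x z) <= B * expR (Hr x + Hr z)) ->
  exists K : cpt R n -> cpt R n -> R, [/\ forall x z, 0 <= K x z,
    forall x z, cabs (toeplitz_kernel h Sq lq kq x z) * expR (- (Hr x + Hr z)) = K x z,
    measurable_fun setT (fun p : mcpt * mcpt => K p.1 p.2) & exists c : R,
    (forall x, \int[mu]_z (K x z)%:E <= c%:E)%E /\ (forall z, \int[mu]_x (K x z)%:E <= c%:E)%E].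
Proof.
move=> tB; pose I0 := expR (cre kq) * cabs (Cint mu (fun y => cexp (qp S 0 0 (em y)))).
pose K x z := I0 * expR (- quad_phase h S MA MB W0 x z).
have I00 : 0 <= I0 by rewrite mulr_ge0 ?expR_ge0 ?cabs_ge0.
exists K; split.
- by move=> x z; rewrite mulr_ge0 ?expR_ge0.
- exact: toeplitz_kernel_phase.
- apply: measurable_funM => //; apply: measurableT_comp => //; apply: measurableT_comp => //.
  by apply: measurable_quad_phase; [exact: measurable_fst|exact: measurable_snd].
(* If the Gaussian constant vanishes then so does the kernel. Otherwise dividing by it turns the
   upper bound on the kernel into a lower bound on the phase. *)
have [I0z|I0n] := eqVneq I0 0.
  by exists 0; split => x; rewrite integral0_eq// => z _; rewrite /K I0z mul0r.
have {I0n} I0p : 0 < I0 by rewrite lt_neqAle eq_sym I0n.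
have Kle x z : K x z <= `|B| + 1.
  rewrite /K -toeplitz_kernel_phase expRN ler_pdivrMr ?expR_gt0//.
  apply: (le_trans (tB x z)); rewrite ler_wpM2r ?expR_ge0//.
  by have := ler_norm B; lra.
have ge x z : - ln ((`|B| + 1) / I0) <= quad_phase h S MA MB W0 x z.
  have := Kle x z; rewrite /K -ler_pdivlMl// [_^-1 * _]mulrC => le1.
  have pos : 0 < (`|B| + 1) / I0 by rewrite divr_gt0// ltr_wpDl.
  by rewrite lerNl -ler_expR lnK.
have [c1 H1] := phase_integral_bound hherm nondegAB ge.
(* Exchanging [MA] with [MB] and [x] with [z] leaves the phase unchanged, so the integral over the
   first variable is bounded by the same lemma. *)
have ge2 x z : - ln ((`|B| + 1) / I0) <= quad_phase h S MB MA W0 x z.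
  by rewrite -quad_phaseC.
have [c2 H2] := phase_integral_bound hherm nondegBA ge2.
have mK (MA' MB' : 'M[C]_(n + n)) x :
    measurable_fun setT (fun z : mcpt => (expR (- quad_phase h S MA' MB' W0 x z))%:E).
  apply/measurable_EFinP; apply: measurableT_comp => //; apply: measurableT_comp => //.
  by apply: measurable_quad_phase => //; exact: measurable_cst.
exists (I0 * (`|c1| + `|c2|)); split => x.
- under eq_integral do rewrite EFinM.
  rewrite ge0_integralZl//.
  rewrite (EFinM I0); apply: lee_wpmul2l; first by rewrite lee_fin.
  apply: (le_trans (H1 x)).
  by rewrite lee_fin; have := ler_norm c1; have := normr_ge0 c2; lra.
- under eq_integral do rewrite /K quad_phaseC EFinM.
  rewrite ge0_integralZl//.
  rewrite (EFinM I0); apply: lee_wpmul2l; first by rewrite lee_fin.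
  apply: (le_trans (H2 x)).
  by rewrite lee_fin; have := ler_norm c2; have := normr_ge0 c1; lra.
Qed.

End KernelDecay.

(** * The Schur test *)

Section SchurTest.
Variables (R : realType) (d : measure_display) (X : measurableType d).
Variable mu : {sigma_finite_measure set X -> \bar R}.
Variables (K : X -> X -> R) (c : R).
Hypotheses (K0 : forall x z, 0 <= K x z) (mK : measurable_fun setT (fun p : X * X => K p.1 p.2)).
Hypotheses (Kx : forall x, (\int[mu]_z (K x z)%:E <= c%:E)%E).
Hypotheses (Kz : forall z, (\int[mu]_x (K x z)%:E <= c%:E)%E).
Variables (f g : X -> R).
Hypotheses (f0 : forall x, 0 <= f x) (g0 : forall x, 0 <= g x).
Hypotheses (mf : measurable_fun setT f) (mg : measurable_fun setT g).
Hypothesis gK : forall x, ((g x)%:E <= \int[mu]_z (K x z * f z)%:E)%E.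

Let mKx x : measurable_fun setT (K x).
Proof. exact: (measurableT_comp mK (pair1_measurable x)). Qed.

Let mKz z : measurable_fun setT (K^~ z).
Proof. exact: (measurableT_comp mK (pair2_measurable z)). Qed.

Let c_ge0 (x : X) : 0 <= c.
Proof.
by rewrite -lee_fin; apply: le_trans (Kx x); apply: integral_ge0 => z _; rewrite lee_fin.
Qed.

(* AM-GM: [K f <= (s K + K f^2 / s) / 2] with [s = g x / c]. *)
Lemma schur_pointwise x : ((g x ^+ 2)%:E <= (c + 1)%:E * \int[mu]_z (K x z * f z ^+ 2)%:E)%E.
Proof.
(* [c + 1] serves as a positive divisor even when [c = 0]. *)
set J := (\int[mu]_z _)%E; set b := c + 1.
have b0 : 0 < b by rewrite ltr_wpDl// (c_ge0 x).
have J0 : (0 <= J)%E by apply: integral_ge0 => z _; rewrite lee_fin mulr_ge0 ?sqr_ge0.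
have [gx0|gx0] := eqVneq (g x) 0.
  by rewrite gx0 expr0n /= mule_ge0// lee_fin ltW.
have gp : 0 < g x by rewrite lt_neqAle eq_sym gx0 g0.
pose s := g x / b.
have s0 : 0 < s by rewrite divr_gt0.
have mJ : measurable_fun setT (fun z => (K x z * f z ^+ 2)%:E).
  by apply/measurable_EFinP; apply: measurable_funM => //; exact: measurable_funX.
have mK' : measurable_fun setT (fun z => (K x z)%:E) by apply/measurable_EFinP.
have ps : 0 <= s / 2 by rewrite divr_ge0 ?ltW.
have qs : 0 <= s^-1 / 2 by rewrite divr_ge0 ?invr_ge0 ?ltW.
have E : (\int[mu]_z ((s / 2)%:E * (K x z)%:E + (s^-1 / 2)%:E * (K x z * f z ^+ 2)%:E) =
    (s / 2)%:E * \int[mu]_z (K x z)%:E + (s^-1 / 2)%:E * J)%E.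
  rewrite ge0_integralD//; [congr (_ + _)%E| | | |]; try exact: measurable_funeM.
  - by rewrite ge0_integralZl// => z _; rewrite lee_fin.
  - by rewrite ge0_integralZl// => z _; rewrite lee_fin mulr_ge0 ?sqr_ge0.
  - by move=> z _; rewrite -EFinM lee_fin mulr_ge0.
  - by move=> z _; rewrite -EFinM lee_fin mulr_ge0// mulr_ge0 ?sqr_ge0.
have step : (\int[mu]_z (K x z * f z)%:E <= (s / 2)%:E * c%:E + (s^-1 / 2)%:E * J)%E.
  apply: (@le_trans _ _ ((s / 2)%:E * \int[mu]_z (K x z)%:E + (s^-1 / 2)%:E * J)%E); last first.
    by apply: leeD => //; apply: lee_wpmul2l => //; rewrite lee_fin.
  rewrite -E; apply: ge0_le_integral => //.
  - by move=> z _; rewrite lee_fin mulr_ge0.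
  - by apply/measurable_EFinP; apply: measurable_funM.
  - by apply: emeasurable_funD; exact: measurable_funeM.
  - move=> z _; rewrite -!EFinM -EFinD lee_fin.
    have -> : s / 2 * K x z + s^-1 / 2 * (K x z * f z ^+ 2) =
      K x z * f z + K x z * ((s - f z) ^+ 2 / (2 * s)) by field; rewrite gt_eqF.
    by rewrite lerDl mulr_ge0// divr_ge0 ?sqr_ge0// mulr_ge0 ?ltW.
have := le_trans (gK x) step; move: J0; case: J {E step} => [j| |]//.
- rewrite lee_fin => j0; rewrite -!EFinM -EFinD !lee_fin => le1.
  have le2 : g x * g x <= g x / b / 2 * c * g x + (g x / b)^-1 / 2 * j * g x.
    by rewrite -mulrDl ler_wpM2r// ltW.
  have e1 : (g x / b)^-1 / 2 * j * g x = b * j / 2 by field; rewrite !gt_eqF.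
  have e2 : g x / b / 2 * c * g x <= g x * g x / 2.
    have -> : g x / b / 2 * c * g x = (g x * g x / 2) * (c / b) by field; rewrite gt_eqF.
    rewrite ler_piMr ?divr_ge0 ?mulr_ge0// ler_pdivrMr// mul1r /b; lra.
  rewrite expr2; lra.
- by move=> _ _; rewrite gt0_muley ?lte_fin// leey.
Qed.

Lemma schur_test : (\int[mu]_x (g x ^+ 2)%:E <= ((c + 1) * (c + 1))%:E * \int[mu]_z (f z ^+ 2)%:E)%E.
Proof.
(* The sign of [c] is obtained at a point, so an empty space is treated apart. *)
have [[x0]|noX] := pselect (inhabited X); last first.
  by rewrite !integral0_eq ?mule0// => x; case: noX; exists.
have c1 : 0 <= c + 1 by rewrite addr_ge0// (c_ge0 x0).
have f2m : measurable_fun setT (fun z => (f z ^+ 2)%:E).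
  by apply/measurable_EFinP; exact: measurable_funX.
have f20 z : setT z -> (0 <= (f z ^+ 2)%:E)%E by rewrite lee_fin sqr_ge0.
have g2m : measurable_fun setT (fun z => (g z ^+ 2)%:E).
  by apply/measurable_EFinP; exact: measurable_funX.
have mKf : measurable_fun setT (fun p : X * X => (K p.1 p.2 * f p.2 ^+ 2)%:E).
  apply/measurable_EFinP; apply: measurable_funM => //; apply: measurable_funX.
  by apply: (measurableT_comp mf); exact: measurable_snd.
have Kf0 (p : X * X) : (0 <= (K p.1 p.2 * f p.2 ^+ 2)%:E)%E by rewrite lee_fin mulr_ge0 ?sqr_ge0.
have mF : measurable_fun setT (fun x => \int[mu]_z (K x z * f z ^+ 2)%:E)%E.
  exact: (@measurable_fun_fubini_tonelli_F _ _ _ _ _ mu _ mKf Kf0).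
have mG : measurable_fun setT (fun z => \int[mu]_x (K x z * f z ^+ 2)%:E)%E.
  exact: (@measurable_fun_fubini_tonelli_G _ _ _ _ _ mu _ mKf Kf0).
have F0 x : setT x -> (0 <= \int[mu]_z (K x z * f z ^+ 2)%:E)%E.
  by move=> _; apply: integral_ge0 => z _; exact: (Kf0 (x, z)).
have swap := @fubini_tonelli _ _ _ _ _ mu mu _ mKf Kf0.
apply: (@le_trans _ _ (\int[mu]_x ((c + 1)%:E * \int[mu]_z (K x z * f z ^+ 2)%:E))%E).
  apply: ge0_le_integral; first exact: measurableT.
  - by move=> x _; rewrite lee_fin sqr_ge0.
  - exact: g2m.
  - exact: measurable_funeM.
  - by move=> x _; exact: schur_pointwise.
rewrite (ge0_integralZl mu measurableT mF F0); last by rewrite lee_fin.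
rewrite EFinM -muleA; apply: lee_wpmul2l; first by rewrite lee_fin.
rewrite swap -(ge0_integralZl mu measurableT f2m f20); last by rewrite lee_fin.
apply: ge0_le_integral; first exact: measurableT.
- by move=> z _; apply: integral_ge0 => x _; exact: (Kf0 (x, z)).
- exact: mG.
- exact: measurable_funeM.
- move=> z _ /=; under eq_integral do rewrite mulrC EFinM.
  rewrite (ge0_integralZl mu measurableT (f := fun x => (K x z)%:E)).
  + rewrite muleC; apply: lee_wpmul2r; first by rewrite lee_fin sqr_ge0.
    by apply: (le_trans (Kz z)); rewrite lee_fin lerDl.
  + exact/measurable_EFinP.
  + by move=> x _; rewrite lee_fin.
  + by rewrite lee_fin sqr_ge0.
Qed.

End SchurTest.

(** * Boundedness for a Hermitian weight *)

Section HermitianWeight.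
Variables (R : realType) (n : nat).
Local Notation C := (R[i]).
Local Notation mcpt := (@mcpt R n).
Local Notation mu := (@cptmu R n).
Variable h : 'M[C]_n.
Local Notation Hr := (Hr h).
Local Notation SH := (SH h).
Hypothesis hherm : forall j k, conjc (h j k) = h k j.
Hypothesis hpos : forall z, z <> @vzero R n -> 0 < Hr z.
Variables (Sq : 'M[C]_(n + n)) (lq : 'cV[C]_(n + n)) (kq : C).
Hypothesis Sq_lt : forall y, y <> @vzero R n -> cre (bl Sq (em y) (em y)) < Hr y.

Lemma cmeas_toeplitz_kernel x : cmeas (fun z : mcpt => toeplitz_kernel h Sq lq kq x z).
Proof.
apply: (cmeas_Cint mu (f := fun p : mcpt * mcpt => cexp (qp Sq lq kq (em p.2) + 2 * Hs h x p.2 +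
  2 * Hs h p.2 p.1 - 2 * Hs h p.2 p.2))).
have m1 : measurable_fun setT (fun p : mcpt * mcpt => p.1) by exact: measurable_fst.
have m2 : measurable_fun setT (fun p : mcpt * mcpt => p.2) by exact: measurable_snd.
have mx : measurable_fun setT (fun p : mcpt * mcpt => x : mcpt) by exact: measurable_cst.
have two (k : mcpt * mcpt -> C) : cmeas k -> cmeas (fun p => 2 * k p).
  by move=> mk; apply: cmeasM => //; exact: cmeas_cst.
apply: cmeas_cexp; apply: cmeasB; last by apply: two; exact: cmeas_Hs_comp.
apply: cmeasD; last by apply: two; exact: cmeas_Hs_comp.
apply: cmeasD; last by apply: two; exact: cmeas_Hs_comp.
exact: (cmeas_comp m2 (cmeas_qp Sq lq kq)).
Qed.

(** The image [g] enters through its reproducing identity and not through [is_proj], so that the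
    bound applies to functions already multiplied by [e^{-f}]. *)
Lemma toeplitz_bound_hermitian (c M0 : R) : 0 < c ->
  (\int[mu]_z (expR (- (2 * Hr z)))%:E = c%:E)%E ->
  ursubmx (Sq + cR (- 2) *: SH + (Sq + cR (- 2) *: SH)^T) \in unitmx ->
  (\int[mu]_w (if M0 < cabs (weyl_integral h Sq lq kq w) then 1 else 0)%:E = 0)%E ->
  exists2 M : R, 0 <= M & forall u g : cpt R n -> C, holomorphic u -> L2H h u ->
    L2H h (fun y => cexp (qp Sq lq kq (em y)) * u y) -> cmeas (g : mcpt -> C) ->
    (forall x, Cint mu (fun y => cexp (qp Sq lq kq (em y)) * u y * cexp (2 * Hs h x y - 2 * Hs h y y)) =
      g x * cR c) ->
    (\int[mu]_z (cabs2 (g z) * expR (- 2 * Hr z))%:E <=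
      M%:E * \int[mu]_z (cabs2 (u z) * expR (- 2 * Hr z))%:E)%E.
Proof.
move=> c0 cE uN aM.
have [B tB] := toeplitz_kernel_bound hherm hpos Sq_lt aM.
have [K [K0 KE mK [b [Kx Kz]]]] := toeplitz_kernel_schur hherm hpos Sq_lt uN tB.
(* [toeplitz_kernel_repr] controls [c * c * g], whence [c^4] after squaring. *)
pose q := c * c * (c * c); have q0 : 0 < q by rewrite !mulr_gt0.
exists ((b + 1) * (b + 1) / q).
  by rewrite divr_ge0 ?(ltW q0)// -expr2 sqr_ge0.
move=> u g hu u2 Qu2 mg gE; have mu_ := hol_cmeas hu.
pose f z := cabs (u z) * expR (- Hr z).
pose F x := cabs (g x) * expR (- Hr x) * (c * c).
have mw (v : mcpt -> C) : cmeas v -> measurable_fun setT (fun z : mcpt => cabs (v z) * expR (- Hr z)).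
  move=> mv; apply: measurable_funM; first exact: measurable_cabs.
  by apply: measurableT_comp => //; apply: measurableT_comp => //; exact: measurable_Hr.
have mF : measurable_fun setT (F : mcpt -> R) by apply: measurable_funM => //; exact: mw.
have sq (v : C) z : (cabs v * expR (- Hr z)) ^+ 2 = cabs2 v * expR (- 2 * Hr z).
  rewrite exprMn sqr_cabs; congr (_ * _).
  by rewrite expr2 -expRD; congr expR; ring.
have FK x : ((F x)%:E <= \int[mu]_z (K x z * f z)%:E)%E.
  have cmk : cmeas (fun z : mcpt => toeplitz_kernel h Sq lq kq x z * (u z * cexp (- 2 * Hs h z z))).
    apply: cmeasM; first exact: cmeas_toeplitz_kernel.
    apply: cmeasM => //; apply: cmeas_cexp; apply: cmeasM; first exact: cmeas_cst.
    by apply: cmeas_Hs_comp; exact: measurable_id.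
  have := cabs_Cint_le_ge0 mu cmk.
  rewrite -(toeplitz_kernel_repr hherm hpos Sq_lt hu u2 Qu2 cE (gE x)) cabsM cabs_cR => le1.
  have -> : F x = expR (- Hr x) * (cabs (g x) * `|c * c|).
    by rewrite /F ger0_norm ?mulr_ge0 ?ltW//; ring.
  rewrite EFinM; apply: (@le_trans _ _ ((expR (- Hr x))%:E *
    \int[mu]_z (cabs (toeplitz_kernel h Sq lq kq x z * (u z * cexp (- 2 * Hs h z z))))%:E)%E).
    by apply: lee_wpmul2l => //; rewrite lee_fin expR_ge0.
  rewrite -ge0_integralZl//; last 2 first.
  - by apply/measurable_EFinP; exact: measurable_cabs.
  - by move=> z _; rewrite lee_fin cabs_ge0.
  rewrite (_ : (\int[mu]_z _)%E = (\int[mu]_z (K x z * f z)%:E)%E)//.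
  apply: eq_integral => z _; rewrite -EFinM; congr EFin.
  rewrite -KE /f !cabsM cabs_cexp -(cR_nat R 2) -cRN cre_cRM -/(Hr z) [- (Hr x + _)]opprD expRD.
  have -> : expR (- 2 * Hr z) = expR (- Hr z) * expR (- Hr z) by rewrite -expRD; congr expR; ring.
  ring.
have f0 z : 0 <= cabs (u z) * expR (- Hr z) by rewrite mulr_ge0 ?cabs_ge0 ?expR_ge0.
have F0 z : 0 <= F z by rewrite mulr_ge0 ?mulr_ge0 ?cabs_ge0 ?expR_ge0 ?ltW.
have := @schur_test _ _ mcpt mu K b K0 mK Kx Kz f F f0 F0 (mw u mu_) mF FK.
have -> : (\int[mu]_x (F x ^+ 2)%:E)%E = (q%:E * \int[mu]_z (cabs2 (g z) * expR (- 2 * Hr z))%:E)%E.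
  rewrite -ge0_integralZl//; last 3 first.
  - by apply/measurable_EFinP; exact: measurable_L2H.
  - by move=> z _; rewrite lee_fin mulr_ge0 ?cabs2_ge0 ?expR_ge0.
  - by rewrite lee_fin ltW.
  by apply: eq_integral => z _; rewrite -EFinM -sq /F /q; congr EFin; ring.
under [X in (_ <= _ * X)%E -> _]eq_integral do rewrite /f sq.
move=> H; rewrite mulrC EFinM -muleA.
rewrite -(@lee_pmul2l _ q%:E) ?lte_fin//.
rewrite [leRHS]muleA -EFinM divff ?gt_eqF// mul1e.
exact: H.
Qed.

End HermitianWeight.

(** * Reduction to the Hermitian weight *)

Section QuadraticForms.
Variables (R : realType) (n : nat).
Local Notation C := (R[i]).
Implicit Types (A B D : 'M[C]_n) (x : cpt R n).

Lemma sqr_cI : cI R * cI R = -1.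
Proof. by apply: complex_ext; rewrite ?creE /=; ring. Qed.

Lemma cR_cre (z : C) : cR (cre z) = 2^-1 * (z + conjc z).
Proof. by rewrite add_conj cRM (cR_nat R 2) mulKf// pnatr_eq0. Qed.

Lemma cR_cim (z : C) : cR (cim z) = - (2^-1 * cI R * (z - conjc z)).
Proof.
have -> : z - conjc z = 2 * (cI R * cR (cim z)).
  by rewrite -(cR_nat R 2); apply: complex_ext; rewrite ?creE /=; ring.
have two : (2 : C) != 0 by rewrite pnatr_eq0.
rewrite -mulrA (mulrC (cI R)) -mulrA mulKf// mulrC mulrA sqr_cI; ring.
Qed.

(* From [Re z = (z + z^* ) / 2] and [Im z = (z - z^* ) / 2i]. *)
Definition cqform_mx A B D : 'M[C]_(n + n) :=
  4^-1 *: block_mx (A - cI R *: B - D) (A + cI R *: B + D) (A - cI R *: B + D) (A + cI R *: B - D).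

Definition clform_col (d e : cpt R n) : 'cV[C]_(n + n) :=
  2^-1 *: col_mx (cv (fun j => d j - cI R * e j)) (cv (fun j => d j + cI R * e j)).

Lemma cqformE A B D x : cqform A B D x = bl (cqform_mx A B D) (em x) (em x).
Proof.
rewrite /cqform_mx blZm emE bl_block !blE -!big_split /= mulr_sumr.
apply: eq_bigr => j _; rewrite -!big_split /= mulr_sumr; apply: eq_bigr => k _.
rewrite !cRM !cR_cre !cR_cim !mxE /vconj.
have -> : (4 : C)^-1 = 2^-1 * 2^-1 by rewrite -invfM -natrM.
set t := 2^-1; set a := x j; set b := x k; set a' := conjc _; set b' := conjc _.
set i := cI R; have ii : i * i = -1 := sqr_cI.
ring: ii.
Qed.

Lemma clformE d e x : clform d e x = ld (clform_col d e) (em x).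
Proof.
rewrite /clform_col ldZl emE ld_col !ldE -!big_split /= mulr_sumr.
apply: eq_bigr => j _; rewrite !cR_cre !cR_cim !mxE /vconj; ring.
Qed.

Lemma bl_basis m (M : 'M[C]_m) (j k : 'I_m) : bl M (delta_mx j 0) (delta_mx k 0) = M j k.
Proof.
rewrite blE (bigD1 j)//= (bigD1 k)//= big1 => [|l lk]; last first.
  by rewrite [delta_mx k 0 _ _]mxE (negbTE lk) mulr0.
rewrite big1 => [|l lj]; first by rewrite !mxE !eqxx /= mul1r mulr1 !addr0.
by rewrite big1 // => r _; rewrite [delta_mx j 0 _ _]mxE (negbTE lj) !mul0r.
Qed.

Lemma em_basis c j : em (vscale c (Defs.vbasis R j)) =
  c *: delta_mx (lshift n j) 0 + conjc c *: delta_mx (rshift n j) 0.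
Proof.
apply/matrixP => i k; rewrite ord1 !mxE.
have cb l : conjc (Defs.vbasis R j l) = Defs.vbasis R j l.
  by rewrite /Defs.vbasis; case: ifP; rewrite ?conjc0 ?conjc1.
have [l ->|l ->] := split_ordP i.
  by rewrite emL /vscale /Defs.vbasis eq_lshift eq_lrshift !andbT /= mulr0 addr0; case: (l == j).
rewrite emR /vscale conjcM cb /Defs.vbasis eq_rshift eq_rlshift !andbT /= mulr0 add0r.
by case: (l == j).
Qed.

(** In the variables [(x, conj x)] the Hessian is [S + S^T], and its upper right block pairs [x_j]
    with [conj x_k]. *)
Lemma dxdxbar_bl (S : 'M[C]_(n + n)) : dxdxbar (fun x => bl S (em x) (em x)) = ursubmx (S + S^T).
Proof.
apply/matrixP => j k; rewrite mxE.
have hE u v : hess2 (fun x => bl S (em x) (em x)) u v = bl (S + S^T) (em u) (em v).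
  by rewrite /hess2 emD !blDl !blDr em0 bl0l blDm bl_tr; ring.
rewrite !hE.
have b1 l : em (Defs.vbasis R l) = delta_mx (lshift n l) 0 + delta_mx (rshift n l) 0.
  have -> : Defs.vbasis R l = vscale 1 (Defs.vbasis R l) by apply/funext => i; rewrite /vscale mul1r.
  by rewrite em_basis conjc1 !scale1r.
have ci : conjc (cI R) = - cI R by apply: complex_ext; rewrite ?creE /=; ring.
rewrite !em_basis !b1 ci !(blDl, blDr, blZl, blZr) !bl_basis.
have -> : cR (4^-1 : R) = 4^-1 by rewrite cR_inv ?pnatr_eq0// (cR_nat R 4).
set M := S + S^T; have -> : ursubmx M j k = M (lshift n j) (rshift n k) by rewrite [LHS]mxE [LHS]mxE.
set i := cI R; have ii : i * i = -1 := sqr_cI.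
have four : (4 : C) != 0 by rewrite pnatr_eq0.
apply: (mulfI four); rewrite mulrA mulfV// mul1r.
ring: ii.
Qed.

End QuadraticForms.

(** * Hermitian and pluriharmonic parts of the weight *)

Section RealQuadraticForm.
Variables (R : realType) (n : nat) (A B D : 'M[R]_n).
Local Notation C := (R[i]).
Local Notation Phi := (rqform A B D).

Definition rqform_mx : 'M[C]_(n + n) :=
  cqform_mx (map_mx (@cR R) A) (map_mx (@cR R) B) (map_mx (@cR R) D).

Definition levi_mx : 'M[C]_n := ursubmx (rqform_mx + rqform_mx^T).

(** The factor 2 accounts for the antiholomorphic part of the weight, the conjugate of the
    holomorphic one: their sum is the real part of this function. *)
Definition pluriharmonic (x : cpt R n) : C := 2 * bl (ulsubmx rqform_mx) (cv x) (cv x).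

Lemma rqformE x : cR (Phi x) = bl rqform_mx (em x) (em x).
Proof.
rewrite -cqformE /rqform /cqform cRsum; apply: eq_bigr => j _; rewrite cRsum; apply: eq_bigr => k _.
by rewrite !mxE !cRD -!cRM !mulrA.
Qed.

Let quarter : (4 : C)^-1 = cR 4^-1. Proof. by rewrite cR_inv ?pnatr_eq0// (cR_nat R 4). Qed.

Let cqform_ul (M N P : 'M[C]_n) : ulsubmx (cqform_mx M N P) = 4^-1 *: (M - cI R *: N - P).
Proof. by rewrite /cqform_mx scale_block_mx block_mxKul. Qed.

Let cqform_ur (M N P : 'M[C]_n) : ursubmx (cqform_mx M N P) = 4^-1 *: (M + cI R *: N + P).
Proof. by rewrite /cqform_mx scale_block_mx block_mxKur. Qed.

Let cqform_dl (M N P : 'M[C]_n) : dlsubmx (cqform_mx M N P) = 4^-1 *: (M - cI R *: N + P).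
Proof. by rewrite /cqform_mx scale_block_mx block_mxKdl. Qed.

Let cqform_dr (M N P : 'M[C]_n) : drsubmx (cqform_mx M N P) = 4^-1 *: (M + cI R *: N - P).
Proof. by rewrite /cqform_mx scale_block_mx block_mxKdr. Qed.

Lemma levi_mxE : levi_mx = ursubmx rqform_mx + (dlsubmx rqform_mx)^T.
Proof. by apply/matrixP => j k; rewrite !mxE. Qed.

Lemma levi_herm j k : conjc (levi_mx j k) = levi_mx k j.
Proof.
rewrite levi_mxE ![(_ + _ : 'M[C]_n) _ _]mxE [(_^T : 'M[C]_n) j k]mxE [(_^T : 'M[C]_n) k j]mxE.
rewrite !cqform_ur !cqform_dl quarter; apply: complex_ext; rewrite !mxE ?creE /=; ring.
Qed.

Lemma rqform_split x : cR (Phi x) = Hs levi_mx x x + (bl (ulsubmx rqform_mx) (cv x) (cv x) +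
  bl (drsubmx rqform_mx) (cv (vconj x)) (cv (vconj x))).
Proof.
by rewrite rqformE emE -{1}[rqform_mx]submxK bl_block HsE levi_mxE blDm bl_tr; ring.
Qed.

(** Replacing [x] by [i x] fixes the Hermitian part and changes the sign of the holomorphic and
    antiholomorphic parts, which the average removes. *)
Lemma phi_hermE x : phi_herm Phi x = Hr levi_mx x.
Proof.
suff E : cR (phi_herm Phi x) = Hs levi_mx x x by rewrite /Hr -E.
have two : (2 : C) != 0 by rewrite pnatr_eq0.
have := rqform_split (vscale (cI R) x); rewrite HsZl HsZr vconjZ !cvZ !blZl !blZr.
have ci : conjc (cI R) = - cI R by apply: complex_ext; rewrite ?creE /=; ring.
have -> : cI R * (conjc (cI R) * Hs levi_mx x x) = Hs levi_mx x x by rewrite ci mulrA mulrN sqr_cI opprK mul1r.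
rewrite ci !mulrA mulrNN sqr_cI !mulN1r => E2.
apply: (mulIf two); rewrite /phi_herm -[in LHS](cR_nat R 2) -cRM divfK ?pnatr_eq0// cRD rqform_split E2; ring.
Qed.

Lemma cre_pluriharmonic x : cre (pluriharmonic x) = Phi x - Hr levi_mx x.
Proof.
have E : cre (bl (drsubmx rqform_mx) (cv (vconj x)) (cv (vconj x))) = cre (bl (ulsubmx rqform_mx) (cv x) (cv x)).
  rewrite -[RHS]cre_conj !blE conjc_sum; congr cre; apply: eq_bigr => j _.
  rewrite conjc_sum; apply: eq_bigr => k _; rewrite !conjcM ![cv _ _ _]mxE /vconj; congr (_ * _ * _).
  rewrite cqform_ul cqform_dr quarter; apply: complex_ext; rewrite !mxE ?creE /=; ring.
have := congr1 (@cre R) (rqform_split x); rewrite !cre_add E cre_cR -/(Hr _ _) /pluriharmonic -(cR_nat R 2) cre_cRM; lra.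
Qed.

Lemma hol_pluriharmonic : holomorphic pluriharmonic.
Proof.
apply: holM; first exact: hol_cst.
under eq_fun do rewrite blE.
apply: hol_sum => i; apply: hol_sum => j; apply: holM.
  by apply: holM; [under eq_fun do rewrite mxE; exact: hol_coord|exact: hol_cst].
by under eq_fun do rewrite mxE; exact: hol_coord.
Qed.

Lemma dxdxbar_rqform : dxdxbar (fun x => cR (Phi x)) = levi_mx.
Proof. by rewrite /levi_mx -dxdxbar_bl; congr dxdxbar; apply/funext => x; exact: rqformE. Qed.

Lemma levi_pos : strictly_psh Phi -> forall z, z <> @vzero R n -> 0 < Hr levi_mx z.
Proof.
move=> psh z z0; have := psh z z0; rewrite dxdxbar_rqform; congr (0 < cre _).
rewrite HsE blE; apply: eq_bigr => j _; apply: eq_bigr => k _.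
by rewrite !mxE /vconj [z j * _]mulrC.
Qed.

End RealQuadraticForm.

(** The mixed block sees only the Hermitian part of a weight. This identifies the block of the
    kernel exponent, built from [q - 2 H], with the matrix of the statement, built from
    [2 Phi_0 - q]. *)
Lemma ursubmx_sub_SH (R : realType) n (S P : 'M[R[i]]_(n + n)) :
  ursubmx (S + cR (- 2) *: SH (ursubmx (P + P^T)) + (S + cR (- 2) *: SH (ursubmx (P + P^T)))^T) =
  - ursubmx (cR 2 *: P + (-1) *: S + (cR 2 *: P + (-1) *: S)^T).
Proof.
apply/matrixP => j k; rewrite [RHS]mxE.
have ur (M : 'M[R[i]]_(n + n)) : ursubmx (M + M^T) j k =
  M (lshift n j) (rshift n k) + M (rshift n k) (lshift n j) by rewrite !mxE.
have e (M N : 'M[R[i]]_(n + n)) (a b : R[i]) i l : (a *: M + b *: N) i l = a * M i l + b * N i l.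
  by rewrite !mxE.
have e1 (M N : 'M[R[i]]_(n + n)) (b : R[i]) i l : (M + b *: N) i l = M i l + b * N i l.
  by rewrite !mxE.
rewrite (ur (_ + _ *: SH _)) (ur (_ *: P + _)) !e !e1.
have -> (M : 'M[R[i]]_n) : SH M (lshift n j) (rshift n k) = M j k by rewrite block_mxEur.
have -> (M : 'M[R[i]]_n) : SH M (rshift n k) (lshift n j) = 0 by rewrite block_mxEdl mxE.
by rewrite ur cRN (cR_nat R 2); ring.
Qed.

(** * Removing the pluriharmonic part of the weight *)

Section Reduction.
Variables (R : realType) (n : nat) (A B D : 'M[R]_n).
Local Notation C := (R[i]).
Local Notation mcpt := (@mcpt R n).
Local Notation mu := (@cptmu R n).
Local Notation Phi := (rqform A B D).
Local Notation h := (levi_mx A B D).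
Local Notation f := (pluriharmonic A B D).
Hypothesis hpos : forall z, z <> @vzero R n -> 0 < Hr h z.

Let hherm := levi_herm A B D.

Lemma weight_twist (v : C) x :
  cabs2 v * expR (- 2 * Phi x) = cabs2 (v * cexp (- f x)) * expR (- 2 * Hr h x).
Proof.
rewrite cabs2M cabs2_cexp cre_opp cre_pluriharmonic -mulrA; congr (_ * _).
by rewrite expr2 -!expRD; congr expR; ring.
Qed.

Lemma hol_twist s (u : cpt R n -> C) : holomorphic u -> holomorphic (fun x => u x * cexp (s * f x)).
Proof.
move=> hu; apply: holM => //; apply: hol_comp; first exact: cdiff_cexp.
by apply: holM; [exact: hol_cst|exact: hol_pluriharmonic].
Qed.

Let cmf : cmeas (f : mcpt -> C). Proof. by apply: hol_cmeas; exact: hol_pluriharmonic. Qed.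

Lemma niint_twist (v : mcpt -> C) : cmeas v ->
  niint (fun x => (cabs2 (v x) * expR (- 2 * Phi x))%:E) =
  (\int[mu]_x (cabs2 (v x * cexp (- f x)) * expR (- 2 * Hr h x))%:E)%E.
Proof.
move=> mv; rewrite (_ : (fun x => _) =
    fun x : mcpt => (cabs2 (v x * cexp (- f x)) * expR (- 2 * Hr h x))%:E); last first.
  by apply/funext => x; rewrite weight_twist.
rewrite niintE//.
  apply/measurable_EFinP; apply: measurable_L2H; apply: cmeasM => //; apply: cmeas_cexp.
  exact: cmeasN.
by move=> x; rewrite lee_fin mulr_ge0 ?cabs2_ge0 ?expR_ge0.
Qed.

(* Testing [is_proj] against the twisted reproducing kernel at [x]. *)
Lemma proj_reproducing (w g : cpt R n -> C) c : cmeas (w : mcpt -> C) -> inL2w Phi w ->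
  is_proj Phi w g -> (\int[mu]_z (expR (- (2 * Hr h z)))%:E = c%:E)%E -> forall x,
  Cint mu (fun y => w y * cexp (- f y) * cexp (2 * Hs h x y - 2 * Hs h y y)) =
  g x * cexp (- f x) * cR c.
Proof.
move=> mw w2 [[hg g2] orth] cE x; have mg := hol_cmeas hg.
pose w0 (y : mcpt) := w y * cexp (- f y); pose g0 (y : mcpt) := g y * cexp (- f y).
have hg0 : holomorphic g0.
  have := hol_twist (-1) hg; congr holomorphic; apply/funext => y; by rewrite mulN1r.
have mw0 : cmeas w0 by apply: cmeasM => //; apply: cmeas_cexp; exact: cmeasN.
have w02 : L2H h w0 by rewrite /L2H -niint_twist.
have g02 : L2H h g0 by rewrite /L2H -niint_twist.
rewrite -/(g0 x) -(reproducing hherm hpos x hg0 g02 cE).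
have wi := repro_cinteg hpos x mw0 w02.
have gi := repro_cinteg hpos x (hol_cmeas hg0) g02.
apply/eqP; rewrite -subr_eq0 -CintB//; apply/eqP.
pose v y := cexp (2 * Hs h y x) * cexp (1 * f y).
have hv : holomorphic v.
  apply: hol_twist; apply: hol_comp; first exact: cdiff_cexp.
  by apply: holM; [exact: hol_cst|exact: hol_Hsl].
have bv : bargmann Phi v.
  split => //; rewrite /inL2w niint_twist; last exact: hol_cmeas.
  under eq_integral => y _.
    rewrite /v mul1r -mulrA -cexpD addrN cexp0 mulr1 cabs2_cexp -(cR_nat R 2) cre_cRM.
    rewrite (_ : _ * _ = expR (4 * cre (Hs h x y) - 2 * Hr h y)); last first.
      by rewrite expr2 -!expRD (cre_HsC hherm x y); congr expR; ring.
    over.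
  exact: gaussH_lin_lty.
rewrite -(orth v bv) /innerw -ciintE; last exact: cintegB.
congr ciint; apply/funext => y; rewrite /v /w0 /g0 mul1r conjcM !conj_cexp.
have -> : conjc (2 * Hs h y x) = 2 * Hs h x y by rewrite conjcM Hs_conj// -(cR_nat R 2) conj_cR.
(* [e^{-2 Phi}] splits into [e^{-f}], which twists [w - g], then [e^{- conj f}], which cancels the
   factor [e^f] of the conjugated test function, and [e^{-2H}]. *)
have -> : cR (expR (- 2 * Phi y)) = cexp (- f y) * cexp (- conjc (f y)) * cexp (- (2 * Hs h y y)).
  rewrite -cexp_cR -!cexpD; congr cexp; rewrite Hs_real// -(cR_nat R 2) -opprD add_conj.
  by rewrite cre_pluriharmonic -cRM -!cRN -cRD; congr cR; ring.
rewrite cexpD; have := cexpNK (conjc (f y)).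
set a := cexp (conjc _); set b := cexp (- conjc _) => ab.
ring: ab.
Qed.

End Reduction.

Theorem theorem1p1 (R : realType) (n : nat)
  (A B C : 'M[R]_n)                        (* Phi_0 = rqform A B C *)
  (qA qB qC : 'M[R[i]]_n) (d e : cpt R n) (c0 : R[i]) (* Q = q + linear + c0 *)
  (Hpsh : strictly_psh (rqform A B C))
  (Hq : forall x : cpt R n, x <> @vzero R n ->
          cre (cqform qA qB qC x) < phi_herm (rqform A B C) x)
  (Hdet : \det (dxdxbar (fun x => cR (2 * rqform A B C x) - cqform qA qB qC x)) != 0)
  (Ha : ess_bounded (weyl_symbol_noconst (rqform A B C)
          (fun x => cqform qA qB qC x + clform d e x + c0))) :
  toeplitz_exp_bounded (rqform A B C)
    (fun x => cqform qA qB qC x + clform d e x + c0).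
Proof.
set Phi := rqform A B C; set h := levi_mx A B C.
pose Sq := cqform_mx qA qB qC; pose lq := clform_col d e.
pose Q := fun x : cpt R n => cqform qA qB qC x + clform d e x + c0.
have QE x : Q x = qp Sq lq c0 (em x) by rewrite /Q cqformE clformE.
have hherm := levi_herm A B C; have hpos := levi_pos Hpsh.
have Sq_lt y : y <> @vzero R n -> cre (bl Sq (em y) (em y)) < Hr h y.
  by move=> y0; rewrite -cqformE -phi_hermE; exact: Hq.
have unitN : ursubmx (Sq + cR (- 2) *: SH h + (Sq + cR (- 2) *: SH h)^T) \in unitmx.
  suff -> : ursubmx (Sq + cR (- 2) *: SH h + (Sq + cR (- 2) *: SH h)^T) =
      - dxdxbar (fun x => cR (2 * Phi x) - cqform qA qB qC x).
    by rewrite -scaleN1r unitmxZ ?unitrN1// unitmxE unitfE.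
  have -> : (fun x => cR (2 * Phi x) - cqform qA qB qC x) =
      (fun x => bl (cR 2 *: rqform_mx A B C + (-1) *: Sq) (em x) (em x)).
    by apply/funext => x; rewrite (cRM 2 (Phi x)) rqformE cqformE blDm !blZm mulN1r.
  by rewrite dxdxbar_bl -ursubmx_sub_SH.
have [M0 aM] := Ha.
(* The statement's iterated integral becomes an integral for [cptmu] because its Gaussian integrand
   is absolutely integrable. *)
have weylE w : weyl_symbol_noconst Phi Q w = weyl_integral h Sq lq c0 w.
  rewrite /weyl_symbol_noconst /weyl_integral -ciintE; last exact: cinteg_weyl.
  by congr ciint; apply/funext => y; rewrite phi_hermE QE.
have {}aM : (\int[@cptmu R n]_w (if M0 < cabs (weyl_integral h Sq lq c0 w) then 1 else 0)%:E = 0)%E.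
  rewrite -niintE.
  - by rewrite -[RHS]aM; congr niint; apply/funext => w; rewrite -weylE.
  - apply/measurable_EFinP; apply: measurable_fun_ifT => //.
    by apply: measurable_fun_ltr => //; apply: measurable_cabs; exact: cmeas_weyl.
  - by move=> w; case: ifP => _; rewrite lee_fin.
have [c cp cE] := @gaussH_mass R n h hherm hpos 2 ltac:(by []).
have [M M_ge0 HM] := toeplitz_bound_hermitian hherm hpos Sq_lt cp cE unitN aM.
(* [HM] compares squared norms. *)
exists (Num.sqrt M) => u [hu u2] Qu2 g gproj; have [[hg g2] _] := gproj.
have mu_ := hol_cmeas hu; have mg := hol_cmeas hg.
have cmQu : cmeas (fun y : mcpt R n => cexp (Q y) * u y).
  apply: cmeasM => //; apply: cmeas_cexp; have := cmeas_qp Sq lq c0; apply: eq_cmeas => y; by rewrite QE.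
have cmf : cmeas (pluriharmonic A B C : mcpt R n -> R[i]) by apply: hol_cmeas; exact: hol_pluriharmonic.
pose f := pluriharmonic A B C.
have hol0 v : holomorphic v -> holomorphic (fun x => v x * cexp (- f x)).
  by move=> hv; have := hol_twist A B C (-1) hv; congr holomorphic; apply/funext => y; rewrite mulN1r.
have key := HM (fun x => u x * cexp (- f x)) (fun x => g x * cexp (- f x)) (hol0 u hu).
rewrite /l2normw -sqrtrM//; apply: ler_wsqrtr.
move: g2 u2; rewrite /inL2w !niint_twist// => g2 u2.
have Qu2' : L2H h (fun y => cexp (qp Sq lq c0 (em y)) * (u y * cexp (- f y))).
  move: Qu2; rewrite /inL2w niint_twist//; congr (_ < _)%E.
  by apply: eq_integral => y _; rewrite -/(Q y) QE mulrA.
have {}key := key u2 Qu2' (hol_cmeas (hol0 g hg)) _.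
have fin v : (\int[@cptmu R n]_x (cabs2 (v x) * expR (- 2 * Hr h x))%:E < +oo)%E ->
    (\int[@cptmu R n]_x (cabs2 (v x) * expR (- 2 * Hr h x))%:E)%E \is a fin_num.
  move=> v2; rewrite ge0_fin_numE// integral_ge0// => x _.
  by rewrite lee_fin mulr_ge0 ?cabs2_ge0 ?expR_ge0.
rewrite -[M]/(fine M%:E) -fineM ?fin//; apply: fine_le.
- exact: fin.
- by rewrite fin_numM ?fin.
(* The orthogonality in [is_proj] enters here, as the reproducing identity for [g]. *)
apply: key => x; rewrite -(proj_reproducing hpos cmQu Qu2 gproj cE).
by apply: eq_Cint => y; rewrite QE mulrA.
Qed.
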